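(* Let $h\in\{1,2\}$, $d\ge2$ if $h=1$ and $d\ge3$ if $h=2$; let $n\ge1$, $c,R>0$ and $t>\frac Rc$. For the random flight with Dirichlet distributed displacements reflected on the sphere of radius $R$ by circular inversion (defined in the context), the conditional density of $\underline{\mathbf X}_d^*(t)$ given $\mathcal N(t)=n$ is $$p_{n,h}^*(\underline{\mathbf x}_d,t)=\frac{\Gamma(\frac{n+1}2(d-h)+\frac h2)}{\Gamma(\frac n2(d-h))}\frac{1}{\pi^{\frac d2}(ct)^{(n+1)(d-h)+h-2}}\Big[(c^2t^2-\|\underline{\mathbf x}_d\|^2)^{\frac n2(d-h)-1}\mathbf 1_{B_R^d}(\underline{\mathbf x}_d)+\frac{R^{2d}}{\|\underline{\mathbf x}_d\|^{2d}}\Big(c^2t^2-\frac{R^4}{\|\underline{\mathbf x}_d\|^2}\Big)^{\frac n2(d-h)-1}\mathbf 1_{C^d_{\frac{R^2}{ct},R}}(\underline{\mathbf x}_d)\Big].$$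
   Context: Free random flight. A particle starts at the origin of $\mathbb R^d$ and moves at constant speed $c$; $\mathcal N(t)$ is the number of changes of direction in $[0,t]$. Given $\mathcal N(t)=n\ge1$, the vector $\underline\tau_n=(\tau_1,\dots,\tau_n)$ of the lengths of the time intervals between successive changes of direction has, on the open simplex $S_n=\{\tau_k>0,\ \sum_{k=1}^n\tau_k<t\}$, the Dirichlet density $$\frac{\Gamma((n+1)(\frac dh-1))}{\Gamma(\frac dh-1)^{n+1}}\,\frac{1}{t^{(n+1)(\frac dh-1)-1}}\prod_{k=1}^{n+1}\tau_k^{\frac dh-2},\qquad \tau_{n+1}=t-\sum_{k=1}^n\tau_k .$$ The position at time $t$ is then $\underline{\mathbf X}_d(t)=c\sum_{k=1}^{n+1}\underline{\mathbf V}^k\tau_k$ with $\underline{\mathbf V}^k$ independent, uniformly distributed on the unit sphere of $\mathbb R^d$, and independent of the $\tau$'s. Reflected flight, for $t>R/c$ and $\mathcal N(t)\ge1$: with $\mu_R(\underline{\mathbf x}_d)=R^2\underline{\mathbf x}_d/\|\underline{\mathbf x}_d\|^2$, $\underline{\mathbf X}_d^*(t):=\underline{\mathbf X}_d(t)\mathbf 1_{B_R^d}(\underline{\mathbf X}_d(t))+\mu_R(\underline{\mathbf X}_d(t))\mathbf 1_{C^d_{R,ct}}(\underline{\mathbf X}_d(t))$. Notation: $B_R^d=\{\|\underline{\mathbf x}_d\|<R\}$; $C^d_{R_1,R_2}=\{R_1<\|\underline{\mathbf x}_d\|\le R_2\}$. *)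

(* Defs.v *)
From HB Require Import structures.
From mathcomp Require Import all_boot all_order all_algebra.
From mathcomp Require Import all_classical all_reals all_analysis.

Set Implicit Arguments.
Unset Strict Implicit.
Unset Printing Implicit Defensive.

Import Order.TTheory GRing.Theory Num.Theory.
Import numFieldNormedType.Exports.

Local Open Scope classical_set_scope.
Local Open Scope ring_scope.

(* R^d is represented by [d.-tuple R], on which MathComp-Analysis puts the
   product sigma-algebra generated by the coordinates (the Borel sets of R^d).
   Tuples carry no vector space structure, hence the operations below. *)
Section vectors.
Context {R : realType} {d : nat}.
Implicit Types x y : d.-tuple R.

Definition addv x y : d.-tuple R := [tuple tnth x i + tnth y i | i < d].

Definition scalev (a : R) x : d.-tuple R := [tuple a * tnth x i | i < d].

Definition sumv (m : nat) (f : nat -> d.-tuple R) : d.-tuple R :=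
  [tuple \sum_(k < m) tnth (f k) i | i < d].

Definition normv x : R := Num.sqrt (\sum_(i < d) tnth x i ^+ 2).

Definition centered_ball (r : R) : set (d.-tuple R) := [set x | normv x < r].

Definition shell (r1 r2 : R) : set (d.-tuple R) :=
  [set x | r1 < normv x <= r2].

(* Inversion with respect to the sphere of radius r; its value at the origin
   is the origin. *)
Definition inversion (r : R) x : d.-tuple R :=
  scalev (r ^+ 2 / normv x ^+ 2) x.

End vectors.

Section lebesgue_vec.
Context {R : realType}.

Definition consv n (p : measurableTypeR R * n.-tuple R) : n.+1.-tuple R :=
  [tuple of p.1 :: p.2].

Lemma measurable_consv n : measurable_fun [set: measurableTypeR R * n.-tuple R] (@consv n).
Proof.
apply: measurable_cons; last exact: measurable_snd.
exact: (@measurable_fst _ _ (measurableTypeR R)).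
Qed.

Section step.
Variables (n : nat) (mu : {sigma_finite_measure set (n.-tuple R) -> \bar R}).
Local Open Scope ereal_scope.

Definition lebesgue_step : set (n.+1.-tuple R) -> \bar R :=
  pushforward (@lebesgue_measure R \x mu) (@consv n).

Let lebesgue_step0 : lebesgue_step set0 = 0.
Proof. by rewrite /lebesgue_step /pushforward preimage_set0 measure0. Qed.

Let lebesgue_step_ge0 A : 0 <= lebesgue_step A.
Proof. by rewrite /lebesgue_step /pushforward measure_ge0. Qed.

Let lebesgue_step_sigma_additive : semi_sigma_additive lebesgue_step.
Proof.
move=> F mF tF mUF; rewrite /lebesgue_step /pushforward preimage_bigcup.
have mp A : measurable A -> measurable (@consv n @^-1` A).
  by move=> mA; rewrite -[X in measurable X]setTI; exact: measurable_consv.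
apply: measure_semi_sigma_additive.
- by move=> k; exact: mp.
- apply/trivIsetP => /= i j _ _ ij; rewrite -preimage_setI.
  by move/trivIsetP : tF => /(_ _ _ _ _ ij) ->//; rewrite preimage_set0.
- by rewrite -preimage_bigcup; exact: mp.
Qed.

HB.instance Definition _ := isMeasure.Build _ _ _ lebesgue_step
  lebesgue_step0 lebesgue_step_ge0 lebesgue_step_sigma_additive.

Let lebesgue_step_sigma_finite : sigma_finite setT lebesgue_step.
Proof.
have /sigma_finiteP[F [FT ndF mF]] := sigma_finiteT (@lebesgue_measure R).
have /sigma_finiteP[G [GT ndG mG]] := sigma_finiteT mu.
pose g (s : n.+1.-tuple R) : (measurableTypeR R * n.-tuple R)%type :=
  (tnth s ord0, [tuple of behead s]).
have mg : measurable_fun [set: n.+1.-tuple R] g.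
  apply/measurable_fun_pair; first exact: (@measurable_tnth _ R).
  exact: measurable_behead.
have gK : cancel (@consv n) g.
  by move=> [x s]; rewrite /g tnth0; congr pair; exact/val_inj.
exists (fun i => g @^-1` (F i `*` G i)).
  rewrite -preimage_bigcup (_ : \bigcup_i _ = setT) ?preimage_setT//.
  rewrite -setXTT FT GT; apply/seteqP; split => -[x y] /=.
    by move=> [k _ [/= Fx Gy]]; split; exists k.
  move=> [/= [k _ Fx] [l _ Gy]]; exists (maxn k l) => //; split => /=.
    by move: x Fx; exact/subsetPset/ndF/leq_maxl.
  by move: y Gy; exact/subsetPset/ndG/leq_maxr.
move=> i; have [mFi Foo] := mF i; have [mGi Goo] := mG i; split.
  by rewrite -[X in measurable X]setTI; apply: mg => //; exact: measurableX.
rewrite /lebesgue_step /pushforward -comp_preimage.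
rewrite (_ : g \o _ = id); last by apply/funext => x /=; rewrite gK.
by rewrite preimage_id product_measure1E// lte_mul_pinfty// ge0_fin_numE.
Qed.

HB.instance Definition _ :=
  Measure_isSigmaFinite.Build _ _ _ lebesgue_step lebesgue_step_sigma_finite.

End step.

(* Lebesgue measure on R^n, by R^(n+1) = R * R^n. *)
Fixpoint lebesgue_vec (n : nat) :
    {sigma_finite_measure set (n.-tuple R) -> \bar R} :=
  match n with
  | 0 => @dirac _ (0.-tuple R) [tuple] R
  | n'.+1 => lebesgue_step (lebesgue_vec n')
  end.

Lemma lebesgue_vec_box n (A : 'I_n -> set R) :
  (forall i, measurable (A i)) ->
  lebesgue_vec n [set x | forall i, A i (tnth x i)] =
  (\prod_(i < n) @lebesgue_measure R (A i))%E.
Proof.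
elim: n A => [|n IHn] A mA.
  by rewrite big_ord0 /= diracE mem_set// => -[].
rewrite big_ord_recl /= /lebesgue_step /pushforward -IHn//.
have mB : measurable [set s : n.-tuple R | forall i, A (lift ord0 i) (tnth s i)].
  rewrite (_ : [set s | _] = \bigcap_(i in [set: 'I_n])
      ((fun s : n.-tuple R => tnth s i) @^-1` A (lift ord0 i))).
    apply: fin_bigcap_measurable => // i _; rewrite -[X in measurable X]setTI.
    exact: (measurable_tnth i).
  by apply/seteqP; split => x /= Ax i; [move=> _|]; exact: Ax.
rewrite (_ : _ @^-1` _ = A ord0 `*`
    [set s : n.-tuple R | forall i, A (lift ord0 i) (tnth s i)]).
  by apply: product_measure1E => //; exact: mA.
apply/seteqP; split => -[x s] /=.
  move=> H; split; first exact: (H ord0).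
  by move=> i; have := H (lift ord0 i); rewrite /consv tnthS.
move=> [Ax As] i; have [j ->|->//] := unliftP ord0 i.
by rewrite tnthS; exact: As.
Qed.

End lebesgue_vec.

Definition Gamma {R : realType} (a : R) : R :=
  \int[@lebesgue_measure R]_(x in `]0, +oo[) (x `^ (a - 1) * expR (- x)).

(* The uniform law on the unit sphere of R^d, i.e. the normalized surface
   measure: the measure of a part A of the sphere is proportional to the volume
   of the cone it spans in the unit ball. *)
Definition sphere_law {R : realType} (d : nat) (A : set (d.-tuple R)) : \bar R :=
  (@lebesgue_vec R d
     [set x | (0 < normv x < 1)%R /\ A (scalev (normv x)^-1 x)] *
   ((fine (@lebesgue_vec R d (centered_ball 1)))^-1)%:E)%E.

Section random_vectors.
Context {R : realType} {disp : measure_display} {Omega : measurableType disp}.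
Implicit Types Q P : probability Omega R.

Definition has_density Q m (X : Omega -> m.-tuple R) (f : m.-tuple R -> R) :=
  [/\ measurable_fun [set: Omega] X, measurable_fun [set: m.-tuple R] f,
      (forall x, 0 <= f x) &
      forall A, measurable A ->
        Q (X @^-1` A) = (\int[@lebesgue_vec R m]_(x in A) (f x)%:E)%E].

Definition uniform_on_sphere Q d (X : Omega -> d.-tuple R) :=
  forall A, measurable A -> Q (X @^-1` A) = sphere_law A.

(* For a finite family, the product rule for subfamilies is the special case
   where some of the B i are the whole space. *)
Definition mutually_independent Q d' (T : measurableType d') m
    (X : 'I_m -> Omega -> T) :=
  forall B : 'I_m -> set T, (forall i, measurable (B i)) ->
  Q [set w | forall i, B i (X i w)] = (\prod_(i < m) Q (X i @^-1` B i))%E.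

Definition independent Q d1 d2 (T1 : measurableType d1)
    (T2 : measurableType d2) (X : Omega -> T1) (Y : Omega -> T2) :=
  forall A B, measurable A -> measurable B ->
  Q (X @^-1` A `&` Y @^-1` B) = (Q (X @^-1` A) * Q (Y @^-1` B))%E.

Lemma measurable_event_eq (N : {mfun Omega >-> nat}) n :
  measurable (N @^-1` [set n]).
Proof. by rewrite -[X in measurable X]setTI; exact: measurable_funP. Qed.

(* P( . | N = n); by convention it is P itself when P(N = n) = 0. *)
Definition cond_prob P (N : {RV P >-> nat}) (n : nat) : probability Omega R :=
  mnormalize (mrestr P (measurable_event_eq N n)) P.

Lemma cond_probE P (N : {RV P >-> nat}) (n : nat) (A : set Omega) :
  P (N @^-1` [set n]) != 0%E ->
  @cond_prob P N n A =
  (P (A `&` N @^-1` [set n]) * ((fine (P (N @^-1` [set n])))^-1)%:E)%E.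
Proof.
move=> PN0; rewrite /cond_prob /= /mnormalize /= /mrestr setTI.
rewrite (negbTE PN0) /= lt_eqF//.
by rewrite ltey_eq fin_num_measure//; exact: measurable_event_eq.
Qed.

End random_vectors.
Arguments cond_prob {R disp Omega} P N n.

Section flight.
Context {R : realType}.

(* Lengths of the n+1 time intervals of a flight of duration t that changes
   direction n times, the first n being s; the default value of [nth], taken at
   the index n, is the length of the last one. *)
Definition interval_length n (t : R) (s : n.-tuple R) (k : nat) : R :=
  nth (t - \sum_(j < n) tnth s j) s k.

Definition simplex n (t : R) : set (n.-tuple R) :=
  [set s | (forall k, 0 < tnth s k) /\ \sum_(k < n) tnth s k < t].

Definition dirichlet_density (d h n : nat) (t : R) (s : n.-tuple R) : R :=
  Gamma (n.+1%:R * (d%:R / h%:R - 1)) / Gamma (d%:R / h%:R - 1 : R) ^+ n.+1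
  * (t `^ (n.+1%:R * (d%:R / h%:R - 1) - 1))^-1
  * \prod_(k < n.+1) interval_length t s k `^ (d%:R / h%:R - 2)
  * \1_(@simplex n t) s.

Context {disp : measure_display} {Omega : measurableType disp}.
Variables (P : probability Omega R) (d h : nat) (c rad t : R).
Variable N : {RV P >-> nat}.
Variable tau : nat -> {RV P >-> R}.
Variable V : nat -> {RV P >-> d.-tuple R}.

Definition times (n : nat) (w : Omega) : n.-tuple R := [tuple tau k w | k < n].

Definition directions (m : nat) (w : Omega) : m.-tuple (d.-tuple R) :=
  [tuple V k w | k < m].

(* N is the number of changes of direction in [0, t]; indices start at 0, so
   that [tau k] and [V k] are the length of the (k+1)-st time interval and the
   (k+1)-st direction. *)
Definition random_flight : Prop :=
  forall n, (0 < n)%N -> P (N @^-1` [set n]) != 0%E ->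
  let Q := cond_prob P N n in
  [/\ has_density Q (times n) (@dirichlet_density d h n t),
      (forall k : 'I_n.+1, uniform_on_sphere Q (V k)),
      mutually_independent Q (fun k : 'I_n.+1 => (V k : Omega -> d.-tuple R)) &
      independent Q (directions n.+1) (times n)].

Definition position (w : Omega) : d.-tuple R :=
  scalev c (sumv (N w).+1
    (fun k => scalev (interval_length t (times (N w) w) k) (V k w))).

Definition reflected_position (w : Omega) : d.-tuple R :=
  let x := position w in
  addv (scalev (\1_(centered_ball rad) x) x)
       (scalev (\1_(shell rad (c * t)) x) (inversion rad x)).

End flight.

(* Main.v *)
(** Put P = t^2 - |x|^2, Q = |x - t v|^2 and L = t - <x, v>, so that 2 t L = P + Q.
    Prepending a leg of length s and direction v to a flight whose endpoint has a
    density proportional to (t^2 - |x|^2)^q leads to the integral over s of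
    s^(a-1) (t - s)^e (P - 2 s L)^q, where a = d/h - 1; a linear (h = 1) or
    homographic (h = 2) substitution evaluates it as a combination of powers of P,
    Q and L, and averaging over v only requires the means over the sphere of
    L^(1-d), Q^(-d/2) and Q^(1-d/2).  These means, as well as the flight with a
    single change of direction, are obtained from the change of variable
    y |-> y - |y| x, whose Jacobian is 1 - <x, y> / |y|.  Hence the endpoint has a
    density proportional to P^(n(d-h)/2 - 1); its constant follows from the total
    mass, computed by integrating a Gaussian over R^d.  The reflected flight is then
    handled by the inversion formula in polar coordinates. *)
From HB Require Import structures.
Require Import Defs.
From mathcomp Require Import all_boot all_order all_algebra.
From mathcomp Require Import all_classical all_reals all_analysis.
From mathcomp Require Import measurable_realfun ring lra.
Import Defs.

Set Implicit Arguments.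
Unset Strict Implicit.
Unset Printing Implicit Defensive.

Import Order.TTheory GRing.Theory Num.Theory.
Import numFieldNormedType.Exports.

Local Open Scope classical_set_scope.
Local Open Scope ring_scope.

(** * Integration and measurability *)

(** The Beta integrals and the Dirichlet constant are never evaluated. Integrands are nonnegative
    and integrals live in the extended reals, so the recursion can carry an unknown, possibly
    infinite constant until the mass 1 of the conditional law forces it to be finite. Even the
    finiteness of Gamma is a by-product, of the finite volume of the unit ball. The recursion starts
    at one change of direction because a flight without any lives on a sphere and has no density.
    The change of variable y |-> y - |y| x serves in two regimes: for |x| < 1 it is onto and gives
    the spherical means; for |x| = 1 its Jacobian vanishes on a ray, its image is a half-space, and
    it handles the flight with a single change. The uniform law on the sphere is a cone measure, so
    polar coordinates need only dilations and Fubini, no surface integrals. The three means are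
    classical: Q^(-d/2) is the Poisson kernel, Q^(1-d/2) the Newtonian potential of a uniform
    sphere, constant inside, and L^(1-d) is up to normalization the Jacobian of a Lorentz boost
    acting on the sphere. *)

Lemma mule_eqr {R : realDomainType} (a x y : \bar R) : x = y -> (a * x = a * y)%E.
Proof. by move=> ->. Qed.

Section pushforward_measure.
Context d1 d2 (T1 : measurableType d1) (T2 : measurableType d2) (R : realType).
Variables (mu : {measure set T1 -> \bar R}) (phi : T1 -> T2).
Hypothesis mphi : measurable_fun setT phi.

Definition image_measure : {measure set T2 -> \bar R} :=
  measure_function_pushforward__canonical__measure_function_Measure mu mphi.

Lemma image_measureE A : image_measure A = mu (phi @^-1` A).
Proof. by []. Qed.

Lemma ge0_integral_image (g : T2 -> \bar R) :
  measurable_fun setT g -> (forall x, (0 <= g x)%E) ->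
  (\int[image_measure]_x g x = \int[mu]_x g (phi x))%E.
Proof.
move=> mg g0.
by rewrite (@ge0_integral_pushforward _ _ _ _ _ _ mphi mu setT).
Qed.

End pushforward_measure.

Section integration_tools.
Context d1 d2 (T1 : measurableType d1) (T2 : measurableType d2) (R : realType).
Local Open Scope ereal_scope.

(** The complement of [D] is negligible for the restricted measure, and inside [D] the two measures
    agree. *)
Lemma ge0_integral_mrestr (mu : {measure set T1 -> \bar R}) (D : set T1)
    (mD : measurable D) (g : T1 -> \bar R) :
  measurable_fun setT g -> (forall x, 0 <= g x) ->
  \int[mrestr mu mD]_x g x = \int[mu]_(x in D) g x.
Proof.
move=> mg g0.
rewrite (@ge0_negligible_integral _ _ _ _ setT (~` D))//; last 2 first.
- exact: measurableC.
- by rewrite /= /mrestr setICl measure0.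
rewrite setTD setCK; apply: eq_measure_integral => A mA AD.
by rewrite /= /mrestr setIidl.
Qed.

Lemma integral_indicl (mu : {measure set T1 -> \bar R}) (D : set T1)
    (f : T1 -> \bar R) :
  \int[mu]_(x in D) f x = \int[mu]_x ((\1_D x)%:E * f x).
Proof.
rewrite integral_mkcond; apply: eq_integral => x _.
rewrite patchE indicE; case: ifP => xD; first by rewrite mul1e.
by rewrite mul0e.
Qed.

Lemma fubini_swap (m1 : {sigma_finite_measure set T1 -> \bar R})
    (m2 : {sigma_finite_measure set T2 -> \bar R}) (f : T1 -> T2 -> \bar R) :
  measurable_fun setT (fun z : T1 * T2 => f z.1 z.2) ->
  (forall x y, 0 <= f x y) ->
  \int[m1]_x \int[m2]_y f x y = \int[m2]_y \int[m1]_x f x y.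
Proof. by move=> mf f0; apply: (fubini_tonelli (fun z => f z.1 z.2)). Qed.

Lemma measurable_integral_r (m2 : {sigma_finite_measure set T2 -> \bar R})
    (f : T1 -> T2 -> \bar R) :
  measurable_fun setT (fun z : T1 * T2 => f z.1 z.2) ->
  (forall x y, 0 <= f x y) ->
  measurable_fun setT (fun x => \int[m2]_y f x y).
Proof.
by move=> mf f0; exact: (measurable_fun_fubini_tonelli_F (fun z => f z.1 z.2)).
Qed.

End integration_tools.
Arguments fubini_swap {d1 d2 T1 T2 R m1 m2} f.
Arguments measurable_integral_r {d1 d2 T1 T2 R} m2 f.

Section integral_scaling.
Context d (T : measurableType d) (R : realType).
Variable mu : {measure set T -> \bar R}.

Lemma mule_integral (k : \bar R) (g : T -> \bar R) :
  measurable_fun setT g -> (forall x, (0 <= g x)%E) -> (0 <= k)%E ->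
  (k * \int[mu]_x g x = \int[mu]_x (k * g x))%E.
Proof.
by move=> mg g0 k0; rewrite ge0_integralZl.
Qed.

Lemma mule_integral_EFin (k : R) (g : T -> R) :
  measurable_fun setT g -> (forall x, 0 <= g x) -> 0 <= k ->
  (k%:E * \int[mu]_x (g x)%:E = \int[mu]_x (k * g x)%:E)%E.
Proof.
move=> mg g0 k0; rewrite mule_integral//; first exact/measurable_EFinP.
Qed.

Lemma adde_integral_EFin (f g : T -> R) :
  measurable_fun setT f -> (forall x, 0 <= f x) ->
  measurable_fun setT g -> (forall x, 0 <= g x) ->
  (\int[mu]_x (f x)%:E + \int[mu]_x (g x)%:E = \int[mu]_x (f x + g x)%:E)%E.
Proof.
move=> mf f0 mg g0; under [RHS]eq_integral do rewrite EFinD.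
rewrite ge0_integralD//; try exact/measurable_EFinP.
- by move=> x _; rewrite lee_fin.
- by move=> x _; rewrite lee_fin.
Qed.

End integral_scaling.

Section measurability.
Context d (T : measurableType d) (R : realType).
Implicit Types f g : T -> R.

Lemma measurable_fun_sqrt f : measurable_fun setT f ->
  measurable_fun setT (fun x => Num.sqrt (f x)).
Proof.
move=> mf; apply: (measurableT_comp (f := @Num.sqrt R)) => //.
by apply: continuous_measurable_fun; exact: sqrt_continuous.
Qed.

Lemma measurable_fun_powRl f (a : R) : measurable_fun setT f ->
  measurable_fun setT (fun x => f x `^ a).
Proof. by move=> mf; exact: (measurableT_comp (measurable_powR a)). Qed.

(** Inversion is discontinuous at 0. The identity 1/y = y (y^2)^(-1), in which both sides vanish at
    y = 0, reduces it to the measurability of real powers. *)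
Lemma measurable_fun_inv f : measurable_fun setT f ->
  measurable_fun setT (fun x => (f x)^-1).
Proof.
move=> mf.
have -> : (fun x => (f x)^-1) =
   (fun x => f x * (f x ^+ 2) `^ (-1)).
  apply/funext => x; have [->|f0] := eqVneq (f x) 0; first by rewrite invr0 mul0r.
  by rewrite powR_inv1 ?sqr_ge0// expr2 invfM mulrA mulfV// mul1r.
apply: measurable_funM => //; apply: measurable_fun_powRl.
exact: measurable_funX.
Qed.

Lemma measurable_fun_abs f : measurable_fun setT f ->
  measurable_fun setT (fun x => `|f x|).
Proof. by move=> mf; exact: (measurableT_comp (@normr_measurable R setT) mf). Qed.

Lemma measurable_fun_indic_lt f g : measurable_fun setT f ->
  measurable_fun setT g -> measurable_fun setT (fun x => (f x < g x)%R%:R : R).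
Proof.
move=> mf mg; rewrite (_ : (fun x => _) = (fun x => if f x < g x then 1 else 0)).
  by apply: measurable_fun_ifT => //; exact: measurable_fun_ltr.
by apply/funext => x; case: ifP.
Qed.

Lemma measurable_fun_indic_le f g : measurable_fun setT f ->
  measurable_fun setT g -> measurable_fun setT (fun x => (f x <= g x)%R%:R : R).
Proof.
move=> mf mg; rewrite (_ : (fun x => _) = (fun x => if f x <= g x then 1 else 0)).
  by apply: measurable_fun_ifT => //; exact: measurable_fun_ler.
by apply/funext => x; case: ifP.
Qed.

Lemma measurable_fun_andb (b1 b2 : T -> bool) :
  measurable_fun setT (fun x => (b1 x)%:R : R) ->
  measurable_fun setT (fun x => (b2 x)%:R : R) ->
  measurable_fun setT (fun x => (b1 x && b2 x)%:R : R).
Proof.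
move=> m1 m2; rewrite (_ : (fun x => _) = (fun x => (b1 x)%:R * (b2 x)%:R)).
  exact: measurable_funM.
by apply/funext => x; case: (b1 x); case: (b2 x); rewrite ?mulr1 ?mulr0.
Qed.

Lemma measurable_fun_orb (b1 b2 : T -> bool) :
  measurable_fun setT (fun x => (b1 x)%:R : R) ->
  measurable_fun setT (fun x => (b2 x)%:R : R) ->
  measurable_fun setT (fun x => (b1 x || b2 x)%:R : R).
Proof.
move=> m1 m2; rewrite (_ : (fun x => _) =
    (fun x => (b1 x)%:R + (1 - (b1 x)%:R) * (b2 x)%:R)).
  apply: measurable_funD => //; apply: measurable_funM => //.
  by apply: measurable_funB => //; exact: measurable_cst.
by apply/funext => x; case: (b1 x); rewrite ?subrr ?mul0r ?addr0// subr0 mul1r add0r.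
Qed.

Lemma measurable_bool (b : T -> bool) :
  measurable_fun setT (fun x => (b x)%R%:R : R) -> measurable [set x | b x].
Proof.
move=> mb; rewrite (_ : [set x | b x] = (fun x => (b x)%R%:R : R) @^-1` [set 1]).
  by rewrite -[X in measurable X]setTI; exact: mb.
apply/seteqP; split => x /=; first by move=> ->.
by case: (b x) => // /eqP; rewrite eq_sym oner_eq0.
Qed.

End measurability.

(** * Dot product and Euclidean norm on tuples *)

Section vectors.
Context {R : realType} {d : nat}.
Implicit Types x y z : d.-tuple R.

Definition dotv x y : R := \sum_(i < d) tnth x i * tnth y i.

Definition zerov : d.-tuple R := [tuple 0 | i < d].

Lemma normvE x : normv x = Num.sqrt (dotv x x).
Proof. by rewrite /normv; congr Num.sqrt; apply: eq_bigr => i _; rewrite expr2. Qed.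

Lemma dotv_ge0 x : 0 <= dotv x x.
Proof. by apply: sumr_ge0 => i _; rewrite -expr2 sqr_ge0. Qed.

Lemma sqr_normv x : normv x ^+ 2 = dotv x x.
Proof. by rewrite normvE sqr_sqrtr// dotv_ge0. Qed.

Lemma normv_ge0 x : 0 <= normv x. Proof. exact: sqrtr_ge0. Qed.

Lemma dotvC x y : dotv x y = dotv y x.
Proof. by apply: eq_bigr => i _; rewrite mulrC. Qed.

Lemma dotvDl x y z : dotv (addv x y) z = dotv x z + dotv y z.
Proof.
by rewrite /dotv -big_split; apply: eq_bigr => i _; rewrite tnth_mktuple mulrDl.
Qed.

Lemma dotvZl (a : R) x y : dotv (scalev a x) y = a * dotv x y.
Proof.
by rewrite /dotv mulr_sumr; apply: eq_bigr => i _; rewrite tnth_mktuple mulrA.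
Qed.

Lemma dotvDr x y z : dotv z (addv x y) = dotv z x + dotv z y.
Proof. by rewrite dotvC dotvDl !(dotvC z). Qed.

Lemma dotvZr (a : R) x y : dotv y (scalev a x) = a * dotv y x.
Proof. by rewrite dotvC dotvZl (dotvC y). Qed.

Lemma dot0v x : dotv zerov x = 0.
Proof. by rewrite /dotv big1// => i _; rewrite tnth_mktuple mul0r. Qed.

Lemma dotv_eq0 x : (dotv x x == 0) = (x == zerov).
Proof.
apply/eqP/eqP => [x0|->]; last exact: dot0v.
apply: eq_from_tnth => i; rewrite tnth_mktuple; apply/eqP.
rewrite -sqrf_eq0 expr2; apply/eqP.
have := x0; move/eqP; rewrite psumr_eq0; last by move=> j _; rewrite -expr2 sqr_ge0.
by move/allP => /(_ i); rewrite mem_index_enum => /(_ isT)/eqP.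
Qed.

Lemma normv_eq0 x : (normv x == 0) = (x == zerov).
Proof. by rewrite -sqrf_eq0 sqr_normv dotv_eq0. Qed.

Lemma normv_scale (a : R) x : normv (scalev a x) = `|a| * normv x.
Proof.
rewrite !normvE dotvZl dotvZr mulrA -expr2 sqrtrM ?sqr_ge0//.
by rewrite sqrtr_sqr.
Qed.

Lemma addvA : associative (@addv R d).
Proof. by move=> x y z; apply: eq_from_tnth => i; rewrite !tnth_mktuple addrA. Qed.

Lemma addvC : commutative (@addv R d).
Proof. by move=> x y; apply: eq_from_tnth => i; rewrite !tnth_mktuple addrC. Qed.

Lemma add0v : left_id zerov (@addv R d).
Proof. by move=> x; apply: eq_from_tnth => i; rewrite !tnth_mktuple add0r. Qed.

Lemma scalevA (a b : R) x : scalev a (scalev b x) = scalev (a * b) x.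
Proof. by apply: eq_from_tnth => i; rewrite !tnth_mktuple mulrA. Qed.

Lemma scale1v x : scalev 1 x = x.
Proof. by apply: eq_from_tnth => i; rewrite !tnth_mktuple mul1r. Qed.

Lemma scale0v x : scalev 0 x = zerov.
Proof. by apply: eq_from_tnth => i; rewrite !tnth_mktuple mul0r. Qed.

Lemma scalevDr (a : R) x y : scalev a (addv x y) = addv (scalev a x) (scalev a y).
Proof. by apply: eq_from_tnth => i; rewrite !tnth_mktuple mulrDr. Qed.

Lemma scalevDl (a b : R) x : scalev (a + b) x = addv (scalev a x) (scalev b x).
Proof. by apply: eq_from_tnth => i; rewrite !tnth_mktuple mulrDl. Qed.

Lemma cauchy_schwarz x y : dotv x y <= normv x * normv y.
Proof.
have [y0|y0] := eqVneq y zerov.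
  by rewrite y0 dotvC dot0v mulr_ge0// normv_ge0.
have yy : 0 < dotv y y by rewrite lt_neqAle dotv_ge0 eq_sym dotv_eq0 y0.
(* The squared norm of <y,y> x - <x,y> y is <y,y> (<x,x> <y,y> - <x,y>^2). *)
have := dotv_ge0 (addv (scalev (dotv y y) x) (scalev (- dotv x y) y)).
rewrite !(dotvDl, dotvDr, dotvZl, dotvZr) (dotvC y x) => H.
have : 0 <= dotv y y * (dotv x x * dotv y y - dotv x y ^+ 2).
  by apply: le_trans H _; rewrite le_eqVlt; apply/orP; left; apply/eqP; ring.
rewrite pmulr_rge0// subr_ge0 -!sqr_normv -exprMn => H2.
rewrite (le_trans (ler_norm _))// -[leRHS]ger0_norm ?mulr_ge0 ?normv_ge0//.
by rewrite -ler_sqr ?nnegrE// !real_normK// num_real.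
Qed.

End vectors.
Arguments zerov {R d}.

Section measurable_vectors.
Context d (T : measurableType d) (R : realType) (n : nat).
Implicit Types f g : T -> n.-tuple R.

Lemma measurable_tuple f :
  (forall i, measurable_fun setT (fun x => tnth (f x) i)) -> measurable_fun setT f.
Proof. by move=> mf; apply/measurable_fun_tnthP. Qed.

Lemma measurable_fun_tnth f i : measurable_fun setT f ->
  measurable_fun setT (fun x => tnth (f x) i).
Proof. by move=> mf; apply: (measurableT_comp (measurable_tnth i) mf). Qed.

Lemma measurable_fun_addv f g : measurable_fun setT f -> measurable_fun setT g ->
  measurable_fun setT (fun x => addv (f x) (g x)).
Proof.
move=> mf mg; apply: measurable_tuple => i.
under eq_fun do rewrite tnth_mktuple.
by apply: measurable_funD; exact: measurable_fun_tnth.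
Qed.

Lemma measurable_fun_scalev (a : T -> R) f : measurable_fun setT a ->
  measurable_fun setT f -> measurable_fun setT (fun x => scalev (a x) (f x)).
Proof.
move=> ma mf; apply: measurable_tuple => i.
under eq_fun do rewrite tnth_mktuple.
by apply: measurable_funM => //; exact: measurable_fun_tnth.
Qed.

Lemma measurable_fun_dotv f g : measurable_fun setT f -> measurable_fun setT g ->
  measurable_fun setT (fun x => dotv (f x) (g x)).
Proof.
move=> mf mg; apply: measurable_sum => i.
by apply: measurable_funM; exact: measurable_fun_tnth.
Qed.

Lemma measurable_fun_normv f : measurable_fun setT f ->
  measurable_fun setT (fun x => normv (f x)).
Proof.
move=> mf; under eq_fun do rewrite normvE.
by apply: measurable_fun_sqrt; exact: measurable_fun_dotv.
Qed.

Lemma measurable_fun_consv (a : T -> R) f : measurable_fun setT a ->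
  measurable_fun setT f -> measurable_fun setT (fun x => consv (a x, f x)).
Proof.
move=> ma mf; apply: (measurableT_comp (@measurable_consv R n)).
exact: measurable_fun_pair.
Qed.

End measurable_vectors.

(** Lets the tactic below handle a kernel of two arguments from one hypothesis on its uncurried
    form. *)
Lemma measurable_fun_curry d d1 d2 d3 (T : measurableType d) (T1 : measurableType d1)
  (T2 : measurableType d2) (T3 : measurableType d3) (g : T1 -> T2 -> T3)
  (a : T -> T1) (b : T -> T2) :
  measurable_fun setT (fun z : T1 * T2 => g z.1 z.2) ->
  measurable_fun setT a -> measurable_fun setT b ->
  measurable_fun setT (fun x => g (a x) (b x)).
Proof.
move=> mg ma mb; apply: (measurableT_comp mg (g := fun x => (a x, b x))).
exact: measurable_fun_pair.
Qed.

(** * Syntax-directed tactics for measurability and nonnegativity *)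

Ltac mfun_step :=
  match goal with
  | |- measurable_fun _ (fun x => x) => exact: measurable_id
  | |- measurable_fun _ (fun x => ?c) => exact: measurable_cst
  | |- measurable_fun _ fst => exact: measurable_fst
  | |- measurable_fun _ snd => exact: measurable_snd
  | |- measurable_fun _ (@GRing.opp _) => exact: oppr_measurable
  | |- measurable_fun _ (@GRing.inv _) => apply: (measurable_fun_inv (f := fun x => x))
  | H : measurable_fun _ ?f |- measurable_fun _ ?f => exact: H
  | |- measurable_fun _ (fun x => (@?f x)%:E) => apply/measurable_EFinP
  | |- measurable_fun _ (fun x => @?f x * @?g x)%R => apply: measurable_funM
  | |- measurable_fun _ (fun x => @?f x + @?g x)%R => apply: measurable_funD
  | |- measurable_fun _ (fun x => - @?f x)%R => apply: measurable_funN
  | |- measurable_fun _ (fun x => @?f x ^+ _)%R => apply: measurable_funX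
  | |- measurable_fun _ (fun x => (@?f x)^-1)%R => apply: measurable_fun_inv
  | |- measurable_fun _ (fun x => `| @?f x |%R) =>
      apply: measurable_fun_abs
  | |- measurable_fun _ (fun x => Num.sqrt (@?f x)) => apply: measurable_fun_sqrt
  | |- measurable_fun _ (fun x => expR (@?f x)) =>
      apply: (measurableT_comp (f := expR)); first exact: measurable_expR
  | |- measurable_fun _ (fun x => (@?f x) `^ _) => apply: measurable_fun_powRl
  | |- measurable_fun _ (fun x => @GRing.natmul _ _ (nat_of_bool (@?f x && @?g x))) => apply: measurable_fun_andb
  | |- measurable_fun _ (fun x => @GRing.natmul _ _ (nat_of_bool (@?f x || @?g x))) => apply: measurable_fun_orb
  | |- measurable_fun _ (fun x => @GRing.natmul _ _ (nat_of_bool (@?f x < @?g x)%R)) => apply: measurable_fun_indic_lt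
  | |- measurable_fun _ (fun x => @GRing.natmul _ _ (nat_of_bool (@?f x <= @?g x)%R)) => apply: measurable_fun_indic_le
  | |- measurable_fun _ (fun x => (@?f x * @?g x)%E) => apply: emeasurable_funM
  | |- measurable_fun _ (fun x => GRing.add (@?f x) (@?g x)) => apply: emeasurable_funD
  | |- measurable_fun _ (fun x => (@?f x, @?g x)) => apply: measurable_fun_pair
  | |- measurable_fun _ (fun x => (@?f x).1) => apply: (measurableT_comp measurable_fst)
  | |- measurable_fun _ (fun x => (@?f x).2) => apply: (measurableT_comp measurable_snd)
  | |- measurable_fun _ (fun x => addv (@?f x) (@?g x)) => apply: measurable_fun_addv
  | |- measurable_fun _ (fun x => scalev (@?f x) (@?g x)) => apply: measurable_fun_scalev
  | |- measurable_fun _ (fun x => dotv (@?f x) (@?g x)) => apply: measurable_fun_dotv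
  | |- measurable_fun _ (fun x => normv (@?f x)) => apply: measurable_fun_normv
  | |- measurable_fun _ (fun x => consv (@?f x, @?g x)) => apply: measurable_fun_consv
  | |- measurable_fun _ (fun x => tnth (@?f x) _) => apply: measurable_fun_tnth
  | H : measurable_fun setT (fun z => ?g z.1 z.2) |-
      measurable_fun _ (fun x => ?g (@?a x) (@?b x)) => apply: (measurable_fun_curry H)
  | |- measurable_fun _ (@normv _ _) => apply: (measurable_fun_normv (f := fun x => x))
  | |- measurable_fun _ (addv ?a) => apply: (measurable_fun_addv (f := fun=> a))
  | |- measurable_fun _ (scalev ?a) => apply: (measurable_fun_scalev (a := fun=> a))
  | |- measurable_fun _ (dotv ?a) => apply: (measurable_fun_dotv (f := fun=> a))
  | |- measurable_fun _ (fun x => bigop.body _ _ _) => apply: measurable_sum => ?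
  | H : measurable_fun setT ?g |- measurable_fun _ (fun x => ?g (@?f x)) =>
      apply: (measurableT_comp H)
  end.

Ltac mfun := repeat mfun_step.

Ltac pos_step :=
  first [ assumption | exact: ler01 | exact: ler0n | exact: normv_ge0 | exact: normr_ge0 | exact: powR_ge0
  | exact: expR_ge0 | exact: sqr_ge0
  | match goal with
    | H : is_true (0 < ?x)%R |- is_true (0 <= ?x)%R => exact: ltW
    | H : forall x, is_true (@Order.le _ _ _ (@?f x)) |- _ => exact: H
    | H : forall x y, is_true (@Order.le _ _ _ (@?f x y)) |- _ => exact: H
    end
  | match goal with
    | |- is_true (@Order.le _ _ _ (mule _ _)) => apply: mule_ge0
    | |- is_true (@Order.le _ _ _ (integral _ _ _)) => apply: integral_ge0 => * /=
    | |- is_true (@Order.le _ _ _ (EFin _)) => rewrite lee_fin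
    | |- is_true (@Order.le _ _ _ (GRing.mul _ _)) => apply: mulr_ge0
    | |- is_true (@Order.le _ _ _ (GRing.add _ _)) => apply: addr_ge0
    | |- is_true (@Order.le _ _ _ (GRing.add _ _)) => apply: adde_ge0
    | |- is_true (@Order.le _ _ _ (GRing.exp _ _)) => apply: exprn_ge0
    | |- is_true (@Order.le _ _ _ (GRing.inv _)) => rewrite invr_ge0
    end ].

Ltac pos := move=> * /=;
  try (match goal with |- ?b = true => change (is_true b) end);
  repeat pos_step.

Ltac sides := try solve [mfun | pos].

(** * Increasing change of variable on an interval *)

Section change_of_variable_itv.
Context {R : realType}.
Variables (F f : R -> R) (p q : R).
Hypothesis pq : p <= q.
Hypothesis mF : measurable_fun setT F.
Hypothesis mf : measurable_fun setT f.
Hypothesis f0 : forall y, p <= y <= q -> 0 <= f y.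
Hypothesis incF : {in `[p, q] &, {mono F : x y / x <= y}}.
Hypothesis ftcF : forall u v, p <= u -> u <= v -> v <= q ->
  (\int[@lebesgue_measure R]_(y in `]u, v]) (f y)%:E = (F v - F u)%:E)%E.
Hypothesis surF : forall z, F p <= z <= F q -> exists2 y, y \in `[p, q] & F y = z.
Notation lambda := (@lebesgue_measure R).

(** The measure with density [f] on ]p, q] is realized as the first marginal of planar measure on
    the region under the graph of [f]. Its image under [F] is [nu], to be identified with Lebesgue
    measure on ]F p, F q]. *)
Let under : set (measurableTypeR R * measurableTypeR R) :=
  [set z | [&& p < z.1, z.1 <= q, 0 <= z.2 & z.2 < f z.1]].

Let munder : measurable under.
Proof. apply: (@measurable_bool _ _ R). mfun. Qed.

Let mFfst : measurable_fun [set: measurableTypeR R * measurableTypeR R]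
  (F \o fst : _ -> measurableTypeR R).
Proof. exact: measurableT_comp. Qed.

Let nu : {measure set (measurableTypeR R) -> \bar R} :=
  image_measure (mrestr (product_measure1 lambda lambda) munder) mFfst.

(** Tonelli: the slice of [under] at y is [0, f y[, of length f y, when p < y <= q, and is empty
    otherwise. *)
Let int_nu (g : R -> \bar R) : measurable_fun setT g -> (forall x, (0 <= g x)%E) ->
  (\int[nu]_(x in [set: measurableTypeR R]) g x = \int[lambda]_(y in `]p, q]) ((f y)%:E * g (F y)))%E.
Proof.
move=> mg g0; rewrite ge0_integral_image//.
rewrite (ge0_integral_mrestr _ munder)//; last first.
  by apply: measurableT_comp.
rewrite integral_indicl.
rewrite (fubini_tonelli1 (m1 := lambda) (m2 := lambda) (fun z => (\1_under z)%:E * (g \o (F \o fst)) z)%E); last 2 first.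
- apply: emeasurable_funM; first exact/measurable_EFinP/measurable_indic.
  exact: measurableT_comp.
- by move=> z; apply: mule_ge0; [rewrite lee_fin|exact: g0].
rewrite [RHS]integral_indicl; apply: eq_integral => y _; rewrite /fubini_F /=.
have munderi : measurable_fun setT (\1_under : _ -> R) by exact: measurable_indic.
rewrite ge0_integralZr//; last by apply/measurable_EFinP; exact: measurableT_comp.
rewrite muleA; congr (_ * _)%E.
rewrite (_ : (fun z => _) = (fun z => (\1_(xsection under y) z)%:E)); last first.
  by apply/funext => z; rewrite !indicE mem_xsection.
rewrite integral_indic ?setIT; last exact: measurable_xsection.
rewrite indicE; have [ypq|ypq] := boolP (y \in `]p, q]%classic).
  rewrite mul1e; move: ypq; rewrite inE/= in_itv/= => /andP[py yq].
  rewrite (_ : xsection under y = `[0, f y[%classic); last first.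
    by apply/seteqP; split => z; rewrite xsectionE/= /under/= py yq in_itv.
  rewrite lebesgue_measure_itv/= lte_fin; case: ltP => [_|fy0].
    by rewrite sube0.
  by congr EFin; apply/eqP; rewrite eq_le fy0 f0// ltW.
rewrite (_ : xsection under y = set0); first by rewrite measure0 mul0e.
apply/seteqP; split => z //; rewrite xsectionE/= /under/= => /and4P[py yq _ _].
by move: ypq; rewrite notin_setE/= in_itv/= py yq.
exact: measurableT.
Qed.

(** Monotonicity and surjectivity pull ]a, b] back to some ]u, v], whose mass F v - F u is given by
    [ftcF]. *)
Let nuE (a b : R) : F p <= a -> a <= b -> b <= F q -> nu `]a, b]%classic = (b - a)%:E.
Proof.
move=> pa ab bq.
have mab : measurable `]a, b]%classic by exact: measurable_itv.
rewrite -[X in nu X]setIT -integral_indic// int_nu//; last first.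
  by apply/measurable_EFinP; exact: measurable_indic.
have [|u upq Fu] := surF (z := a); first by rewrite pa (le_trans ab).
have [|v vpq Fv] := surF (z := b); first by rewrite bq (le_trans pa).
have uv : u <= v by rewrite -(incF upq vpq) Fu Fv.
move: (upq) (vpq); rewrite !in_itv/= => /andP[pu uq] /andP[pv vq].
rewrite -Fu -Fv -(ftcF pu uv vq) [LHS]integral_indicl [RHS]integral_indicl; apply: eq_integral => y _.
rewrite !indicE !mem_setE !in_itv/=.
have [/andP[py yq]|H] := boolP (p < y <= q).
  have yi : y \in `[p, q] by rewrite in_itv/= ltW.
  rewrite mul1e muleC; congr (_%:R%:E * _)%E.
  by rewrite !ltNge incF// incF.
rewrite mul0e (_ : (u < y <= v) = false) ?mul0e//.
apply/negP => /andP[uy yv]; move/negP: H; apply.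
by rewrite (le_lt_trans pu uy) (le_trans yv vq).
Qed.

Let mFpq : measurable (`]F p, F q]%classic : set (measurableTypeR R)).
Proof. exact: measurable_itv. Qed.

Let rho : {measure set (measurableTypeR R) -> \bar R} := mrestr lambda mFpq.

(** Half-open intervals form a pi-system generating the Borel sets; each one is first clipped to
    [F p, F q], where [nuE] applies. *)
Let nu_restr A : measurable A -> nu A = rho A.
Proof.
move=> mA.
have pp : p \in `[p, q] by rewrite in_itv/= lexx.
have qq : q \in `[p, q] by rewrite in_itv/= lexx andbT.
have Fpq : F p <= F q by rewrite incF.
apply: (@measure_unique _ R (measurableTypeR R) (@ocitv R) (fun n => `](- n%:R), n%:R]%classic)) => //.
- exact: ocitvI.
- by move=> n; exact: is_ocitv.
- exact: bigcup_itvT.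
- move=> _ [[a b] _ <-]/=.
  rewrite /= /mrestr.
  pose a' := Num.max a (F p); pose b' := Num.min b (F q).
  rewrite (_ : _ `&` _ = `]a', b']%classic); last first.
    apply/seteqP; split => y /=; rewrite !in_itv/= /a' /b' gt_max le_min.
      by move=> [/andP[-> ->] /andP[-> ->]].
    by move=> /andP[/andP[-> ->] /andP[-> ->]].
  have nuI : nu `]a, b]%classic = nu (`]a', b']%classic `&` `]F p, F q]%classic).
    rewrite /nu !image_measureE /= /mrestr; congr (product_measure1 _ _ _).
    apply/seteqP; split => -[y z]/= [].
      move=> H U; split => //; move: H U; rewrite /under/= !in_itv/=.
      move=> /andP[ay yb] /and4P[py yq _ _].
      have yi : y \in `[p, q] by rewrite in_itv/= ltW.
      by rewrite /a' /b' gt_max le_min ay yb ltNge !incF// -ltNge py yq.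
    move=> H U; split => //; move: H; rewrite !in_itv/= /a' /b' gt_max le_min.
    by move=> [/andP[/andP[-> _] /andP[-> _]] _].
  rewrite nuI.
  have [ab|ba] := leP a' b'.
    rewrite (_ : `]a', b']%classic `&` _ = `]a', b']%classic); last first.
      rewrite setIidl//; apply: subset_itv; rewrite bnd_simp.
        by rewrite /a' le_max lexx orbT.
      by rewrite /b' ge_min lexx orbT.
    rewrite nuE//; last 2 first.
    + by rewrite /a' le_max lexx orbT.
    + by rewrite /b' ge_min lexx orbT.
    rewrite lebesgue_measure_itv/= lte_fin; case: ltgtP ab => // ->.
    by rewrite subrr.
  rewrite (_ : `]a', b']%classic = set0) ?set0I ?measure0; last first.
    by rewrite set_itv_ge// bnd_simp -leNgt ltW.
  by [].
(* Finiteness on the covering intervals: no set has mass larger than the integral of [f] over ]p,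
   q], which is F q - F p. *)
- move=> n; rewrite -[X in nu X]setIT -integral_indic//= int_nu; last 2 first.
  + by apply/measurable_EFinP; exact: measurable_indic.
  + by move=> x; rewrite lee_fin.
  apply: (@le_lt_trans _ _ (\int[lambda]_(y in `]p, q]) (f y)%:E)%E).
    apply: ge0_le_integral => //=.
    + move=> y /=; rewrite in_itv/= => /andP[py yq].
      by rewrite mule_ge0// lee_fin// f0// yq ltW.
    + apply: measurable_funTS; apply: emeasurable_funM; first exact/measurable_EFinP.
      apply/measurable_EFinP; apply: measurableT_comp => //.
    + by apply: measurable_funTS; exact/measurable_EFinP.
    + move=> y /=; rewrite in_itv/= => /andP[py yq].
      rewrite -[leRHS]mule1; apply: lee_wpmul2l; first by rewrite lee_fin f0// yq ltW.
      by rewrite lee_fin indicE lern1 leq_b1.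
  by rewrite ftcF// ltry.
Qed.

Lemma change_of_variable_itv (g : R -> \bar R) :
  measurable_fun setT g -> (forall x, (0 <= g x)%E) ->
  (\int[lambda]_(y in `]p, q]) ((f y)%:E * g (F y)) =
   \int[lambda]_(z in `]F p, F q]) g z)%E.
Proof.
move=> mg g0; rewrite -int_nu//.
rewrite -[RHS](@ge0_integral_mrestr _ (measurableTypeR R) _ lambda _ mFpq)//.
by apply: eq_measure_integral => A mA _; exact: nu_restr.
Qed.

End change_of_variable_itv.

(** * Substitutions on the line *)

Section one_dimension.
Context {R : realType}.
Notation lambda := (@lebesgue_measure R).
Implicit Types (F f : R -> R) (g : R -> \bar R).

(** A positive derivative makes [F] increasing, the fundamental theorem of calculus gives the mass
    of subintervals, and the intermediate value theorem gives surjectivity: these are the hypotheses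
    of [change_of_variable_itv]. *)
Lemma change_of_variable_C1 F f (p q : R) g : p <= q ->
  measurable_fun setT F -> measurable_fun setT f ->
  (forall x, p <= x <= q -> is_derive x 1 F (f x)) ->
  (forall x, p <= x <= q -> {for x, continuous f}) ->
  (forall x, p <= x <= q -> 0 < f x) ->
  measurable_fun setT g -> (forall x, (0 <= g x)%E) ->
  (\int[lambda]_(y in `]p, q]) ((f y)%:E * g (F y)) =
   \int[lambda]_(z in `]F p, F q]) g z)%E.
Proof.
move=> pq mF mf dF cf f0 mg g0.
have derF x : p <= x <= q -> derivable F x 1 by move=> /dF[].
have dFE x : p <= x <= q -> F^`()%classic x = f x.
  by move=> xpq; rewrite derive1E; case: (dF _ xpq).
have cF u v : p <= u -> v <= q -> {within `[u, v], continuous F}.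
  move=> pu vq; apply: derivable_within_continuous => x.
  rewrite in_itv/= => /andP[ux xv]; apply: derF.
  by rewrite (le_trans pu)// (le_trans xv).
have incF x y : p <= x -> x < y -> y <= q -> F x < F y.
  apply: (@gtr0_derive1_incr _ F p q); last exact: cF.
  - by move=> z; rewrite in_itv/= => /andP[pz zq]; apply: derF; rewrite !ltW.
  - move=> z; rewrite in_itv/= => /andP[pz zq].
    by rewrite dFE ?f0 ?ltW.
apply: change_of_variable_itv => //.
- by move=> x /f0/ltW.
- apply: le_mono_in => x y; rewrite !in_itv/= => /andP[px _] /andP[_ yq] xy.
  exact: incF.
- move=> u v pu; rewrite le_eqVlt => /predU1P[<- _|uv vq].
    by rewrite set_itvoc0 integral_set0 subrr.
  rewrite integral_itv_obnd_cbnd; last first.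
    by apply: measurable_funTS; exact/measurable_EFinP.
  rewrite (@continuous_FTC2 _ f F)//.
  + apply: continuous_in_subspaceT => x /set_mem/=; rewrite in_itv/= => /andP[ux xv].
    by apply: cf; rewrite (le_trans pu)// (le_trans xv).
  + split.
    * move=> x; rewrite in_itv/= => /andP[ux xv]; apply: derF.
      by rewrite (le_trans pu (ltW ux)) (le_trans (ltW xv) vq).
    * apply: cvg_at_right_filter; apply: differentiable_continuous.
      by apply/derivable1_diffP; apply: derF; rewrite pu (le_trans (ltW uv)).
    * apply: cvg_at_left_filter; apply: differentiable_continuous.
      by apply/derivable1_diffP; apply: derF; rewrite vq (le_trans pu) ?ltW.
  + move=> x; rewrite in_itv/= => /andP[ux xv]; apply: dFE.
    by rewrite (le_trans pu (ltW ux)) (le_trans (ltW xv) vq).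
- move=> z /andP[Fpz zFq].
  apply: (@IVT _ F p q z) => //; first exact: cF.
  by rewrite ge_min Fpz/= le_max zFq orbT.
Qed.

(** Divided by [a], the image of Lebesgue measure has the right value on half-open intervals, and
    these values characterize Lebesgue measure. *)
Lemma image_lebesgue (phi : R -> R) (a : R) g : 0 < a ->
  measurable_fun setT phi ->
  (forall u v, u < v -> lambda (phi @^-1` `]u, v]%classic) = (a * (v - u))%:E) ->
  measurable_fun setT g -> (forall x, (0 <= g x)%E) ->
  (\int[lambda]_x g (phi x) = a%:E * \int[lambda]_x g x)%E.
Proof.
move=> a0 mphi phiE mg g0.
have mphi' : measurable_fun setT (phi : measurableTypeR R -> measurableTypeR R) by [].
have a1 : 0 <= a^-1 by rewrite invr_ge0 ltW.
pose nu : {measure set (measurableTypeR R) -> \bar R} :=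
  mscale (NngNum a1) (image_measure lambda mphi').
have nuE A : measurable A -> lambda A = nu A.
  move=> mA; apply: lebesgue_measure_unique => // _ [[u v] _ <-] /=.
  rewrite lebesgue_measure_itv/= lte_fin /mscale/= /pushforward.
  case: ltP => [uv|vu]; first by rewrite phiE// -EFinM mulKf// gt_eqF.
  by rewrite set_itv_ge ?preimage_set0 ?measure0 ?mule0// bnd_simp -leNgt.
transitivity (\int[image_measure lambda mphi']_x g x)%E.
  by rewrite ge0_integral_image.
rewrite [X in (_ = _ * X)%E](_ : _ = \int[nu]_x g x)%E; last first.
  by apply: eq_measure_integral => A mA _; exact: nuE.
rewrite ge0_integral_mscale//= muleA -EFinM mulfV ?gt_eqF//.
by rewrite mul1e.
Qed.

Lemma lebesgue_shift (a : R) g :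
  measurable_fun setT g -> (forall x, (0 <= g x)%E) ->
  (\int[lambda]_x g (a + x)%R = \int[lambda]_x g x)%E.
Proof.
move=> mg g0; rewrite (@image_lebesgue (fun x => a + x) 1) ?mul1e//; last 2 first.
- by mfun.
- move=> u v uv; rewrite (_ : _ @^-1` _ = `](u - a), (v - a)]%classic).
    by rewrite lebesgue_measure_itv/= lte_fin ltrD2r uv mul1r -EFinD; congr EFin; ring.
  by apply/seteqP; split => x /=; rewrite !in_itv/= ltrBlDl lerBrDl.
Qed.

Lemma lebesgue_opp g :
  measurable_fun setT g -> (forall x, (0 <= g x)%E) ->
  (\int[lambda]_x g (- x)%R = \int[lambda]_x g x)%E.
Proof.
move=> mg g0; rewrite (@image_lebesgue -%R 1) ?mul1e//; last first.
  move=> u v uv; rewrite (_ : _ @^-1` _ = `[(- v), (- u)[%classic).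
    by rewrite lebesgue_measure_itv/= lte_fin ltrN2 uv mul1r -EFinD; congr EFin; ring.
  by apply/seteqP; split => x /=; rewrite !in_itv/= lerNl ltrNr andbC.
Qed.

Lemma lebesgue_scale (a : R) g : 0 < a ->
  measurable_fun setT g -> (forall x, (0 <= g x)%E) ->
  (\int[lambda]_x g (a * x)%R = (a^-1)%:E * \int[lambda]_x g x)%E.
Proof.
move=> a0 mg g0; rewrite (@image_lebesgue (fun x => a * x) a^-1) ?invr_gt0//; last first.
  move=> u v uv; rewrite (_ : _ @^-1` _ = `](a^-1 * u), (a^-1 * v)]%classic).
    by rewrite lebesgue_measure_itv/= lte_fin ltr_pM2l ?invr_gt0// uv -EFinD mulrBr.
  apply/seteqP; split => x /=; rewrite !in_itv/= => /andP[? ?].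
    by rewrite ltr_pdivrMl// ler_pdivlMl//; apply/andP.
  by rewrite -ltr_pdivrMl// -ler_pdivlMl//; apply/andP.
by mfun.
Qed.

End one_dimension.

(** * Lebesgue measure on R^n *)

Section lebesgue_vec_theory.
Context {R : realType}.
Notation lambda := (@lebesgue_measure R).
Notation leb := (@lebesgue_vec R).

Lemma integral_lebesgue_vecS n (g : n.+1.-tuple R -> \bar R) :
  measurable_fun setT g -> (forall x, (0 <= g x)%E) ->
  (\int[leb n.+1]_x g x = \int[lambda]_a \int[leb n]_s g (consv (a, s)))%E.
Proof.
move=> mg g0.
transitivity (\int[image_measure (product_measure1 lambda (leb n)) (@measurable_consv R n)]_x g x)%E.
  by apply: eq_measure_integral.
rewrite ge0_integral_image//.
rewrite (fubini_tonelli1 (fun z => g (consv z)))//.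
by apply: measurableT_comp => //; exact: measurable_consv.
Qed.

Lemma consvK n (x : n.+1.-tuple R) : consv (tnth x ord0, [tuple of behead x]) = x.
Proof. by rewrite /consv -tuple_eta. Qed.

(** Induction on the dimension with Tonelli. Translations, dilations, x |-> -x and the anisotropic
    contraction [shrink] below are all instances, which is why map and factor depend on the
    coordinate. *)
Lemma lebesgue_vec_map n (phi : 'I_n -> R -> R) (c : 'I_n -> R) :
  (forall i, measurable_fun setT (phi i)) -> (forall i, 0 <= c i) ->
  (forall i (h : R -> \bar R), measurable_fun setT h -> (forall x, (0 <= h x)%E) ->
     (\int[lambda]_x h (phi i x) = (c i)%:E * \int[lambda]_x h x)%E) ->
  forall g : n.-tuple R -> \bar R,
  measurable_fun setT g -> (forall x, (0 <= g x)%E) ->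
  (\int[leb n]_x g [tuple phi i (tnth x i) | i < n] =
   (\prod_(i < n) c i)%:E * \int[leb n]_x g x)%E.
Proof.
elim: n phi c => [|n IH] phi c mphi c0 phiE g mg g0.
  rewrite big_ord0 mul1e; apply: eq_integral => x _; congr g.
  by rewrite [RHS]tuple0; exact: tuple0.
have mphiv : measurable_fun setT
    (fun x : n.+1.-tuple R => [tuple phi i (tnth x i) | i < n.+1]).
  apply: measurable_tuple => i; under eq_fun do rewrite tnth_mktuple.
  exact: (measurableT_comp (mphi i) (measurable_tnth i)).
rewrite integral_lebesgue_vecS//; last exact: measurableT_comp.
pose psi (s : n.-tuple R) := [tuple phi (lift ord0 i) (tnth s i) | i < n].
have mpsi : measurable_fun setT psi.
  apply: measurable_tuple => i; under eq_fun do rewrite tnth_mktuple.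
  exact: (measurableT_comp (mphi _) (measurable_tnth i)).
transitivity (\int[lambda]_a \int[leb n]_s g (consv (phi ord0 a, psi s)))%E.
  apply: eq_integral => a _; apply: eq_integral => s _; congr g.
  apply: eq_from_tnth => i; rewrite tnth_mktuple.
  have [j ->|->] := unliftP ord0 i; last by rewrite /consv !tnth0.
  by rewrite /consv !tnthS tnth_mktuple.
under eq_integral.
  move=> a _.
  rewrite (IH (fun i => phi (lift ord0 i)) (fun i => c (lift ord0 i)) _ _ (fun i => phiE (lift ord0 i))
    (fun s => g (consv (phi ord0 a, s))))//; last first.
    by apply: measurableT_comp => //; mfun.
  over.
rewrite ge0_integralZl//; last 3 first.
- apply: (measurable_integral_r (leb n) (fun a s => g (consv (phi ord0 a, s)))) => //.
  by apply: measurableT_comp => //; have := mphi ord0 => mphi0; mfun.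
- by move=> a _; exact: integral_ge0.
- by rewrite lee_fin prodr_ge0.
rewrite (phiE ord0 (fun u => \int[leb n]_s g (consv (u, s)))%E); last 2 first.
- apply: (measurable_integral_r (leb n) (fun a s => g (consv (a, s)))) => //.
  by apply: measurableT_comp => //; mfun.
- by move=> u; exact: integral_ge0.
by rewrite -integral_lebesgue_vecS// big_ord_recl EFinM muleA [in LHS](muleC (\prod_(i < n) _)%:E).
Qed.

Lemma lebesgue_vec_shift n (a : n.-tuple R) (g : n.-tuple R -> \bar R) :
  measurable_fun setT g -> (forall x, (0 <= g x)%E) ->
  (\int[leb n]_x g (addv a x) = \int[leb n]_x g x)%E.
Proof.
move=> mg g0; rewrite -[RHS]mul1e (_ : 1%E = (\prod_(i < n) (1 : R))%:E); last by rewrite big1.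
rewrite -(@lebesgue_vec_map _ (fun i x => tnth a i + x))//.
- by move=> i; mfun.
- by move=> i h mh h0; rewrite mul1e lebesgue_shift.
Qed.

Lemma lebesgue_vec_scale n (a : R) (g : n.-tuple R -> \bar R) : 0 < a ->
  measurable_fun setT g -> (forall x, (0 <= g x)%E) ->
  (\int[leb n]_x g (scalev a x) = ((a ^+ n)^-1)%:E * \int[leb n]_x g x)%E.
Proof.
move=> a0 mg g0.
rewrite (@lebesgue_vec_map _ (fun i x => a * x) (fun=> a^-1))//.
- by rewrite prodr_const card_ord exprVn.
- by move=> i; mfun.
- by move=> i; rewrite invr_ge0 ltW.
- by move=> i h mh h0; rewrite lebesgue_scale.
Qed.

Lemma lebesgue_vec_opp n (g : n.-tuple R -> \bar R) :
  measurable_fun setT g -> (forall x, (0 <= g x)%E) ->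
  (\int[leb n]_x g (scalev (-1) x) = \int[leb n]_x g x)%E.
Proof.
move=> mg g0; rewrite -[RHS]mul1e (_ : 1%E = (\prod_(i < n) (1 : R))%:E); last by rewrite big1.
rewrite -(@lebesgue_vec_map _ (fun i x => -1 * x))//.
- by move=> i; mfun.
- move=> i h mh h0; rewrite mul1e; under eq_integral do rewrite mulN1r.
  exact: lebesgue_opp.
Qed.

Lemma lebesgue_vec_zerov n : leb n.+1 [set zerov] = 0%E.
Proof.
rewrite (_ : [set _] = [set x | forall i, [set 0] (tnth x i)]); last first.
  apply/seteqP; split => x /=; first by move=> -> i; rewrite tnth_mktuple.
  by move=> x0; apply: eq_from_tnth => i; rewrite tnth_mktuple x0.
rewrite (lebesgue_vec_box (A := fun=> [set 0])); last by move=> i; exact: measurable_set1.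
by rewrite big_ord_recl lebesgue_measure_set1 mul0e.
Qed.

Lemma measurable_ball n (r : R) : measurable (centered_ball r : set (n.-tuple R)).
Proof.
apply: (@measurable_bool _ _ R (fun x => normv x < r)).
mfun.
Qed.

Lemma tnth_le_normv n (x : n.-tuple R) i : `|tnth x i| <= normv x.
Proof.
rewrite -ler_sqr ?nnegrE ?normv_ge0// real_normK ?num_real// sqr_normv.
rewrite /dotv (bigD1 i)//= expr2 lerDl sumr_ge0// => j _.
by rewrite -expr2 sqr_ge0.
Qed.

Lemma ball_lt_oo n : (leb n (centered_ball 1) < +oo)%E.
Proof.
apply: (@le_lt_trans _ _ (leb n [set x | forall i, `[-1, 1]%classic (tnth x i)])).
  apply: le_measure; rewrite ?inE; first exact: measurable_ball.
    rewrite (_ : [set x | _] = \bigcap_(i in [set: 'I_n])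
        ((fun s : n.-tuple R => tnth s i) @^-1` `[-1, 1]%classic)).
      apply: fin_bigcap_measurable => // i _; rewrite -[X in measurable X]setTI.
      exact: (measurable_tnth i).
    by apply/seteqP; split => x /= Ax i; [move=> _|]; exact: Ax.
  move=> x; rewrite /centered_ball/= => x1 i; rewrite in_itv/= -ler_norml.
  by rewrite (le_trans (tnth_le_normv x i))// ltW.
rewrite (lebesgue_vec_box (A := fun=> `[-1, 1]%classic)); last by move=> i; exact: measurable_itv.
rewrite lebesgue_measure_itv/= lte_fin gtrN// -EFinD.
rewrite ltey_eq; apply/orP; left.
by elim/big_ind: _ => // x y xoo yoo; exact: fin_numM.
Qed.

Lemma ball_gt0 n : (0 < leb n (centered_ball 1))%E.
Proof.
(* The cube of half-side e = 1/(n+1) lies in the open unit ball, because n e^2 < e <= 1; taking n+1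
   covers dimension 0. *)
pose e : R := n.+1%:R^-1.
have e0 : 0 < e by rewrite invr_gt0 ltr0n.
apply: (@lt_le_trans _ _ (leb n [set x | forall i, `[- e, e]%classic (tnth x i)])).
  rewrite (lebesgue_vec_box (A := fun=> `[- e, e]%classic)); last by move=> i; exact: measurable_itv.
  rewrite lebesgue_measure_itv/= lte_fin gtrN// -EFinD.
  elim/big_ind: _ => //= [x y x0 y0|i _]; first by rewrite mule_gt0.
  by rewrite lte_fin opprK addr_gt0.
apply: le_measure; rewrite ?inE; last 2 first.
- exact: measurable_ball.
- move=> x /= xe; rewrite /centered_ball/= normvE -sqrtr1 ltr_sqrt//.
  apply: (@le_lt_trans _ _ (\sum_(i < n) e ^+ 2)).
    apply: ler_sum => i _; rewrite -expr2 -real_normK ?num_real//.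
    have := xe i; rewrite in_itv/= -ler_norml => xi.
    by rewrite ler_sqr ?nnegrE// ltW.
  rewrite sumr_const card_ord -mulr_natl expr2 mulrA.
  have ne1 : n%:R * e < 1 by rewrite /e ltr_pdivrMr ?ltr0n// mul1r ltr_nat.
  have e1 : e <= 1 by rewrite /e invf_le1 ?ler1n ?ltr0n.
  by apply: lt_le_trans e1; rewrite -[ltRHS]mul1r ltr_pM2r.
rewrite (_ : [set x | _] = \bigcap_(i in [set: 'I_n])
    ((fun s : n.-tuple R => tnth s i) @^-1` `[- e, e]%classic)).
  apply: fin_bigcap_measurable => // i _; rewrite -[X in measurable X]setTI.
  exact: (measurable_tnth i).
by apply/seteqP; split => x /= Ax i; [move=> _|]; exact: Ax.
Qed.

(* The proof of the uniqueness of Haar measure: [g (H x) * b y] is transformed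
   into [g x * b y] by translations, b being the indicator of the unit ball. *)
Lemma integral_involution n (H : n.-tuple R -> n.-tuple R)
    (g : n.-tuple R -> \bar R) :
  measurable_fun setT H -> (forall x y, H (addv x y) = addv (H x) (H y)) ->
  (forall a x, H (scalev a x) = scalev a (H x)) ->
  involutive H -> (forall x, normv (H x) = normv x) ->
  measurable_fun setT g -> (forall x, (0 <= g x)%E) ->
  (\int[leb n]_x g (H x) = \int[leb n]_x g x)%E.
Proof.
move=> mH HD HZ HK nH mg g0.
pose b (x : n.-tuple R) : \bar R := ((normv x < 1)%R%:R)%:E.
have mb : measurable_fun setT b by rewrite /b; mfun.
have b0 x : (0 <= b x)%E by rewrite lee_fin.
have intb : (\int[leb n]_x b x = leb n (centered_ball 1))%E.
  rewrite -[X in leb n X]setIT -integral_indic//; last exact: measurable_ball.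
  by apply: eq_integral => x _; rewrite /b indicE mem_setE.
have bfin : leb n (centered_ball 1) \is a fin_num.
  by rewrite ge0_fin_numE// ball_lt_oo.
have bn0 : leb n (centered_ball 1) != 0%E by rewrite gt_eqF// ball_gt0.
(* The isometric involution enters here: [H] maps x - H y to H x - y, the opposite of y - H x, which
   has the same norm. *)
have bb x y : b (addv (scalev (-1) (H x)) y) = b (addv (scalev (-1) (H y)) x).
  rewrite /b -(nH (addv (scalev (-1) (H y)) x)) HD HZ HK.
  rewrite (_ : addv _ y = scalev (-1) (addv (scalev (-1) y) (H x))).
    by rewrite normv_scale normrN1 mul1r.
  by apply: eq_from_tnth => i; rewrite !tnth_mktuple; ring.
suff : (\int[leb n]_x g (H x) * leb n (centered_ball 1) =
        \int[leb n]_x g x * leb n (centered_ball 1))%E.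
  move/(congr1 (fun z => z * ((fine (leb n (centered_ball 1)))^-1)%:E)%E).
  rewrite -!muleA -(fineK bfin)/= -EFinM mulfV ?mule1//.
  by apply: contra bn0 => /eqP H0; rewrite -(fineK bfin) H0.
rewrite -intb -!ge0_integralZr//; last 3 first.
- exact: integral_ge0.
- exact: measurableT_comp.
- exact: integral_ge0.
transitivity (\int[leb n]_x \int[leb n]_y (g (H x) * b y))%E.
  apply: eq_integral => x _; rewrite ge0_integralZl//.
transitivity (\int[leb n]_y \int[leb n]_x (g (addv y (H x)) * b y))%E.
  rewrite (fubini_swap (fun x y => g (H x) * b y)%E); last 2 first.
  - by mfun.
  - by move=> x y; rewrite mule_ge0.
  apply: eq_integral => y _.
  rewrite -(lebesgue_vec_shift (H y) (g := fun x => g (H x) * b y)%E)//; last 2 first.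
  - by mfun.
  - by move=> x; rewrite mule_ge0.
  by apply: eq_integral => x _; rewrite HD HK.
rewrite (fubini_swap (fun y x => g (addv y (H x)) * b y)%E); last 2 first.
- by mfun.
- by move=> x y; rewrite mule_ge0.
transitivity (\int[leb n]_x \int[leb n]_y (g y * b (addv (scalev (-1) (H x)) y)))%E.
  apply: eq_integral => x _.
  rewrite -(lebesgue_vec_shift (scalev (-1) (H x)) (g := fun y => g (addv y (H x)) * b y)%E)//; last 2 first.
  - by mfun.
  - by move=> y; rewrite mule_ge0.
  apply: eq_integral => y _; congr (g _ * _)%E.
  rewrite (addvC _ y) -addvA -{2}[H x]scale1v -scalevDl addNr scale0v.
  by rewrite addvC add0v.
rewrite (fubini_swap (fun x y => g y * b (addv (scalev (-1) (H x)) y))%E); last 2 first.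
- by mfun.
- by move=> x y; rewrite mule_ge0.
apply: eq_integral => y _; rewrite -mule_integral; sides.
under eq_integral do rewrite bb.
by rewrite -(lebesgue_vec_shift (scalev (-1) (H y)) (g := b)).
Qed.

(** Orthogonal reflection in the hyperplane normal to [w]. For w = 0 the convention on the inverse
    of 0 makes it the identity, so its algebra holds for every [w]. *)
Definition reflection n (w x : n.-tuple R) : n.-tuple R :=
  addv x (scalev (- (2 * dotv w x / dotv w w)) w).

Lemma measurable_reflection n (w : n.-tuple R) : measurable_fun setT (reflection w).
Proof. by rewrite /reflection; mfun. Qed.

Lemma reflectionD n (w x y : n.-tuple R) :
  reflection w (addv x y) = addv (reflection w x) (reflection w y).
Proof.
by apply: eq_from_tnth => i; rewrite !tnth_mktuple dotvDr; ring.
Qed.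

Lemma reflectionZ n (w : n.-tuple R) a x :
  reflection w (scalev a x) = scalev a (reflection w x).
Proof.
by apply: eq_from_tnth => i; rewrite !tnth_mktuple dotvZr; ring.
Qed.

Lemma dotv_reflection n (w x y : n.-tuple R) :
  dotv (reflection w x) (reflection w y) = dotv x y.
Proof.
rewrite !(dotvDl, dotvDr, dotvZl, dotvZr) (dotvC x w).
have [w0|w0] := eqVneq (dotv w w) 0; last by field.
by rewrite w0 invr0; ring.
Qed.

Lemma reflectionK n (w : n.-tuple R) : involutive (reflection w).
Proof.
move=> x; rewrite {1}/reflection {2}/reflection dotvDr dotvZr.
apply: eq_from_tnth => i; rewrite !tnth_mktuple.
have [w0|w0] := eqVneq (dotv w w) 0; last by field.
by rewrite w0 invr0; ring.
Qed.

Definition axisv n (r : R) : n.+1.-tuple R := consv (r, zerov).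

Lemma dotv_consv n (a b : R) (x y : n.-tuple R) :
  dotv (consv (a, x)) (consv (b, y)) = a * b + dotv x y.
Proof. by rewrite /dotv big_ord_recl; congr (_ + _); apply: eq_bigr => i _; rewrite !tnthS. Qed.

(** With e the axis vector of the same norm as x and w = x - e, equality of the norms gives <w,w> =
    2 <w,x>, so the reflection sends x to x - w = e. If w = 0, then x already lies on the axis. *)
Lemma reflection_axis n (x : n.+1.-tuple R) :
  reflection (addv x (scalev (-1) (axisv n (normv x)))) x = axisv n (normv x).
Proof.
set e := axisv _ _; set w := addv _ _.
have ee : dotv e e = dotv x x.
  by rewrite /e /axisv dotv_consv dot0v addr0 -expr2 sqr_normv.
have wx : dotv w x = dotv x x - dotv e x by rewrite /w dotvDl dotvZl mulN1r.
have ww : dotv w w = 2 * dotv w x.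
  rewrite wx {1 2}/w !(dotvDl, dotvDr, dotvZl, dotvZr) (dotvC x e) ee; ring.
rewrite /reflection; have [w0|w0] := eqVneq (dotv w w) 0.
  rewrite w0 invr0 mulr0 oppr0 scale0v addvC add0v.
  move/eqP: w0; rewrite dotv_eq0 => /eqP w0.
  rewrite -[x]add0v -[e]add0v addvC -w0 /w.
  apply: eq_from_tnth => i; rewrite !tnth_mktuple.
  have := congr1 (fun v => tnth v i) w0; rewrite /w !tnth_mktuple => H.
  by move: H; lra.
rewrite -ww divff//; apply: eq_from_tnth => i; rewrite !tnth_mktuple; ring.
Qed.

(** Collects what is needed to move a privileged vector to the first axis under an integral, where
    [integral_lebesgue_vecS] can single out one coordinate. *)
Lemma rotate_to_axis n (x : n.+1.-tuple R) : exists H : n.+1.-tuple R -> n.+1.-tuple R,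
  [/\ measurable_fun setT H, H x = axisv n (normv x),
      (forall y z, dotv (H y) (H z) = dotv y z),
      ((forall y z, H (addv y z) = addv (H y) (H z)) /\
       (forall a y, H (scalev a y) = scalev a (H y))) &
      involutive H /\ forall g : n.+1.-tuple R -> \bar R,
        measurable_fun setT g -> (forall x, (0 <= g x)%E) ->
        (\int[leb n.+1]_x g (H x) = \int[leb n.+1]_x g x)%E].
Proof.
exists (reflection (addv x (scalev (-1) (axisv n (normv x))))); split.
- exact: measurable_reflection.
- exact: reflection_axis.
- exact: dotv_reflection.
- by split; [exact: reflectionD|exact: reflectionZ].
- split; first exact: reflectionK.
  move=> g mg g0; apply: integral_involution => //.
  + exact: measurable_reflection.
  + exact: reflectionD.
  + exact: reflectionZ.
  + exact: reflectionK.
  + by move=> y; rewrite !normvE dotv_reflection.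
Qed.

End lebesgue_vec_theory.

(** * The uniform law on the sphere and polar coordinates *)

Section polar_coordinates.
Context {R : realType} {n : nat}.
Notation lambda := (@lebesgue_measure R).
Notation leb := (@lebesgue_vec R n.+1).
Notation vec := (n.+1.-tuple R).

Definition ball_volume : R := fine (leb (centered_ball 1)).

Lemma ball_volumeE : leb (centered_ball 1) = ball_volume%:E.
Proof. by rewrite /ball_volume fineK// ge0_fin_numE// ball_lt_oo. Qed.

Lemma ball_volume_gt0 : 0 < ball_volume.
Proof. by rewrite -lte_fin -ball_volumeE ball_gt0. Qed.

Definition punctured_ball : set vec := [set x | 0 < normv x < 1].

Lemma measurable_punctured_ball : measurable punctured_ball.
Proof. apply: (@measurable_bool _ _ R); mfun. Qed.

Lemma measurable_zerov : measurable [set zerov : vec].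
Proof.
rewrite (_ : [set zerov] = [set x : vec | normv x <= 0]).
  apply: (@measurable_bool _ _ R); mfun.
apply/seteqP; split => x /=; first by move=> ->; rewrite le_eqVlt normv_eq0 eqxx.
by rewrite le_eqVlt ltNge normv_ge0 orbF normv_eq0 => /eqP.
Qed.

Lemma punctured_ballE : leb punctured_ball = ball_volume%:E.
Proof.
rewrite -ball_volumeE (_ : centered_ball 1 = punctured_ball `|` [set zerov]).
  rewrite measureU0//; first exact: measurable_punctured_ball.
    exact: measurable_zerov.
  exact: lebesgue_vec_zerov.
apply/seteqP; split => x; rewrite /centered_ball /punctured_ball /=.
  move=> x1; have [->|x0] := eqVneq x zerov; [by right|left].
  by rewrite x1 lt_neqAle normv_ge0 eq_sym normv_eq0 x0.
move=> [/andP[]//|->].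
by rewrite (_ : normv _ = 0)// ; apply/eqP; rewrite normv_eq0.
Qed.

Definition direction (x : vec) : vec := scalev (normv x)^-1 x.

Lemma measurable_direction : measurable_fun setT direction.
Proof. rewrite /direction; mfun. Qed.

Let invvol_ge0 : 0 <= ball_volume^-1.
Proof. by rewrite invr_ge0 ltW// ball_volume_gt0. Qed.

(** The cone measure of [sphere_law], assembled from an image and a restriction so that it is a
    measure by construction. The origin, whose direction would be the default [zerov], is
    removed. *)
Definition uniform_sphere : set vec -> \bar R :=
  mscale (NngNum invvol_ge0)
    (image_measure (mrestr leb measurable_punctured_ball) measurable_direction).

HB.instance Definition _ := Measure.on uniform_sphere.

Lemma uniform_sphere_setT : uniform_sphere setT = 1%E.
Proof.
rewrite /uniform_sphere /mscale/= /pushforward preimage_setT /mrestr setTI.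
by rewrite punctured_ballE -EFinM mulVf// gt_eqF// ball_volume_gt0.
Qed.

HB.instance Definition _ := Measure_isProbability.Build _ _ _ uniform_sphere
  uniform_sphere_setT.

Lemma sphere_lawE A : sphere_law A = uniform_sphere A.
Proof.
rewrite /sphere_law /uniform_sphere /mscale/= /pushforward /mrestr muleC.
by congr (_ * leb _)%E; apply/seteqP; split => x /= [].
Qed.

Lemma integral_uniform_sphere (g : vec -> \bar R) :
  measurable_fun setT g -> (forall x, (0 <= g x)%E) ->
  (\int[uniform_sphere]_v g v = (ball_volume^-1)%:E *
    \int[leb]_y (((0 < normv y < 1)%R%:R)%:E * g (direction y)))%E.
Proof.
move=> mg g0; have mdir := measurable_direction.
transitivity (\int[mscale (NngNum invvol_ge0)
    (image_measure (mrestr leb measurable_punctured_ball) measurable_direction)]_v g v)%E.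
  by apply: eq_measure_integral.
rewrite ge0_integral_mscale; last 3 first.
- exact: measurableT.
- exact: mg.
- by move=> x _; exact: g0.
apply: mule_eqr; rewrite (ge0_integral_image _ _ mg g0).
rewrite (ge0_integral_mrestr _ _ (measurableT_comp mg mdir)); last first.
  by move=> x; exact: g0.
by rewrite integral_indicl; apply: eq_integral => y _; rewrite indicE mem_setE.
Qed.

Lemma normv_direction (y : vec) : normv y != 0 -> normv (direction y) = 1.
Proof.
by move=> y0; rewrite normv_scale ger0_norm ?invr_ge0 ?normv_ge0// mulVf.
Qed.

(** Every point of the punctured ball has a direction of norm 1, so the cone measure charges unit
    vectors only. All later computations over the sphere use this to assume [normv v = 1]. *)
Lemma ae_uniform_sphere (g1 g2 : vec -> \bar R) :
  measurable_fun setT g1 -> (forall x, (0 <= g1 x)%E) ->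
  measurable_fun setT g2 -> (forall x, (0 <= g2 x)%E) ->
  (forall v, normv v = 1 -> g1 v = g2 v) ->
  (\int[uniform_sphere]_v g1 v = \int[uniform_sphere]_v g2 v)%E.
Proof.
move=> mg1 g10 mg2 g20 g12; rewrite !integral_uniform_sphere//; congr (_ * _)%E.
apply: eq_integral => y _; have [/andP[y0 y1]|] := boolP (0 < normv y < 1).
  by rewrite g12// normv_direction// gt_eqF.
by rewrite !mul0e.
Qed.

Lemma integral_power_tail (r : R) : 0 < r ->
  (\int[lambda]_s (((r < s)%R%:R * (s ^+ n.+2)^-1)%:E) =
    ((n.+1%:R * r ^+ n.+1)^-1)%:E)%E.
Proof.
move=> r0.
transitivity (\int[lambda]_(s in `[r, +oo[) ((s ^+ n.+2)^-1)%:E)%E.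
  rewrite -integral_itv_obnd_cbnd; last first.
    apply: measurable_funTS; mfun.
  rewrite [RHS]integral_indicl; apply: eq_integral => s _.
  by rewrite -EFinM indicE mem_setE in_itv/= andbT.
pose F (s : R) : R := - n.+1%:R^-1 * (s ^-1) ^+ n.+1.
have dF (x : R) : 0 < x -> is_derive x 1 F (x ^- n.+2).
  move=> x0.
  have x0' : x != 0 by rewrite gt_eqF.
  have dV := is_deriveV (f := @id R) x0' (is_derive_id x 1).
  have -> : F = - n.+1%:R^-1 \*: ((GRing.inv : R -> R) ^+ n.+1).
    by apply/funext => y; rewrite /F !fctE.
  apply: is_derive_eq.
  rewrite /= !scaler1 /GRing.scale/= -!exprVn !exprS.
  by rewrite mulrN mulrNN -(mulrA n.+1%:R) mulKf ?pnatr_eq0// expr0 mulr1; ring.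
have cF (x : R) : 0 < x -> {for x, continuous F}.
  move=> x0; apply: differentiable_continuous; apply/derivable1_diffP.
  by case: (dF _ x0).
rewrite (@ge0_continuous_FTC2y _ _ F _ 0).
- rewrite sub0e -EFinN; congr EFin.
  by rewrite /F mulNr opprK invfM exprVn.
- by move=> s rs; rewrite invr_ge0 exprn_ge0// ltW// (lt_le_trans r0)//.
- apply: continuous_in_subspaceT => x /set_mem/=; rewrite in_itv/= andbT => rx.
  have x0 : 0 < x by exact: lt_le_trans rx.
  by apply: cvgV; [rewrite expf_neq0// gt_eqF|exact: exprn_continuous].
- rewrite -[X in _ --> X](mulr0 (- n.+1%:R^-1)); apply: cvgM; first exact: cvg_cst.
  rewrite -[X in _ --> X](expr0n R n.+1).
  have H : (s : R)^-1 @[s --> +oo%R] --> (0 : R).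
    by apply/gtr0_cvgV0; [exact: nbhs_pinfty_gt|exact: cvg_id].
  exact: (cvg_comp _ _ H (@exprn_continuous R n.+1 0)).
- by move=> x rx; have [] := dF _ (lt_trans r0 rx).
- by apply: cvg_at_right_filter; exact: cF.
- move=> x; rewrite in_itv/= andbT => rx; rewrite derive1E.
  by apply: derive_val; apply: dF; exact: lt_trans rx.
Qed.

Lemma integral_neq0 (g : vec -> \bar R) :
  measurable_fun setT g -> (forall x, (0 <= g x)%E) ->
  (\int[leb]_x (((0 < normv x)%R%:R)%:E * g x) = \int[leb]_x g x)%E.
Proof.
move=> mg g0.
rewrite [RHS](@ge0_negligible_integral _ _ _ _ setT [set zerov])//; last 2 first.
- exact: measurable_zerov.
- exact: lebesgue_vec_zerov.
rewrite [RHS]integral_indicl; apply: eq_integral => x _; congr (_%:R%:E * _)%E.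
rewrite setTD lt_neqAle normv_ge0 andbT eq_sym normv_eq0.
by rewrite in_setC; congr (~~ _); apply/eqP/idP => [->|]; rewrite inE.
Qed.

Let kappa (s : R) : R := (0 < s)%R%:R * s ^+ n.

Let kappa_ge0 s : 0 <= kappa s.
Proof.
by rewrite /kappa; case: ltP => s0; rewrite ?mul0r// mul1r exprn_ge0// ltW.
Qed.

Let mkappa : measurable_fun setT kappa.
Proof. rewrite /kappa; mfun. Qed.

(** Start from the right-hand side and write the spherical mean as an integral over the unit ball.
    Two dilations and exchanges of integrals bring the argument of [g] to a free variable z; what
    remains is the integral of s^(-n-2) over s > |z|, which cancels the factor |z|^(n+1) up to the
    constant n+1. *)
Lemma polar_coordinates (g : vec -> \bar R) :
  measurable_fun setT g -> (forall x, (0 <= g x)%E) ->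
  (\int[leb]_x g x = (n.+1%:R * ball_volume)%:E *
    \int[lambda]_s (((0 < s)%R%:R * s ^+ n)%:E *
      \int[uniform_sphere]_v g (scalev s v)))%E.
Proof.
move=> mg g0; have vol0 := ball_volume_gt0; have mdir := measurable_direction.
have mk := mkappa.
apply/esym.
transitivity (n.+1%:R%:E * \int[lambda]_s \int[leb]_y
   ((kappa s * (0 < normv y < 1)%R%:R)%:E * g (scalev s (direction y))))%E.
  rewrite mulrC EFinM muleC muleA -ge0_integralZr//; last 3 first.
  - apply: emeasurable_funM; first by mfun.
    apply: (measurable_integral_r uniform_sphere (fun s v => g (scalev s v))) => //.
    by mfun.
  - move=> s _; rewrite -/(kappa s); pos.
  - by rewrite lee_fin ltW.
  rewrite muleC; apply: mule_eqr; apply: eq_integral => s _.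
  rewrite integral_uniform_sphere//; last by mfun.
  rewrite -muleA [X in (_ * X)%E]muleAC -EFinM mulVf ?gt_eqF// mul1e.
  rewrite -ge0_integralZl//; last 3 first.
  - by mfun.
  - pos.
  - by rewrite lee_fin kappa_ge0.
  by apply: eq_integral => y _; rewrite EFinM muleA.
rewrite (fubini_swap (m1 := lambda) (m2 := leb) (fun s y => ((kappa s * (0 < normv y < 1)%R%:R)%:E * g (scalev s (direction y)))%E)); last 2 first.
- by mfun.
- pos.
(* Dilation of s by |y| with y fixed: s times the direction of y becomes s y, and s^n ds releases
   |y|^(n+1). *)
transitivity (n.+1%:R%:E * \int[leb]_y \int[lambda]_s
   ((kappa s * (0 < normv y < 1)%R%:R * normv y ^+ n.+1)%:E * g (scalev s y)))%E.
  apply: mule_eqr; apply: eq_integral => y _.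
  have [/andP[y0 y1]|] := boolP (0 < normv y < 1); last first.
    move=> _; rewrite !integral0_eq// => s _; first by rewrite mulr0 mul0r mul0e.
    by rewrite mulr0 mul0e.
  pose h s : \bar R := ((kappa (normv y * s))%:E * g (scalev s y))%E.
  transitivity (\int[lambda]_s h ((normv y)^-1 * s)%R)%E.
    apply: eq_integral => s _; rewrite /h mulr1 mulrA mulfV ?gt_eqF// mul1r.
    by rewrite /direction scalevA [(_ * s)%R]mulrC.
  rewrite lebesgue_scale//; last 3 first.
  - by rewrite invr_gt0.
  - by rewrite /h; mfun.
  - move=> s; rewrite /h; pos.
  rewrite invrK -ge0_integralZl//; last 3 first.
  - by rewrite /h; mfun.
  - move=> s _; rewrite /h; pos.
  - by rewrite lee_fin normv_ge0.
  apply: eq_integral => s _; rewrite /h muleA -EFinM; congr (_%:E * _)%E.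
  by rewrite /kappa pmulr_rgt0// mulr1 exprMn exprS; ring.
rewrite (fubini_swap (m1 := leb) (m2 := lambda) (fun y s => ((kappa s * (0 < normv y < 1)%R%:R * normv y ^+ n.+1)%:E * g (scalev s y))%E)); last 2 first.
- by mfun.
- pos.
(* Substitution z = s y with s fixed: |y| < 1 becomes |z| < s, and the exponent of s drops from n to
   -(n+2). *)
transitivity (n.+1%:R%:E * \int[lambda]_s \int[leb]_z
   (((0 < normv z)%R%:R * normv z ^+ n.+1 * ((normv z < s)%R%:R * (s ^+ n.+2)^-1))%:E * g z))%E.
  apply: mule_eqr; apply: eq_integral => s _.
  have [s0|s0] := ltP 0 s; last first.
    rewrite !integral0_eq// => z _; last by rewrite /kappa ltNge s0/= !mul0r mul0e.
    by rewrite (ltNge (normv z)) (le_trans s0 (normv_ge0 _))/= mul0r mulr0 mul0e.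
  pose G z : \bar R := ((kappa s * (0 < normv z < s)%R%:R * (normv z / s) ^+ n.+1)%:E * g z)%E.
  transitivity (\int[leb]_y G (scalev s y))%E.
    apply: eq_integral => y _; rewrite /G normv_scale gtr0_norm// pmulr_rgt0//.
    have -> : s * normv y / s = normv y by rewrite mulrAC divff ?gt_eqF// mul1r.
    by rewrite gtr_pMr.
  rewrite lebesgue_vec_scale//; last 2 first.
  - by rewrite /G; mfun.
  - move=> z; rewrite /G; pos.
  rewrite -ge0_integralZl//; last 3 first.
  - by rewrite /G; mfun.
  - move=> z _; rewrite /G; pos.
  - by rewrite lee_fin invr_ge0 exprn_ge0// ltW.
  apply: eq_integral => z _; rewrite /G muleA -EFinM; congr (_%:E * _)%E.
  rewrite /kappa s0 mul1r exprMn exprVn.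
  have -> : (0 < normv z < s)%R%:R = (0 < normv z)%R%:R * (normv z < s)%R%:R :> R.
    by case: (0 < normv z); case: (normv z < s); rewrite ?mulr1 ?mulr0.
  by rewrite !exprS; field; rewrite expf_neq0 gt_eqF.
have tail_ge0 (z : vec) (s : R) : 0 <= (normv z < s)%R%:R * (s ^+ n.+2)^-1.
  case: ltP => [zs|_]; last by rewrite mul0r.
  by rewrite mul1r invr_ge0 exprn_ge0// ltW// (le_lt_trans (normv_ge0 z)).
have w_ge0 (z : vec) (s : R) :
    0 <= (0 < normv z)%R%:R * normv z ^+ n.+1 * ((normv z < s)%R%:R * (s ^+ n.+2)^-1).
  by apply: mulr_ge0; [pos|exact: tail_ge0].
rewrite (fubini_swap (m1 := lambda) (m2 := leb) (fun s z => (((0 < normv z)%R%:R * normv z ^+ n.+1 * ((normv z < s)%R%:R * (s ^+ n.+2)^-1))%:E * g z)%E)); last 2 first.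
- by mfun.
- by move=> s z; rewrite mule_ge0// lee_fin w_ge0.
rewrite -ge0_integralZl//; last 2 first.
- apply: (measurable_integral_r lambda (fun z s => (((0 < normv z)%R%:R * normv z ^+ n.+1 * ((normv z < s)%R%:R * (s ^+ n.+2)^-1))%:E * g z)%E)).
    by mfun.
  by move=> z s; rewrite mule_ge0// lee_fin w_ge0.
- by move=> z _; apply: integral_ge0 => s _; rewrite mule_ge0// lee_fin w_ge0.
rewrite -integral_neq0//; apply: eq_integral => z _.
have [z0|] := ltP 0 (normv z); last first.
  by move=> _; rewrite mul0e integral0_eq ?mule0// => s _; rewrite !mul0r mul0e.
under eq_integral do rewrite mul1r.
rewrite ge0_integralZr//; last 2 first.
- by mfun.
- by move=> s _; rewrite lee_fin mulr_ge0 ?exprn_ge0 ?normv_ge0 ?tail_ge0.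
rewrite mul1e muleA.
under eq_integral do rewrite EFinM.
rewrite ge0_integralZl//; last 3 first.
- by mfun.
- by move=> s _; rewrite lee_fin tail_ge0.
- by rewrite lee_fin exprn_ge0// normv_ge0.
rewrite integral_power_tail// muleA -!EFinM.
rewrite (_ : (_ * _)%R = 1%R) ?mul1e//.
by rewrite invfM mulrACA mulfV ?pnatr_eq0// mul1r mulfV// expf_neq0// gt_eqF.
Qed.

End polar_coordinates.

(** * The shear y - |y| x *)

Section shear_one_dimension.
Context {R : realType}.
Notation lambda := (@lebesgue_measure R).
Variables (r s : R).
Hypotheses (r0 : 0 <= r) (r1 : r <= 1) (s0 : 0 < s).

(** Norm of a point with first coordinate y at distance s from the axis; [F] is the effect of the
    shear on a line parallel to the axis. *)
Let rad (y : R) := Num.sqrt (y ^+ 2 + s ^+ 2).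

Let F (y : R) := y - r * rad y.

Let f (y : R) := 1 - r * y / rad y.

Let q_gt0 (y : R) : 0 < y ^+ 2 + s ^+ 2.
Proof. by rewrite ltr_wpDl ?sqr_ge0// exprn_gt0. Qed.

Let rad_gt0 (y : R) : 0 < rad y.
Proof. by rewrite sqrtr_gt0. Qed.

Let abs_lt_rad (y : R) : `|y| < rad y.
Proof.
rewrite -[ltLHS]sqrtr_sqr ltr_sqrt//.
by rewrite ltrDl exprn_gt0.
Qed.

Let f_gt0 (y : R) : 0 < f y.
Proof.
rewrite /f subr_gt0 ltr_pdivrMr// mul1r.
apply: le_lt_trans (abs_lt_rad y).
apply: le_trans (ler_norm _) _.
by rewrite normrM ger0_norm// -[leRHS]mul1r ler_wpM2r.
Qed.

Let mF : measurable_fun setT F.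
Proof. by rewrite /F /rad; mfun. Qed.

Let mf : measurable_fun setT f.
Proof. by rewrite /f /rad; mfun. Qed.

Let dF (y : R) : is_derive y 1 F (f y).
Proof.
have dq : is_derive y 1 (fun u : R => u ^+ 2 + s ^+ 2) (2 * y).
  have -> : (fun u : R => u ^+ 2 + s ^+ 2) = (@id R) ^+ 2 + cst (s ^+ 2).
    by apply/funext => u; rewrite !fctE.
  by apply: is_derive_eq; rewrite /= addr0 expr1 scaler1.
have dr := @is_derive1_comp R Num.sqrt (fun u : R => u ^+ 2 + s ^+ 2) y _ _
  (is_derive1_sqrt (q_gt0 y)) dq.
have -> : F = id - r \*: (Num.sqrt \o (fun u : R => u ^+ 2 + s ^+ 2)).
  by apply/funext => u; rewrite /F !fctE.
apply: is_derive_eq; rewrite /f /rad /GRing.scale/=; congr (1 - _).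
by field; rewrite gt_eqF// sqrtr_gt0.
Qed.

Let cf (y : R) : {for y, continuous f}.
Proof.
rewrite /f; apply: cvgB; first exact: cvg_cst.
apply: cvgM; first by apply: cvgM; [exact: cvg_cst|exact: cvg_id].
apply: cvgV; first by rewrite gt_eqF.
apply: (cvg_comp (fun u : R => u ^+ 2 + s ^+ 2)); last exact: sqrt_continuous.
by apply: cvgD; [exact: exprn_continuous|exact: cvg_cst].
Qed.

Let Fmono (x y : R) : x <= y -> F x <= F y.
Proof.
rewrite le_eqVlt => /predU1P[->//|xy]; apply: ltW.
apply: (@gtr0_derive1_incr _ F x y _ _ _ x y (lexx x) xy (lexx y)).
- by move=> z _; case: (dF z).
- by move=> z _; rewrite derive1E; case: (dF z) => _ ->.
- by apply: derivable_within_continuous => z _; case: (dF z).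
Qed.

(** F (- k) <= - k tends to minus infinity, whereas F k grows like (1 - r) k if r < 1 and stays
    negative, approaching 0, if r = 1. *)
Let image : \bigcup_k `]F (- k%:R), F k%:R]%classic = [set z : R | (r < 1) || (z < 0)].
Proof.
apply/seteqP; split => z /=.
  move=> [k _] /=; rewrite in_itv/= => /andP[_ zF].
  have [//|r1'] := ltP r 1; rewrite /=.
  have r1E : r = 1 by apply/eqP; rewrite eq_le r1.
  apply: le_lt_trans zF _; rewrite /F r1E mul1r subr_lt0.
  exact: le_lt_trans (ler_norm _) (abs_lt_rad _).
have Fneg k : F (- k%:R) <= - k%:R.
  by rewrite /F gerBl mulr_ge0// ltW.
move=> zr.
suff [M FM] : exists M : R, 0 <= M /\ forall k : nat, M <= k%:R -> z <= F k%:R.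
  have [k kM] : exists k : nat, Num.max M (1 - z) < k%:R.
    exists (Num.bound (Num.max M (1 - z))); apply: archi_boundP.
    by rewrite le_max; case: FM => ->.
  exists k => //=; rewrite in_itv/=.
  move: kM; rewrite gt_max => /andP[Mk zk]; case: FM => _ /(_ k (ltW Mk)) ->.
  rewrite andbT; apply: le_lt_trans (Fneg k) _.
  by lra.
have [r1'|r1'] := ltP r 1.
  (* Beyond this threshold (1 - r) k - r s >= z, and F k is at least the left side since rad k <= k
     + s. *)
  exists (Num.max 0 ((z + r * s) / (1 - r))); split; first by rewrite le_max lexx.
  move=> k; rewrite ge_max => /andP[k0].
  rewrite ler_pdivrMr ?subr_gt0// => zk.
  have : rad k%:R <= k%:R + s.
    rewrite -ler_sqr ?nnegrE; last 2 first.
    - exact: ltW.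
    - by rewrite addr_ge0// ltW.
    rewrite sqr_sqrtr; last exact: ltW.
    by rewrite sqrrD addrAC lerDl mulrn_wge0// mulr_ge0// ltW.
  rewrite /F => H; have : r * rad k%:R <= r * (k%:R + s) by rewrite ler_wpM2l.
  by move: zk; lra.
have r1E : r = 1 by apply/eqP; rewrite eq_le r1.
move: zr; rewrite r1E ltxx /= => z0.
(* From k (- z) >= s^2 follows k^2 + s^2 <= (k - z)^2, that is rad k <= k - z. *)
exists (Num.max 1 (s ^+ 2 / (- z))); split; first by rewrite le_max ler01.
move=> k; rewrite ge_max => /andP[k1].
rewrite ler_pdivrMr ?oppr_gt0// => zk.
rewrite /F r1E mul1r lerBrDr -lerBrDl -ler_sqr ?nnegrE; last 2 first.
- by rewrite ltW.
- by rewrite subr_ge0 (le_trans (ltW z0)).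
rewrite sqr_sqrtr; last exact: ltW.
apply: (@le_trans _ _ (k%:R ^+ 2 + k%:R * (- z) + z ^+ 2)).
  by rewrite -addrA lerD2l (le_trans zk)// lerDl sqr_ge0.
rewrite sqrrB mulr2n.
have : 0 <= k%:R * (- z) by rewrite mulr_ge0// oppr_ge0 ltW.
by lra.
Qed.

(** The substitution is made on ]-k, k], and monotone convergence exhausts the line on one side and
    [image] on the other. *)
Lemma shear_1d (g : R -> \bar R) :
  measurable_fun setT g -> (forall x, (0 <= g x)%E) ->
  (\int[lambda]_y ((1 - r * y / Num.sqrt (y ^+ 2 + s ^+ 2))%:E *
      g (y - r * Num.sqrt (y ^+ 2 + s ^+ 2))%R) =
   \int[lambda]_z ((((r < 1) || (z < 0))%R%:R)%:E * g z))%E.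
Proof.
move=> mg g0.
have mG : measurable_fun setT (fun y => (f y)%:E * g (F y))%E by mfun.
have G0 y : (0 <= (f y)%:E * g (F y))%E by rewrite mule_ge0// lee_fin ltW.
transitivity (\int[lambda]_(z in [set z : R | ((r < 1) || (z < 0))%R]) g z)%E; last first.
  by rewrite integral_indicl; apply: eq_integral => z _; rewrite indicE mem_setE.
rewrite -image.
have ndF : nondecreasing_seq (fun k : nat => `]F (- k%:R), F k%:R]%classic).
  move=> k l kl; apply/subsetPset; apply: subset_itv; rewrite bnd_simp; apply: Fmono.
    by rewrite lerN2 ler_nat.
  by rewrite ler_nat.
have nd : nondecreasing_seq (fun k : nat => `](- k%:R : R), k%:R]%classic).
  by move=> k l kl; apply/subsetPset; apply: subset_itv; rewrite bnd_simp ?lerN2 ler_nat.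
have H1 := @ge0_nondecreasing_set_cvg_integral _ (measurableTypeR R) R
  (fun k : nat => `]F (- k%:R), F k%:R]%classic) g lambda ndF
  (fun=> measurable_itv _) (fun=> measurable_funTS mg) (fun _ _ _ => g0 _).
have H2 := @ge0_nondecreasing_set_cvg_integral _ (measurableTypeR R) R
  (fun k : nat => `](- k%:R), k%:R]%classic) (fun y => (f y)%:E * g (F y))%E lambda nd
  (fun=> measurable_itv _) (fun=> measurable_funTS mG) (fun _ _ _ => G0 _).
move: H2; rewrite bigcup_itvT => H2.
rewrite -(cvg_lim _ H1)//.
transitivity (\int[lambda]_y ((f y)%:E * g (F y)))%E; first by [].
rewrite -(cvg_lim _ H2)//; congr (limn _); apply/funext => k.
apply: (change_of_variable_C1 _ mF mf (fun x _ => dF x) (fun x _ => @cf x)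
  (fun x _ => f_gt0 x) mg g0).
by rewrite (@le_trans _ _ 0)// oppr_le0.
Qed.

End shear_one_dimension.

Section shear.
Context {R : realType} {n : nat}.
Notation lambda := (@lebesgue_measure R).
Notation leb := (@lebesgue_vec R).
Notation vec := (n.+2.-tuple R).

Let weight (x y : vec) : R := 1 - dotv x y / normv y.

Let weight_ge0 x y : normv x <= 1 -> 0 <= weight x y.
Proof.
move=> x1; rewrite /weight subr_ge0.
have [y0|y0] := eqVneq (normv y) 0; first by rewrite y0 invr0 mulr0.
rewrite ler_pdivrMr ?lt_neqAle ?normv_ge0 1?eq_sym ?y0// mul1r.
apply: le_trans (cauchy_schwarz _ _) _.
by rewrite -[leRHS]mul1r ler_wpM2r// normv_ge0.
Qed.

Lemma addv_scale_axis (a b r : R) (s : n.+1.-tuple R) :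
  addv (consv (a, s)) (scalev b (axisv n.+1 r)) = consv (a + b * r, s).
Proof.
apply: eq_from_tnth => i; rewrite !tnth_mktuple.
have [j ->|->] := unliftP ord0 i; last by rewrite /axisv /consv !tnth0.
by rewrite /axisv /consv !tnthS tnth_mktuple mulr0 addr0.
Qed.

(** Along the first axis the shear fixes the other coordinates [s], so Tonelli reduces it to
    [shear_1d] with |s| as the distance. The null set s = 0 is set aside, that distance having to be
    positive. *)
Let shear_axis (r : R) (g : vec -> \bar R) : 0 <= r <= 1 ->
  measurable_fun setT g -> (forall x, (0 <= g x)%E) ->
  (\int[leb n.+2]_y ((weight (axisv n.+1 r) y)%:E *
      g (addv y (scalev (- normv y) (axisv n.+1 r)))) =
   \int[leb n.+2]_z ((((r < 1) || (dotv (axisv n.+1 r) z < 0))%R%:R)%:E * g z))%E.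
Proof.
move=> /andP[r0 r1] mg g0.
have nax : normv (axisv n.+1 r) <= 1.
  by rewrite normvE dotv_consv dot0v addr0 -expr2 sqrtr_sqr ger0_norm.
have mw : measurable_fun setT (weight (axisv n.+1 r)) by rewrite /weight; mfun.
have mim : measurable_fun setT
    (fun z : vec => ((r < 1) || (dotv (axisv n.+1 r) z < 0))%R%:R : R).
  by case: (r < 1) => /=; mfun.
rewrite integral_lebesgue_vecS; last 2 first.
- by mfun.
- by move=> y; rewrite mule_ge0// lee_fin weight_ge0.
rewrite integral_lebesgue_vecS; last 2 first.
- by mfun.
- by move=> y; rewrite mule_ge0// lee_fin.
rewrite (fubini_swap (m1 := lambda) (m2 := leb n.+1) (fun a s =>
  ((weight (axisv n.+1 r) (consv (a, s)))%:E *
   g (addv (consv (a, s)) (scalev (- normv (consv (a, s))) (axisv n.+1 r))))%E)); last 2 first.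
- by mfun.
- by move=> y s; rewrite mule_ge0// lee_fin weight_ge0.
rewrite [RHS](fubini_swap (m1 := lambda) (m2 := leb n.+1) (fun a s =>
  ((((r < 1) || (dotv (axisv n.+1 r) (consv (a, s)) < 0))%R%:R)%:E * g (consv (a, s)))%E)); last 2 first.
- by mfun.
- by move=> y s; rewrite mule_ge0// lee_fin.
rewrite -integral_neq0; last 2 first.
- apply: (measurable_integral_r lambda (fun s a => ((weight (axisv n.+1 r) (consv (a, s)))%:E *
   g (addv (consv (a, s)) (scalev (- normv (consv (a, s))) (axisv n.+1 r))))%E)).
    by mfun.
  by move=> y s; rewrite mule_ge0// lee_fin weight_ge0.
- by move=> s; apply: integral_ge0 => a _; rewrite mule_ge0// lee_fin weight_ge0.
rewrite -[RHS]integral_neq0; last 2 first.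
- apply: (measurable_integral_r lambda (fun s a =>
    ((((r < 1) || (dotv (axisv n.+1 r) (consv (a, s)) < 0))%R%:R)%:E * g (consv (a, s)))%E)).
    by mfun.
  by move=> y s; rewrite mule_ge0// lee_fin.
- by move=> s; apply: integral_ge0 => a _; rewrite mule_ge0// lee_fin.
apply: eq_integral => s _; have [s0|] := ltP 0 (normv s); last by rewrite !mul0e.
apply: mule_eqr.
have H := shear_1d r0 r1 s0 (g := fun a => g (consv (a, s))).
transitivity (\int[lambda]_y ((1 - r * y / Num.sqrt (y ^+ 2 + normv s ^+ 2))%:E *
      g (consv ((y - r * Num.sqrt (y ^+ 2 + normv s ^+ 2))%R, s))))%E.
  apply: eq_integral => y _.
  have ny : normv (consv (y, s)) = Num.sqrt (y ^+ 2 + normv s ^+ 2).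
    by rewrite normvE dotv_consv sqr_normv -expr2.
  rewrite /weight dotv_consv dot0v addr0 ny; congr (_ * g _)%E.
  by rewrite addv_scale_axis mulNr mulrC.
rewrite H//; last by mfun.
apply: eq_integral => y _; rewrite dotv_consv dot0v addr0.
have [//|r1'] := ltP r 1; have -> : r = 1 by apply/eqP; rewrite eq_le r1.
by rewrite mul1r.
Qed.

(** The involution carrying x to the first axis preserves dot products and integrals, which reduces
    the claim to [shear_axis]. The sphere averages use |x| < 1, the flight with one change |x| =
    1. *)
Lemma shear_change_of_variable (x : vec) (g : vec -> \bar R) : normv x <= 1 ->
  measurable_fun setT g -> (forall x, (0 <= g x)%E) ->
  (\int[leb n.+2]_y ((1 - dotv x y / normv y)%:E *
      g (addv y (scalev (- normv y) x))) =
   \int[leb n.+2]_z ((((normv x < 1) || (dotv x z < 0))%R%:R)%:E * g z))%E.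
Proof.
move=> x1 mg g0.
have [H [mH Hx dotH [HD HZ] [HK intH]]] := rotate_to_axis x.
have normH y : normv (H y) = normv y by rewrite !normvE dotH.
have mim : measurable_fun setT
    (fun z : vec => ((normv x < 1) || (dotv x z < 0))%R%:R : R).
  by case: (normv x < 1) => /=; mfun.
rewrite -[LHS]intH; last 2 first.
- by mfun.
- by move=> y; rewrite mule_ge0// lee_fin weight_ge0.
rewrite -[RHS]intH; last 2 first.
- by mfun.
- by move=> y; rewrite mule_ge0// lee_fin.
have xH y : dotv x (H y) = dotv (axisv n.+1 (normv x)) y by rewrite -Hx -(HK y) dotH HK.
have A := @shear_axis (normv x) (fun y => g (H y)).
transitivity (\int[leb n.+2]_y ((weight (axisv n.+1 (normv x)) y)%:E *
      g (H (addv y (scalev (- normv y) (axisv n.+1 (normv x)))))))%E.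
  apply: eq_integral => y _; rewrite /weight xH normH.
  by rewrite HD HZ -Hx HK.
rewrite A//; last 2 first.
- by rewrite normv_ge0.
- by mfun.
by apply: eq_integral => y _; rewrite xH.
Qed.

End shear.

(** * Averages over the sphere *)

Section homogeneous_average.
Context {R : realType} {n : nat}.
Notation lambda := (@lebesgue_measure R).
Notation leb := (@lebesgue_vec R).
Notation vec := (n.+1.-tuple R).
Notation sigma := (@uniform_sphere R n).

Lemma integral_power_initial (k : nat) (N : R) : 0 < N ->
  (\int[lambda]_s (((0 < s)%R%:R * s ^+ k * (s * N < 1)%R%:R)%:E) =
   ((k.+1%:R * N ^+ k.+1)^-1)%:E)%E.
Proof.
move=> N0.
transitivity (\int[lambda]_(s in `[0%R, N^-1%R]) (s ^+ k)%:E)%E.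
  rewrite -integral_itv_obnd_cbnd; last by apply: measurable_funTS; mfun.
  rewrite -integral_itv_bndo_bndc; last by apply: measurable_funTS; mfun.
  rewrite [RHS]integral_indicl; apply: eq_integral => s _.
  rewrite -EFinM indicE mem_setE in_itv/= mulrAC -natrM mulnb.
  by rewrite -[X in (s < X)%R]mul1r ltr_pdivlMr.
have dF (x : R) : is_derive x 1 ((k.+1%:R)^-1 \*: (@id R ^+ k.+1)) (x ^+ k).
  apply: is_derive_eq; rewrite /GRing.scale/= mulr1 mulrA mulVf ?mul1r//.
have cF (x : R) : {for x, continuous ((k.+1%:R)^-1 \*: (@id R ^+ k.+1))}.
  by apply: differentiable_continuous; apply/derivable1_diffP; case: (dF x).
have FE y : ((k.+1%:R)^-1 \*: (@id R ^+ k.+1)) y = (k.+1%:R)^-1 * y ^+ k.+1.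
  by rewrite !fctE.
rewrite (@continuous_FTC2 _ (fun s => s ^+ k) ((k.+1%:R)^-1 \*: (@id R ^+ k.+1)))//.
- by rewrite -EFinB !FE expr0n mulr0 subr0 invfM exprVn.
- by rewrite invr_gt0.
- by apply: continuous_subspaceT => x; exact: exprn_continuous.
- split.
  + by move=> x _; case: (dF x).
  + by apply: cvg_at_right_filter; exact: cF.
  + by apply: cvg_at_left_filter; exact: cF.
- by move=> x _; rewrite derive1E; case: (dF x).
Qed.

(** In polar coordinates [N] is linear along rays, so N < 1 cuts the ray of v at s = 1/N v, and
    s^(n-m) = s^k integrates to 1/((k+1) N(v)^(k+1)). Spherical means of negative powers thus become
    Lebesgue integrals, on which the shear can act. *)
Lemma homogeneous_average (N : vec -> R) (m k : nat) : (m + k = n)%N ->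
  measurable_fun setT N -> (forall s v, 0 < s -> N (scalev s v) = s * N v) ->
  (forall v, 0 <= N v) -> (forall v, normv v = 1 -> 0 < N v) ->
  (\int[leb n.+1]_y (((N y < 1)%R%:R * (normv y ^+ m)^-1)%:E) =
   (n.+1%:R * @ball_volume R n / k.+1%:R)%:E *
     \int[sigma]_v ((N v ^+ k.+1)^-1)%:E)%E.
Proof.
move=> mkn mN NZ Nge0 N0.
rewrite polar_coordinates; last 2 first.
- by mfun.
- pos.
rewrite [in RHS]EFinM -muleA; apply: mule_eqr.
have kap0 (s : R) : 0 <= (0 < s)%R%:R * s ^+ n.
  by case: ltP => [s0|_]; rewrite ?mul0r// mul1r exprn_ge0// ltW.
transitivity (\int[lambda]_s \int[sigma]_v
    (((0 < s)%R%:R * s ^+ n)%:E * ((N (scalev s v) < 1)%R%:R * (normv (scalev s v) ^+ m)^-1)%:E))%E.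
  apply: eq_integral => s _; rewrite ge0_integralZl; sides => //.
rewrite (fubini_swap (m1 := lambda) (m2 := sigma) (fun s v =>
  (((0 < s)%R%:R * s ^+ n)%:E * ((N (scalev s v) < 1)%R%:R * (normv (scalev s v) ^+ m)^-1)%:E))%E); last 2 first.
- by mfun.
- by move=> s v; rewrite mule_ge0// lee_fin// mulr_ge0// invr_ge0 exprn_ge0// normv_ge0.
rewrite -ge0_integralZl; sides => //.
apply: ae_uniform_sphere.
- apply: (measurable_integral_r lambda (fun v s =>
    (((0 < s)%R%:R * s ^+ n)%:E * ((N (scalev s v) < 1)%R%:R * (normv (scalev s v) ^+ m)^-1)%:E))%E).
    by mfun.
  by move=> s v; rewrite mule_ge0// lee_fin// mulr_ge0// invr_ge0 exprn_ge0// normv_ge0.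
- move=> v; apply: integral_ge0 => s _.
  by rewrite mule_ge0// lee_fin// mulr_ge0// invr_ge0 exprn_ge0// normv_ge0.
- by mfun.
- pos.
move=> v v1; have Nv := N0 _ v1.
transitivity (\int[lambda]_s (((0 < s)%R%:R * s ^+ k * (s * N v < 1)%R%:R)%:E))%E.
  apply: eq_integral => s _; rewrite -EFinM; congr EFin.
  have [s0|_] := ltP 0 s; last by rewrite !mul0r.
  rewrite NZ// normv_scale v1 mulr1 gtr0_norm// !mul1r -mkn exprD.
  by field; rewrite expf_neq0// gt_eqF.
by rewrite integral_power_initial// -EFinM invfM.
Qed.

Lemma integral_ball_power (m k : nat) : (m + k = n)%N ->
  (\int[leb n.+1]_y (((normv y < 1)%R%:R * (normv y ^+ m)^-1)%:E) =
   (n.+1%:R * @ball_volume R n / k.+1%:R)%:E)%E.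
Proof.
move=> mkn; rewrite (homogeneous_average mkn)//; last 4 first.
- mfun.
- by move=> s v s0; rewrite normv_scale gtr0_norm.
- pos.
- by move=> v ->.
rewrite (@ae_uniform_sphere _ _ _ (fun=> 1%E)); sides; last first.
- by move=> v v1; rewrite v1 expr1n invr1.
have -> : (\int[sigma]__ 1 = 1)%E.
  by rewrite integral_cst//= mul1e; exact: uniform_sphere_setT.
by rewrite mule1.
Qed.

(** The odd part of the integrand cancels under z |-> -z. *)
Lemma symmetrization (E o : vec -> R) :
  measurable_fun setT E -> (forall z, 0 <= E z) ->
  measurable_fun setT o -> (forall z, `|o z| <= 1) ->
  (forall z, E (scalev (-1) z) = E z) -> (forall z, o (scalev (-1) z) = - o z) ->
  (\int[leb n.+1]_z ((1 + o z) * E z)%:E = \int[leb n.+1]_z (E z)%:E)%E.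
Proof.
move=> mE E0 mo o1 Eeven oodd.
have o1' z : 0 <= 1 + o z by have := o1 z; rewrite ler_norml => /andP[]; lra.
have o1'' z : 0 <= 1 - o z by have := o1 z; rewrite ler_norml => /andP[]; lra.
(* Both sides are doubled, then halved at the end: values may be infinite, so the odd part cannot be
   subtracted. *)
have H : (\int[leb n.+1]_z ((1 + o z) * E z)%:E + \int[leb n.+1]_z ((1 + o z) * E z)%:E =
          \int[leb n.+1]_z (E z)%:E + \int[leb n.+1]_z (E z)%:E)%E.
  rewrite -[X in (_ + X)%E = _]lebesgue_vec_opp; last 2 first.
  - by mfun.
  - by move=> z; rewrite lee_fin mulr_ge0.
  have p1 z : 0 <= (1 + o z) * E z by rewrite mulr_ge0.
  have p2 z : 0 <= (1 + o (scalev (-1) z)) * E (scalev (-1) z).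
    by rewrite oodd mulr_ge0.
  rewrite -!ge0_integralD; sides => //.
  by apply: eq_integral => z _; rewrite -!EFinD Eeven oodd; congr EFin; ring.
have half (u : \bar R) : (u = (2^-1 : R)%:E * (u + u))%E.
  rewrite -[(u + u)%E]mule2n -mule_natl muleA -EFinM mulVf ?mul1e//.
by rewrite [LHS]half H -half.
Qed.

End homogeneous_average.

Section sphere_averages.
Context {R : realType} {n : nat}.
Notation lambda := (@lebesgue_measure R).
Notation leb := (@lebesgue_vec R).
Notation vec := (n.+2.-tuple R).
Notation sigma := (@uniform_sphere R n.+1).
Notation vol := (@ball_volume R n.+1).
Variable x : vec.
Hypothesis x1 : normv x < 1.

Let P := 1 - normv x ^+ 2.

(** At a unit vector v this is v - x, hence its norm there is the distance from v to x. *)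
Let shear (y : vec) : vec := addv y (scalev (- normv y) x).

(** A preimage of z under [shear] has a norm rho solving |z + rho x| = rho, a quadratic equation
    with leading coefficient [P]. [S] is the root of its reduced discriminant, and [radius] below is
    the nonnegative solution. *)
Let S (z : vec) := Num.sqrt (dotv x z ^+ 2 + P * normv z ^+ 2).

Let P0 : 0 < P.
Proof. by rewrite subr_gt0 expr_lt1// normv_ge0. Qed.

Let mS : measurable_fun setT S.
Proof. by rewrite /S; mfun. Qed.

Let mshear : measurable_fun setT shear.
Proof. by rewrite /shear; mfun. Qed.

Let dot_lt (y : vec) : 0 < normv y -> dotv x y < normv y.
Proof.
move=> y0; apply: le_lt_trans (cauchy_schwarz _ _) _.
by rewrite -[ltRHS]mul1r ltr_pM2r.
Qed.

Let S_shear y : S (shear y) = normv y - dotv x y.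
Proof.
have H : dotv x (shear y) ^+ 2 + P * normv (shear y) ^+ 2 = (normv y - dotv x y) ^+ 2.
  rewrite sqr_normv /shear !(dotvDl, dotvDr, dotvZl, dotvZr) -!sqr_normv /P (dotvC y x).
  by ring.
rewrite /S H sqrtr_sqr ger0_norm// subr_ge0.
have := normv_ge0 y; rewrite le_eqVlt => /predU1P[y0|/dot_lt/ltW//].
by apply: le_trans (cauchy_schwarz _ _) _; rewrite -y0 mulr0.
Qed.

Let S_gt0 z : 0 < normv z -> 0 < S z.
Proof.
move=> z0; rewrite sqrtr_gt0 ltr_wpDl ?sqr_ge0// mulr_gt0//.
by rewrite exprn_gt0.
Qed.

Let dot_shear y : dotv x (shear y) = dotv x y - normv y * normv x ^+ 2.
Proof. by rewrite dotvDr dotvZr sqr_normv mulNr. Qed.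

Let radius (z : vec) := (dotv x z + S z) / P.

Let radius_shear y : radius (shear y) = normv y.
Proof.
rewrite /radius S_shear dot_shear /P; field.
by rewrite gt_eqF.
Qed.

Let abs_dot_le z : `|dotv x z| <= S z.
Proof.
rewrite -sqrtr_sqr ler_wsqrtr// lerDl mulr_ge0 ?sqr_ge0// ltW//.
Qed.

Let abs_dot_lt z : 0 < normv z -> `|dotv x z| < S z.
Proof.
move=> z0; rewrite -[ltLHS]sqrtr_sqr ltr_sqrt; last by rewrite -sqrtr_gt0 S_gt0.
by rewrite ltrDl mulr_gt0// exprn_gt0.
Qed.

Let one_plus_ge0 z : 0 <= 1 + dotv x z / S z.
Proof.
have [->|Sz] := eqVneq (S z) 0; first by rewrite invr0 mulr0 addr0.
have {}Sz : 0 < S z by rewrite lt_neqAle eq_sym Sz sqrtr_ge0.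
rewrite -(divff (lt0r_neq0 Sz)) -mulrDl divr_ge0// ?(ltW Sz)//.
by have := abs_dot_le z; rewrite ler_norml => /andP[]; lra.
Qed.

Let one_minus_ge0 z : 0 <= 1 + - dotv x z / S z.
Proof.
have [->|Sz] := eqVneq (S z) 0; first by rewrite invr0 mulr0 addr0.
have {}Sz : 0 < S z by rewrite lt_neqAle eq_sym Sz sqrtr_ge0.
rewrite -(divff (lt0r_neq0 Sz)) -mulrDl divr_ge0// ?(ltW Sz)//.
by have := abs_dot_le z; rewrite ler_norml => /andP[]; lra.
Qed.

Let radius_ge0 z : 0 <= radius z.
Proof.
rewrite divr_ge0 ?(ltW P0)//.
have := abs_dot_le z; rewrite ler_norml => /andP[]; lra.
Qed.

Let mradius : measurable_fun setT radius.
Proof. by rewrite /radius; mfun. Qed.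

Let S_ge0 z : 0 <= S z.
Proof. exact: sqrtr_ge0. Qed.

(** At z = shear y the Jacobian 1 - <x,y>/|y| equals S z / radius z, whose inverse is the weight on
    the right. As |x| < 1, no part of the space is missed. *)
Lemma shear_inverse (G : vec -> \bar R) :
  measurable_fun setT G -> (forall z, (0 <= G z)%E) ->
  (\int[leb n.+2]_y G (shear y) = \int[leb n.+2]_z ((radius z / S z)%:E * G z))%E.
Proof.
move=> mG G0.
rewrite -[LHS]integral_neq0//; last by mfun.
have H := @shear_change_of_variable _ _ x (fun z => (radius z / S z)%:E * G z)%E (ltW x1).
rewrite -[LHS]integral_neq0 in H; last 2 first.
- by mfun.
- move=> y; rewrite mule_ge0//; last by rewrite mule_ge0// lee_fin divr_ge0.
  rewrite lee_fin subr_ge0.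
  have [y0|y0] := eqVneq (normv y) 0; first by rewrite y0 invr0 mulr0.
  have {}y0 : 0 < normv y by rewrite lt_neqAle eq_sym y0 normv_ge0.
  by rewrite ler_pdivrMr// mul1r ltW// dot_lt.
transitivity (\int[leb n.+2]_z
    ((((normv x < 1) || (dotv x z < 0))%R%:R)%:E * ((radius z / S z)%:E * G z)))%E; last first.
  by apply: eq_integral => z _; rewrite x1 mul1e.
rewrite -H; last 2 first.
- by mfun.
- by move=> z; rewrite mule_ge0// lee_fin divr_ge0.
apply: eq_integral => y _; have [y0|] := ltP 0 (normv y); last by rewrite !mul0e.
apply: mule_eqr; rewrite -/(shear y) muleA -EFinM.
rewrite radius_shear S_shear (_ : (_ * _)%R = 1%R) ?mul1e//.
have := dot_lt y0; rewrite -subr_gt0 => xy.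
by field; rewrite !gt_eqF.
Qed.

Let N_shear (v : vec) : normv v = 1 -> 0 < normv (shear v).
Proof.
move=> v1; rewrite lt_neqAle normv_ge0 andbT eq_sym; apply/negP => /eqP H.
have := S_shear v; rewrite /S H.
have -> : dotv x (shear v) = 0.
  by move/eqP: H; rewrite normv_eq0 => /eqP ->; rewrite dotvC dot0v.
rewrite !expr0n/= mulr0 addr0 sqrtr0 => /esym/eqP; rewrite subr_eq0 => /eqP vx.
by have := @dot_lt v; rewrite v1 -vx v1 ltxx => /(_ ltr01).
Qed.

Let shearZ s v : 0 < s -> shear (scalev s v) = scalev s (shear v).
Proof.
move=> s0; rewrite /shear normv_scale gtr0_norm// scalevDr !scalevA.
by congr (addv _ (scalev _ _)); ring.
Qed.

Let SN z : S (scalev (-1) z) = S z.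
Proof. by rewrite /S dotvZr normv_scale normrN1 mul1r mulN1r sqrrN. Qed.

Let coef0 (k : nat) : (n.+2%:R * vol / k.+1%:R)%:E \is a fin_num /\
   (n.+2%:R * vol / k.+1%:R)%R != 0.
Proof.
split => //; rewrite gt_eqF// divr_gt0// mulr_gt0//.
exact: ball_volume_gt0.
Qed.

Let cancel_coef (k : nat) (u : \bar R) (v : R) :
  ((n.+2%:R * vol / k.+1%:R)%:E * u = (v * (n.+2%:R * vol / k.+1%:R))%:E)%E ->
  u = v%:E.
Proof.
have [_ c0] := coef0 k; move/(congr1 (fun w => ((n.+2%:R * vol / k.+1%:R)^-1)%:E * w)%E).
by rewrite muleA -EFinM mulVf// mul1e => ->; rewrite -EFinM mulrCA mulVf// mulr1.
Qed.

(** Normalization of the Poisson kernel. The mean becomes the volume of the set where |shear y| < 1;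
    undoing the shear gives the weight (1 + <x,z>/S)/P on the unit ball, whose odd part integrates
    to 0. *)
Lemma average_poisson :
  (\int[sigma]_v ((normv (addv v (scalev (-1) x)) ^+ n.+2)^-1)%:E = (P^-1)%:E)%E.
Proof.
transitivity (\int[sigma]_v ((normv (shear v) ^+ n.+2)^-1)%:E)%E.
  apply: ae_uniform_sphere.
  - by mfun.
  - pos.
  - by mfun.
  - pos.
  by move=> v v1; rewrite /shear v1.
apply: (cancel_coef (k := n.+1)).
rewrite -(homogeneous_average (m := 0) (N := fun y => normv (shear y)))//; last 3 first.
- by mfun.
- by move=> s v s0; rewrite shearZ// normv_scale gtr0_norm.
- pos.
under eq_integral do rewrite expr0 invr1 mulr1.
rewrite (shear_inverse (G := fun z => ((normv z < 1)%R%:R)%:E)); last 2 first.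
- by mfun.
- pos.
transitivity (\int[leb n.+2]_z ((1 + dotv x z / S z) * (P^-1 * (normv z < 1)%R%:R))%:E)%E.
  rewrite -[LHS]integral_neq0; last 2 first.
  - by mfun.
  - by move=> z; rewrite mule_ge0// lee_fin divr_ge0.
  rewrite -[RHS]integral_neq0; last 2 first.
  - by mfun.
  - by move=> z; rewrite lee_fin !mulr_ge0// invr_ge0 ltW.
  apply: eq_integral => z _; have [z0|] := ltP 0 (normv z); last by rewrite !mul0e.
  apply: mule_eqr; rewrite -EFinM; congr EFin; rewrite /radius.
  by have := S_gt0 z0 => Sz; field; rewrite !gt_eqF.
rewrite (symmetrization (E := fun z => P^-1 * (normv z < 1)%R%:R) (o := fun z => dotv x z / S z)); last 6 first.
- by mfun.
- by move=> z; rewrite mulr_ge0// invr_ge0 ltW.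
- by mfun.
- move=> z; rewrite normrM normfV (ger0_norm (S_ge0 z)).
  have [->|Sz] := eqVneq (S z) 0; first by rewrite invr0 mulr0.
  by rewrite ler_pdivrMr ?mul1r// lt_neqAle eq_sym Sz S_ge0.
- by move=> z; rewrite normv_scale normrN1 mul1r.
- by move=> z; rewrite SN dotvZr mulN1r mulNr.
under eq_integral do rewrite EFinM.
rewrite ge0_integralZl; sides => //.
have -> : (\int[leb n.+2]_z ((normv z < 1)%R%:R)%:E =
    (n.+2%:R * vol / n.+2%:R)%:E)%E.
  rewrite -(@integral_ball_power R n.+1 0 n.+1 erefl).
  by apply: eq_integral => z _; rewrite expr0 invr1 mulr1.
by rewrite -EFinM.
Qed.

(** Newton's theorem inside a sphere. Here the weight |y|^(-2) is inserted, and since P |z|^2 = (S -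
    <x,z>)(S + <x,z>), undoing the shear turns it into (1 - <x,z>/S)/|z|^2, again 1 plus an odd term
    times an even function. *)
Lemma average_newton (k : nat) : n = k.+1 ->
  (\int[sigma]_v ((normv (addv v (scalev (-1) x)) ^+ n)^-1)%:E = 1%:E)%E.
Proof.
move=> nk.
transitivity (\int[sigma]_v ((normv (shear v) ^+ k.+1)^-1)%:E)%E.
  rewrite -nk; apply: ae_uniform_sphere.
  - by mfun.
  - pos.
  - by mfun.
  - pos.
  by move=> v v1; rewrite /shear v1.
have kn : (2 + k = n.+1)%N by rewrite nk.
apply: (cancel_coef (k := k)); rewrite mul1r -[RHS](integral_ball_power kn).
rewrite -[LHS](homogeneous_average kn (N := fun y => normv (shear y)))//; last 3 first.
- by mfun.
- by move=> s v s0; rewrite shearZ// normv_scale gtr0_norm.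
- pos.
transitivity (\int[leb n.+2]_y (((normv (shear y) < 1)%R%:R * (radius (shear y) ^+ 2)^-1)%:E))%E.
  by apply: eq_integral => y _; rewrite radius_shear.
rewrite (shear_inverse (G := fun z => (((normv z < 1)%R%:R * (radius z ^+ 2)^-1)%:E)%E)); last 2 first.
- by mfun.
- pos.
transitivity (\int[leb n.+2]_z ((1 + - dotv x z / S z) * ((normv z < 1)%R%:R * (normv z ^+ 2)^-1))%:E)%E.
  rewrite -[LHS]integral_neq0; last 2 first.
  - by mfun.
  - pos.
  rewrite -[RHS]integral_neq0; last 2 first.
  - by mfun.
  - by move=> z; rewrite lee_fin mulr_ge0// mulr_ge0// invr_ge0 exprn_ge0// normv_ge0.
  apply: eq_integral => z _; have [z0|] := ltP 0 (normv z); last by rewrite !mul0e.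
  apply: mule_eqr; rewrite -EFinM; congr EFin.
  have Sz := S_gt0 z0.
  have SS : S z ^+ 2 = dotv x z ^+ 2 + P * normv z ^+ 2.
    by rewrite sqr_sqrtr// addr_ge0 ?sqr_ge0// mulr_ge0 ?sqr_ge0// ltW.
  have := abs_dot_lt z0; rewrite ltr_norml => /andP[SD1 SD2].
  have zE : normv z ^+ 2 = (S z - dotv x z) * (S z + dotv x z) / P.
    rewrite -subr_sqr SS addrAC subrr add0r mulrAC divff ?mul1r// gt_eqF//.
  have D1 : 0 < S z - dotv x z by lra.
  have D2 : 0 < dotv x z + S z by lra.
  rewrite zE /radius [S z + _]addrC; field.
  by rewrite [S z + _]addrC [- _ + S z]addrC !gt_eqF.
rewrite (symmetrization (E := fun z => (normv z < 1)%R%:R * (normv z ^+ 2)^-1) (o := fun z => - dotv x z / S z))//.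
- by mfun.
- pos.
- by mfun.
- move=> z; rewrite normrM normrN normfV (ger0_norm (S_ge0 z)).
  have [->|Sz] := eqVneq (S z) 0; first by rewrite invr0 mulr0.
  by rewrite ler_pdivrMr ?mul1r// lt_neqAle eq_sym Sz S_ge0.
- by move=> z; rewrite normv_scale normrN1 mul1r.
- by move=> z; rewrite SN dotvZr mulN1r !mulNr.
Qed.

(** Once x lies on the first axis, [S] is the Euclidean norm after this linear contraction of
    determinant P^((n+1)/2). *)
Let shrink (w : vec) : vec :=
  [tuple (if i == ord0 then tnth w i else Num.sqrt P * tnth w i) | i < n.+2].

Let integral_shrink (g : vec -> \bar R) :
  measurable_fun setT g -> (forall z, (0 <= g z)%E) ->
  (\int[leb n.+2]_z g (shrink z) =
   ((Num.sqrt P ^+ n.+1)^-1)%:E * \int[leb n.+2]_z g z)%E.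
Proof.
move=> mg g0; have sP : 0 < Num.sqrt P by rewrite sqrtr_gt0.
rewrite (@lebesgue_vec_map _ _ (fun i u => if i == ord0 then u else Num.sqrt P * u)
  (fun i => if i == ord0 then 1 else (Num.sqrt P)^-1))//.
- by rewrite big_ord_recl /= mul1r prodr_const card_ord exprVn.
- by move=> i; case: (i == ord0); mfun.
- by move=> i; case: (i == ord0) => //; rewrite invr_ge0 ltW.
- move=> i h mh h0; case: (i == ord0); first by rewrite mul1e.
  by rewrite lebesgue_scale.
Qed.

Let normv_shrink z : normv (shrink z) =
  Num.sqrt (dotv (axisv n.+1 (normv x)) z ^+ 2 + P * normv z ^+ 2).
Proof.
rewrite normvE; congr Num.sqrt; rewrite sqr_normv -(consvK z).
rewrite !dotv_consv dot0v addr0 /dotv big_ord_recl !tnth_mktuple /consv !tnth0 /=.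
have -> : \sum_(i < n.+1) tnth (shrink (tnth z ord0 :: [tuple of behead z])) (lift ord0 i) *
    tnth (shrink (tnth z ord0 :: [tuple of behead z])) (lift ord0 i) =
    P * dotv [tuple of behead z] [tuple of behead z].
  rewrite /dotv mulr_sumr; apply: eq_bigr => i _.
  rewrite tnth_mktuple /= tnthS mulrACA -expr2 sqr_sqrtr//.
  exact: ltW.
rewrite -/(dotv [tuple of behead z] [tuple of behead z]) /P; ring.
Qed.

(** On the unit sphere S (shear v) = 1 - <x,v>. With the weight 1/|y| the factor [radius] cancels
    when the shear is undone, leaving 1/S over an ellipsoid, which [shrink] maps to the unit ball;
    its determinant is the value sought. *)
Lemma average_lorentz :
  (\int[sigma]_v ((`|1 - dotv x v| ^+ n.+1)^-1)%:E = ((Num.sqrt P ^+ n.+1)^-1)%:E)%E.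
Proof.
have kn : (1 + n = n.+1)%N by [].
transitivity (\int[sigma]_v ((S (shear v) ^+ n.+1)^-1)%:E)%E.
  apply: ae_uniform_sphere; sides.
  by move=> v v1; rewrite S_shear v1 gtr0_norm// subr_gt0 -v1 dot_lt// v1.
apply: (cancel_coef (k := n)).
rewrite -[LHS](homogeneous_average kn (N := fun y => S (shear y)))//; last 3 first.
- by mfun.
- by move=> s v s0; rewrite !S_shear dotvZr normv_scale gtr0_norm// mulrBr.
- by move=> v v1; rewrite S_shear subr_gt0 dot_lt// v1.
transitivity (\int[leb n.+2]_y (((S (shear y) < 1)%R%:R * (radius (shear y))^-1)%:E))%E.
  by apply: eq_integral => y _; rewrite radius_shear expr1.
rewrite (shear_inverse (G := fun z => (((S z < 1)%R%:R * (radius z)^-1)%:E)%E)); sides.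
transitivity (\int[leb n.+2]_z ((S z < 1)%R%:R * (S z)^-1)%:E)%E.
  rewrite -[LHS]integral_neq0; sides.
  rewrite -[RHS]integral_neq0; sides.
  apply: eq_integral => z _; have [z0|] := ltP 0 (normv z); last by rewrite !mul0e.
  apply: mule_eqr; rewrite -EFinM; congr EFin.
  have := abs_dot_lt z0; rewrite ltr_norml => /andP[SD1 SD2].
  have r0 : radius z != 0.
    by rewrite gt_eqF// divr_gt0// addrC -(opprK (dotv x z)) subr_gt0; lra.
  by have Sz := S_gt0 z0; field; rewrite r0 gt_eqF.
have [H [mH Hx dotH _ [HK intH]]] := rotate_to_axis x.
rewrite -[LHS]intH; sides.
transitivity (\int[leb n.+2]_z ((normv (shrink z) < 1)%R%:R * (normv (shrink z))^-1)%:E)%E.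
  apply: eq_integral => z _; rewrite normv_shrink -Hx.
  have E1 : dotv x (H z) = dotv (H x) z by rewrite -{1}(HK x) dotH.
  have E2 : normv (H z) = normv z by rewrite !normvE dotH.
  by rewrite /S E1 E2.
rewrite (integral_shrink (g := fun z => ((normv z < 1)%R%:R * (normv z)^-1)%:E)); sides.
by rewrite EFinM; apply: mule_eqr; rewrite -(integral_ball_power kn).
Qed.

End sphere_averages.

Section scaled_sphere_averages.
Context {R : realType} {n : nat}.
Notation vec := (n.+2.-tuple R).
Notation sigma := (@uniform_sphere R n.+1).
Variables (t : R) (x : vec).
Hypotheses (t0 : 0 < t) (xt : normv x < t).

Let x' : vec := scalev t^-1 x.

Let x'1 : normv x' < 1.
Proof. by rewrite normv_scale gtr0_norm ?invr_gt0// ltr_pdivrMl// mulr1. Qed.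

Let PE : t ^+ 2 - normv x ^+ 2 = t ^+ 2 * (1 - normv x' ^+ 2).
Proof.
rewrite normv_scale gtr0_norm ?invr_gt0//; field.
by rewrite gt_eqF.
Qed.

Let normE (v : vec) : normv (addv x (scalev (- t) v)) = t * normv (addv v (scalev (-1) x')).
Proof.
rewrite -[t in RHS]gtr0_norm// -normrN -normv_scale; congr normv.
apply: eq_from_tnth => i; rewrite !tnth_mktuple; field.
by rewrite gt_eqF.
Qed.

Lemma average_lorentz_scaled :
  (\int[sigma]_v ((`|t - dotv x v| ^+ n.+1)^-1)%:E =
   ((Num.sqrt (t ^+ 2 - normv x ^+ 2) ^+ n.+1)^-1)%:E)%E.
Proof.
transitivity (\int[sigma]_v (((t ^+ n.+1)^-1)%:E * ((`|1 - dotv x' v| ^+ n.+1)^-1)%:E))%E.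
  apply: eq_integral => v _; rewrite -EFinM -invfM -exprMn; congr ((_ ^+ _)^-1)%:E.
  rewrite -{2}(gtr0_norm t0) -normrM dotvZl; congr Num.norm.
  by field; rewrite gt_eqF.
rewrite ge0_integralZl; sides.
  rewrite average_lorentz// -EFinM -invfM -exprMn PE sqrtrM ?sqr_ge0// sqrtr_sqr.
  by rewrite gtr0_norm.
exact: measurableT.
Qed.

Lemma average_poisson_scaled :
  (\int[sigma]_v ((normv (addv x (scalev (- t) v)) ^+ n.+2)^-1)%:E =
   ((t ^+ n * (t ^+ 2 - normv x ^+ 2))^-1)%:E)%E.
Proof.
transitivity (\int[sigma]_v (((t ^+ n.+2)^-1)%:E *
    ((normv (addv v (scalev (-1) x')) ^+ n.+2)^-1)%:E))%E.
  apply: eq_integral => v _; rewrite -EFinM -invfM -exprMn.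
  by rewrite normE.
rewrite ge0_integralZl; sides.
- rewrite average_poisson// -EFinM -invfM PE; congr (_^-1)%:E.
  by rewrite mulrA -exprD addn2.
- exact: measurableT.
Qed.

Lemma average_newton_scaled : (0 < n)%N ->
  (\int[sigma]_v ((normv (addv x (scalev (- t) v)) ^+ n)^-1)%:E =
   ((t ^+ n)^-1)%:E)%E.
Proof.
move=> n0.
transitivity (\int[sigma]_v (((t ^+ n)^-1)%:E *
    ((normv (addv v (scalev (-1) x')) ^+ n)^-1)%:E))%E.
  apply: eq_integral => v _; rewrite -EFinM -invfM -exprMn.
  by rewrite normE.
rewrite ge0_integralZl; sides.
- rewrite (@average_newton _ _ _ x'1 n.-1) ?prednK//.
  by rewrite mule1.
- exact: measurableT.
Qed.

End scaled_sphere_averages.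

(** * Beta integrals *)

Lemma powR_exp_ln {R : realType} (x a : R) : 0 < x -> x `^ a = expR (a * ln x).
Proof. by move=> x0; rewrite /powR gt_eqF. Qed.

Lemma powR_predr {R : realType} (x a : R) : 0 < x -> x `^ a = x `^ (a - 1) * x.
Proof.
move=> x0; rewrite !powR_exp_ln// -{3}(lnK x0) -expRD.
by congr expR; ring.
Qed.

Section beta_integrals.
Context {R : realType}.
Notation lambda := (@lebesgue_measure R).
Variables (a b : R).

Definition beta_weight (u : R) : R :=
  ((0 < u) && (u < 1))%R%:R * (u `^ (a - 1) * (1 - u) `^ (b - 1)).

Lemma beta_weight_ge0 u : 0 <= beta_weight u.
Proof. rewrite /beta_weight; pos. Qed.

Lemma measurable_beta_weight : measurable_fun setT beta_weight.
Proof. by rewrite /beta_weight; mfun. Qed.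

(** Substitution s = (P/B) u; the hypothesis P/B <= t makes the constraint s < t automatic for u <
    1. *)
Lemma linear_beta_integral (P B t : R) : 0 < P -> 0 < B -> P / B <= t ->
  (\int[lambda]_s (((0 < s) && (s < t) && (s * B < P))%R%:R *
      (s `^ (a - 1) * (P - s * B) `^ (b - 1)))%:E =
   (P `^ (a + b - 1) * B `^ (- a))%:E * \int[lambda]_u (beta_weight u)%:E)%E.
Proof.
move=> P0 B0 Pt; have PB : 0 < P / B by rewrite divr_gt0.
pose g (s : R) : \bar R := (((0 < s) && (s < t) && (s * B < P))%R%:R *
      (s `^ (a - 1) * (P - s * B) `^ (b - 1)))%:E.
have mg : measurable_fun setT g by rewrite /g; mfun.
have g0 s : (0 <= g s)%E by rewrite /g; pos.
have E : (\int[lambda]_s g s = (P / B)%:E * \int[lambda]_s g (P / B * s)%R)%E.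
  by rewrite lebesgue_scale// muleA -EFinM mulfV ?gt_eqF// mul1e.
transitivity (\int[lambda]_s g s)%E; first by [].
rewrite {}E.
rewrite mule_integral; sides; last by rewrite /g; mfun.
have mb := measurable_beta_weight.
have b0 := beta_weight_ge0.
rewrite mule_integral_EFin; sides.
apply: eq_integral => u _; rewrite /g /beta_weight -!EFinM; congr EFin.
have E1 : P / B * u * B = P * u by field; rewrite gt_eqF.
rewrite E1 pmulr_rgt0// gtr_pMr//.
have [u0|] := boolP (0 < u); last by rewrite !mul0r !mulr0.
have [u1|] := boolP (u < 1); last by rewrite andbF !mul0r !mulr0.
have -> : P / B * u < t by apply: lt_le_trans Pt; rewrite gtr_pMr.
have -> : P - P * u = P * (1 - u) by ring.
rewrite /= !mul1r.
have u1' : 0 < 1 - u by rewrite subr_gt0.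
rewrite -{1}[P / B]powRr1; last exact: ltW.
rewrite !powR_exp_ln ?mulr_gt0 ?invr_gt0// !lnM ?lnV ?posrE ?mulr_gt0 ?invr_gt0//.
by rewrite -!expRD; congr expR; ring.
Qed.

Lemma mobius_beta_integral (P Q t : R) : 0 < P -> 0 < Q -> 0 < t ->
  (\int[lambda]_s (((0 < s) && (s < t) && (s * ((P + Q) / t) < P))%R%:R *
      (s `^ (a - 1) * (t - s) `^ (- (a + b) - 1) *
       (P - s * ((P + Q) / t)) `^ (b - 1)))%:E =
   (t `^ (- b - 1))%:E *
   ((P `^ (a + b - 1) * Q `^ (- a))%:E * \int[lambda]_u (beta_weight u)%:E +
    (P `^ (a + b) * Q `^ (- a - 1))%:E * \int[lambda]_u (u * beta_weight u)%:E))%E.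
Proof.
move=> P0 Q0 t0.
pose g (s : R) : \bar R := (((0 < s) && (s < t) && (s * ((P + Q) / t) < P))%R%:R *
      (s `^ (a - 1) * (t - s) `^ (- (a + b) - 1) *
       (P - s * ((P + Q) / t)) `^ (b - 1)))%:E.
have mg : measurable_fun setT g by rewrite /g; mfun.
have g0 s : (0 <= g s)%E by rewrite /g; pos.
have mb := measurable_beta_weight.
have b0 := beta_weight_ge0.
have ub0 (u : R) : 0 <= u * beta_weight u.
  rewrite /beta_weight; have [u0|] := ltP 0 u; last by rewrite /= !mul0r mulr0.
  by pos.
(* This homographic map sends [0, 1] onto [0, t P/(P+Q)], whose upper end is the zero of P - s
   (P+Q)/t, and makes s, t - s and that affine factor all monomials divided by Q + P u. *)
pose F (u : R) := t * P * u / (Q + P * u).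
pose f (u : R) := t * P * Q / ((Q + P * u) * (Q + P * u)).
have D0 (u : R) : 0 <= u -> 0 < Q + P * u.
  by move=> u0; rewrite ltr_wpDr// mulr_ge0// ltW.
have F0 : F 0 = 0 by rewrite /F mulr0 mul0r.
have F1 : F 1 = t * P / (P + Q) by rewrite /F !mulr1 addrC.
have PQ : 0 < P + Q by rewrite addr_gt0.
have dF (u : R) : 0 <= u <= 1 -> is_derive u 1 F (f u).
  move=> /andP[u0 _]; have Du := D0 _ u0.
  have Du' : Q + P * u != 0 by rewrite gt_eqF.
  have dD : is_derive u 1 (fun u : R => Q + P * u) P.
    have -> : (fun u : R => Q + P * u) = cst Q + P \*: (@id R).
      by apply/funext => v; rewrite !fctE.
    by apply: is_derive_eq; rewrite /= add0r scaler1.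
  have dV := is_deriveV (f := fun u : R => Q + P * u) Du' dD.
  have -> : F = ((t * P) \*: (@id R)) * (fun u : R => (Q + P * u)^-1).
    by apply/funext => v; rewrite /F !fctE.
  apply: is_derive_eq; rewrite /f /GRing.scale/=.
  by rewrite -[(t * P) *: u]/(t * P * u); field.
have cf (u : R) : 0 <= u <= 1 -> {for u, continuous f}.
  move=> /andP[u0 _]; rewrite /f; apply: cvgM; first exact: cvg_cst.
  apply: cvgV; first by rewrite mulf_neq0// gt_eqF// D0.
  by apply: cvgM; apply: cvgD; [exact: cvg_cst|apply: cvgM; [exact: cvg_cst|exact: cvg_id]
    |exact: cvg_cst|apply: cvgM; [exact: cvg_cst|exact: cvg_id]].
have f0 (u : R) : 0 <= u <= 1 -> 0 < f u.
  by move=> /andP[u0 _]; rewrite /f divr_gt0 ?mulr_gt0 ?D0//.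
transitivity (\int[lambda]_(s in `]F 0%R, F 1%R]) g s)%E.
  rewrite [RHS]integral_indicl; apply: eq_integral => s _.
  rewrite -/(g s) indicE mem_setE in_itv/= F0 F1.
  have [/andP[s0 s1]|H] := boolP (0 < s <= _); first by rewrite mul1e.
  rewrite mul0e /g; case: ltP H => //= s0; rewrite ?mul0r// -ltNge => H.
  rewrite (_ : (s * _ < P) = false) ?andbF ?mul0r//; apply/negbTE.
  rewrite -leNgt mulrA ler_pdivlMr//; move: H.
  by rewrite ltr_pdivrMr// => H; rewrite mulrC ltW.
rewrite -(@change_of_variable_C1 _ F f 0 1 g)//; last 2 first.
- by rewrite /F; mfun.
- by rewrite /f; mfun.
rewrite [LHS]integral_indicl.
rewrite !mule_integral_EFin; sides.
rewrite adde_integral_EFin; sides.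
rewrite mule_integral_EFin; sides.
apply: eq_integral => u _; rewrite indicE mem_setE in_itv/= /g /beta_weight.
rewrite -!EFinM; congr EFin.
have [u0|] /= := ltP 0 u; last by rewrite !mul0r !mulr0 addr0 mulr0.
have Du := D0 _ (ltW u0).
have E1 : P - F u * ((P + Q) / t) = P * Q * (1 - u) / (Q + P * u).
  by rewrite /F; field; rewrite !gt_eqF.
have E2 : t - F u = t * Q / (Q + P * u).
  by rewrite /F; field; rewrite !gt_eqF.
have [u1|u1] := ltP u 1; last first.
  rewrite (_ : F u * _ < P = false) ?andbF ?mul0r ?mulr0 ?addr0 ?mulr0//.
  rewrite -subr_gt0 E1; apply/negbTE; rewrite -leNgt.
  rewrite pmulr_lle0 ?invr_gt0//; apply: mulr_ge0_le0; last by rewrite subr_le0.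
  by rewrite mulr_ge0// ltW.
have u1' : 0 < 1 - u by rewrite subr_gt0.
rewrite (ltW u1) -[F u * _ < P]subr_gt0 E1 -[F u < t]subr_gt0 E2.
have Fu : 0 < F u by rewrite /F divr_gt0// !mulr_gt0.
have -> : 0 < P * Q * (1 - u) / (Q + P * u) by rewrite divr_gt0// !mulr_gt0.
have -> : 0 < t * Q / (Q + P * u) by rewrite divr_gt0// !mulr_gt0.
rewrite Fu /= !mul1r.
set D := Q + P * u in Du *.
(* The exponent -(a+b) - 1 of t - s is the one for which the powers of D = Q + P u collected from
   the factors and the derivative add up to 1. Expanding D then yields the two Beta integrals. *)
transitivity (t `^ (- b - 1) * (u `^ (a - 1) * (1 - u) `^ (b - 1)) *
   (P `^ (a + b - 1) * Q `^ (- a - 1)) * D `^ 1).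
  rewrite /f /F -/D.
  have -> : t * P * Q / (D * D) = (t * P * Q / (D * D)) `^ 1.
    by rewrite powRr1// ltW// divr_gt0 ?mulr_gt0.
  rewrite !powR_exp_ln ?(mulr_gt0, invr_gt0)//.
  rewrite !(lnM, lnV) ?posrE ?(mulr_gt0, invr_gt0)//.
  by rewrite -!expRD; congr expR; ring.
rewrite powRr1 ?(ltW Du)//.
rewrite (powR_predr (- a) Q0) (powR_predr (a + b) P0).
by rewrite /D; ring.
Qed.

End beta_integrals.

(** * Recursion over the legs of a flight *)

Section flight_functional.
Context {R : realType} {n : nat}.
Notation lambda := (@lebesgue_measure R).
Notation leb := (@lebesgue_vec R).
Notation vec := (n.+2.-tuple R).
Notation sigma := (@uniform_sphere R n.+1).
Variable a : R.

(* The law of a flight with N changes of direction, up to the Dirichlet constant: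
   the recursion peels off the first leg. *)
Fixpoint flight_functional (N : nat) (t : R) (g : vec -> \bar R) : \bar R :=
  match N with
  | 0 => ((t `^ (a - 1))%:E * \int[sigma]_v g (scalev t v))%E
  | N'.+1 => (\int[lambda]_s ((((0 < s) && (s < t))%R%:R * s `^ (a - 1))%:E *
      \int[sigma]_v flight_functional N' (t - s)%R (fun y => g (addv (scalev s v) y))))%E
  end.

(* The constant K may be infinite here; the total mass decides at the end. *)
Definition radial_law (N : nat) (e q : R) :=
  exists2 K : \bar R, (0 <= K)%E & forall t g, 0 < t ->
  measurable_fun setT g -> (forall x, (0 <= g x)%E) ->
  (flight_functional N t g = K * (t `^ e)%:E *
    \int[leb n.+2]_x (((normv x < t)%R%:R * (t ^+ 2 - normv x ^+ 2) `^ q)%:E * g x))%E.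

(** Contribution to the density at x of all flights whose first leg has direction v: the remaining
    time is t - s and the remaining displacement x - s v. *)
Definition step_kernel (e q t : R) (x v : vec) : \bar R :=
  (\int[lambda]_s (((0 < s) && (s < t) &&
      (normv (addv x (scalev (- s) v)) < t - s))%R%:R *
    (s `^ (a - 1) * (t - s) `^ e *
     ((t - s) ^+ 2 - normv (addv x (scalev (- s) v)) ^+ 2) `^ q))%:E)%E.

Lemma step_kernel_ge0 e q t x v : (0 <= step_kernel e q t x v)%E.
Proof. rewrite /step_kernel; pos. Qed.

Lemma measurable_step_kernel e q t :
  measurable_fun setT (fun z : vec * vec => step_kernel e q t z.1 z.2).
Proof.
apply: (measurable_integral_r lambda (fun (z : vec * vec) s => (((0 < s) && (s < t) &&
      (normv (addv z.1 (scalev (- s) z.2)) < t - s))%R%:R *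
    (s `^ (a - 1) * (t - s) `^ e *
     ((t - s) ^+ 2 - normv (addv z.1 (scalev (- s) z.2)) ^+ 2) `^ q))%:E)).
  by mfun.
by pos.
Qed.

Lemma normv_sub_sqr (x v : vec) (s : R) : normv v = 1 ->
  normv (addv x (scalev (- s) v)) ^+ 2 = normv x ^+ 2 - 2 * s * dotv x v + s ^+ 2.
Proof.
move=> v1; rewrite sqr_normv !(dotvDl, dotvDr, dotvZl, dotvZr) -!sqr_normv v1.
by rewrite (dotvC v x); ring.
Qed.

(** For 0 < s < t the support condition |x - s v| < t - s is the positivity of the same affine
    function of s that is raised to the power q. *)
Lemma step_kernel_unit e q t x v : 0 < t -> normv v = 1 ->
  step_kernel e q t x v = (\int[lambda]_s (((0 < s) && (s < t) &&
      (s * (2 * (t - dotv x v)) < t ^+ 2 - normv x ^+ 2))%R%:R *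
    (s `^ (a - 1) * (t - s) `^ e *
     (t ^+ 2 - normv x ^+ 2 - s * (2 * (t - dotv x v))) `^ q))%:E)%E.
Proof.
move=> t0 v1; apply: eq_integral => s _.
have E : (t - s) ^+ 2 - normv (addv x (scalev (- s) v)) ^+ 2 =
    t ^+ 2 - normv x ^+ 2 - s * (2 * (t - dotv x v)).
  by rewrite normv_sub_sqr//; ring.
rewrite E; have [s0|_] := ltP 0 s; last by [].
have [st|_] := ltP s t; last by [].
congr ((_ && _)%:R * _)%:E.
rewrite -[s * _ < _]subr_gt0 -E subr_gt0 ltr_sqr// nnegrE ?normv_ge0//.
by rewrite subr_ge0 ltW.
Qed.

(** Triangle inequality in squared form; it makes the kernel vanish when |x| >= t. *)
Lemma normv_lt_of_step (x v : vec) (s t : R) : normv v = 1 -> 0 < s ->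
  normv (addv x (scalev (- s) v)) < t - s -> normv x < t.
Proof.
move=> v1 s0.
have : x = addv (addv x (scalev (- s) v)) (scalev s v).
  by apply: eq_from_tnth => i; rewrite !tnth_mktuple; ring.
move: (addv x (scalev (- s) v)) => w -> H.
have t0 : 0 < t by have := normv_ge0 w; lra.
rewrite -ltr_sqr ?nnegrE ?normv_ge0 ?(ltW t0)//.
rewrite [ltLHS]sqr_normv !(dotvDl, dotvDr, dotvZl, dotvZr) -!sqr_normv v1 (dotvC v w).
have wv := cauchy_schwarz w v; rewrite v1 mulr1 in wv.
apply: (@le_lt_trans _ _ ((normv w + s) ^+ 2)).
  have : s * dotv w v <= s * normv w by rewrite ler_wpM2l// ltW.
  by move=> sw; rewrite sqrrD; lra.
have ws : normv w + s < t by lra.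
rewrite ltr_sqr// nnegrE ?(ltW t0)//.
by rewrite addr_ge0// ?normv_ge0// ltW.
Qed.

(** Integrating over the first leg, translating and exchanging integrals gathers all dependence on s
    and v in [step_kernel], so a closed form of its spherical mean is enough. *)
Lemma radial_law_step N e q e' q' (c : \bar R) : (0 <= c)%E ->
  (forall t x, 0 < t -> normv x < t ->
    (\int[sigma]_v step_kernel e q t x v =
     c * (t `^ e' * (t ^+ 2 - normv x ^+ 2) `^ q')%:E)%E) ->
  radial_law N e q -> radial_law N.+1 e' q'.
Proof.
move=> c0 cE [K K0 H]; exists (K * c)%E; first exact: mule_ge0.
move=> t g t0 mg g0 /=.
have mk := measurable_step_kernel e q t.
have k0 := step_kernel_ge0 e q t.
pose w (s : R) (v x : vec) : R :=
  ((0 < s) && (s < t) && (normv (addv x (scalev (- s) v)) < t - s))%R%:R *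
  (s `^ (a - 1) * (t - s) `^ e *
   ((t - s) ^+ 2 - normv (addv x (scalev (- s) v)) ^+ 2) `^ q).
have wE s v x : w s v x =
  ((0 < s) && (s < t) && (normv (addv x (scalev (- s) v)) < t - s))%R%:R *
  (s `^ (a - 1) * (t - s) `^ e *
   ((t - s) ^+ 2 - normv (addv x (scalev (- s) v)) ^+ 2) `^ q) by [].
have w0 s v x : 0 <= w s v x by rewrite /w; pos.
have mw d (U : measurableType d) (fs : U -> R) (fv fx : U -> vec) :
    measurable_fun setT fs -> measurable_fun setT fv -> measurable_fun setT fx ->
    measurable_fun setT (fun u => w (fs u) (fv u) (fx u)).
  by move=> mfs mfv mfx; rewrite /w; mfun.
clearbody w.
pose A s v x : \bar R := (K * ((w s v x)%:E * g x))%E.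
have A0 s v x : (0 <= A s v x)%E by rewrite /A mule_ge0// mule_ge0// lee_fin.
have mA d (U : measurableType d) (fs : U -> R) (fv fx : U -> vec) :
    measurable_fun setT fs -> measurable_fun setT fv -> measurable_fun setT fx ->
    measurable_fun setT (fun u => A (fs u) (fv u) (fx u)).
  move=> mfs mfv mfx; apply: emeasurable_funM; first exact: measurable_cst.
  apply: emeasurable_funM; last exact: measurableT_comp.
  by apply/measurable_EFinP; exact: mw.
transitivity (\int[lambda]_s \int[sigma]_v \int[leb n.+2]_x A s v x)%E.
  apply: eq_integral => s _.
  have [s0|s0] := ltP 0 s; last first.
    rewrite mul0r mul0e integral0_eq// => v _; rewrite integral0_eq// => x _.
    by rewrite /A wE (ltNge 0 s) s0 /= mul0r mul0e mule0.
  have [st|st] := ltP s t; last first.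
    rewrite mul0r mul0e integral0_eq// => v _; rewrite integral0_eq// => x _.
    by rewrite /A wE (ltNge s t) st andbF /= mul0r mul0e mule0.
  have ts : 0 < t - s by rewrite subr_gt0.
  pose I v x : \bar R := (((normv x < t - s)%R%:R * ((t - s) ^+ 2 - normv x ^+ 2) `^ q)%:E *
       g (addv (scalev s v) x))%E.
  have mI : measurable_fun setT (fun z : vec * vec => I z.1 z.2) by rewrite /I; mfun.
  have I0 v x : (0 <= I v x)%E by rewrite /I; pos.
  have mI' : measurable_fun setT (fun v => \int[leb n.+2]_x I v x)%E.
    exact: (measurable_integral_r (leb n.+2) I).
  transitivity ((s `^ (a - 1))%:E * \int[sigma]_v (K * ((t - s) `^ e)%:E * \int[leb n.+2]_x I v x))%E.
    rewrite mul1r; apply: mule_eqr; apply: eq_integral => v _.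
    by rewrite H//; mfun.
  rewrite mule_integral; sides.
  apply: eq_integral => v _.
  have mIv : measurable_fun setT (I v).
    by apply: (measurableT_comp mI (g := fun x => (v, x))); mfun.
  have IE x : I v x = (((normv x < t - s)%R%:R * ((t - s) ^+ 2 - normv x ^+ 2) `^ q)%:E *
       g (addv (scalev s v) x))%E by [].
  clearbody I.
  (* Translation by s v, from the displacement after the first leg to the endpoint of the whole
     flight. *)
  have <- : (\int[leb n.+2]_x A s v (addv (scalev s v) x) = \int[leb n.+2]_x A s v x)%E.
    apply: (lebesgue_vec_shift (scalev s v) (g := A s v)); last exact: A0.
    exact: (mA _ _ (fun=> s) (fun=> v) id).
  rewrite muleCA -!muleA -mule_integral; sides; last 2 first.
  - apply: emeasurable_funM; last by mfun.
    by apply/measurable_EFinP; apply: mw; mfun.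
  - by move=> x; rewrite mule_ge0// lee_fin.
  apply: mule_eqr; rewrite muleA -EFinM mule_integral; sides.
  have wshift x : w s v (addv (scalev s v) x) = (t - s) `^ e * s `^ (a - 1) *
     ((normv x < t - s)%R%:R * ((t - s) ^+ 2 - normv x ^+ 2) `^ q).
    rewrite wE s0 st /=; have -> : addv (addv (scalev s v) x) (scalev (- s) v) = x.
      by apply: eq_from_tnth => i; rewrite !tnth_mktuple; ring.
    ring.
  by apply: eq_integral => x _; rewrite wshift IE (EFinM (_ * _)) -muleA.
transitivity (\int[lambda]_s \int[leb n.+2]_x \int[sigma]_v A s v x)%E.
  apply: eq_integral => s _.
  rewrite (fubini_swap (m1 := sigma) (m2 := leb n.+2) (A s))//.
  by apply: mA; mfun.
rewrite (fubini_swap (m1 := lambda) (m2 := leb n.+2) (fun s x => \int[sigma]_v A s v x)%E); last 2 first.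
- apply: (measurable_integral_r sigma (fun (z : measurableTypeR R * vec) v => A z.1 v z.2)) => //; apply: mA; mfun.
- by move=> s x; exact: integral_ge0.
rewrite -muleA mule_integral; sides.
rewrite mule_integral; sides.
apply: eq_integral => x _.
rewrite (fubini_swap (m1 := lambda) (m2 := sigma) (fun s v => A s v x)); last 2 first.
- by apply: mA; mfun.
- by [].
transitivity (\int[sigma]_v (K * (step_kernel e q t x v * g x)))%E.
  apply: eq_integral => v _; rewrite /A /step_kernel -mule_integral; sides; last 2 first.
  - apply: emeasurable_funM; last exact: measurable_cst.
    by apply/measurable_EFinP; apply: mw; mfun.
  - by move=> s; rewrite mule_ge0// lee_fin.
  apply: mule_eqr; rewrite [RHS]muleC mule_integral; sides.
  by apply: eq_integral => s _; rewrite wE muleC.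
have mkx : measurable_fun setT (step_kernel e q t x).
  by apply: (measurableT_comp mk (g := fun v => (x, v))); mfun.
rewrite -mule_integral; sides.
rewrite -!muleA; apply: mule_eqr.
under eq_integral do rewrite muleC.
rewrite -mule_integral; sides.
(* The closed form [cE] is available only for |x| < t; elsewhere the kernel is 0 for every unit
   v. *)
have [xt|xt] := ltP (normv x) t; last first.
  rewrite mul0r mul0e !mule0 (_ : (\int[sigma]_v step_kernel e q t x v = 0)%E) ?mule0//.
  rewrite (ae_uniform_sphere (g2 := fun=> 0%E)) ?integral0//.
  move=> v v1; rewrite /step_kernel integral0_eq// => s _.
  have [s0|_] := ltP 0 s; last by rewrite mul0r.
  rewrite (_ : (normv _ < _) = false) ?andbF ?mul0r//.
  by apply/negP => /(normv_lt_of_step v1 s0); rewrite ltNge xt.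
rewrite cE// mul1r muleC -!muleA; apply: mule_eqr.
by rewrite EFinM -muleA.
Qed.

End flight_functional.

Lemma dotv_lt_sphere {R : realType} {n : nat} (t : R) (x v : n.-tuple R) :
  normv v = 1 -> normv x < t -> 0 < t - dotv x v.
Proof.
move=> v1 xt; rewrite subr_gt0; apply: le_lt_trans xt.
by apply: le_trans (cauchy_schwarz _ _) _; rewrite v1 mulr1.
Qed.

Lemma sphere_dist_gt0 {R : realType} {n : nat} (t : R) (x v : n.-tuple R) :
  0 < t -> normv v = 1 -> normv x < t -> 0 < normv (addv x (scalev (- t) v)).
Proof.
move=> t0 v1 xt; rewrite lt_neqAle normv_ge0 andbT eq_sym normv_eq0.
apply/negP => /eqP H; move: xt.
have -> : x = scalev t v.
  apply: eq_from_tnth => i; have := congr1 (fun z => tnth z i) H.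
  by rewrite !tnth_mktuple => /eqP; rewrite addr_eq0 mulNr opprK => /eqP.
by rewrite normv_scale v1 mulr1 gtr0_norm// ltxx.
Qed.

Lemma power_difference_gt0 {R : realType} {n : nat} (t : R) (x : n.-tuple R) :
  normv x < t -> 0 < t ^+ 2 - normv x ^+ 2.
Proof.
move=> xt; rewrite subr_gt0 ltr_sqr ?nnegrE ?normv_ge0//.
by rewrite ltW// (le_lt_trans (normv_ge0 x)).
Qed.

Section step_kernels.
Context {R : realType} {n : nat}.
Notation lambda := (@lebesgue_measure R).
Notation vec := (n.+2.-tuple R).
Notation sigma := (@uniform_sphere R n.+1).
Variable b : R.

Lemma beta_integral_ge0 (a : R) : (0 <= \int[lambda]_u (beta_weight a b u)%:E)%E.
Proof. by apply: integral_ge0 => u _; rewrite lee_fin beta_weight_ge0. Qed.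

Lemma beta_integral1_ge0 (a : R) : (0 <= \int[lambda]_u (u * beta_weight a b u)%:E)%E.
Proof.
apply: integral_ge0 => u _; rewrite lee_fin /beta_weight.
by have [u0|] := ltP 0 u; [pos|rewrite /= !mul0r mulr0].
Qed.

(** The Beta integral leaves L^(-a) with a = d - 1, whose spherical mean is P^(-a/2): each leg
    raises the exponent of P by a/2. *)
Lemma average_step_kernel1 (a := n.+1%:R) (t : R) (x : vec) :
  0 < t -> normv x < t ->
  (\int[sigma]_v step_kernel a 0 (b - 1) t x v =
   ((2 `^ (- a))%:E * \int[lambda]_u (beta_weight a b u)%:E) *
   (t `^ 0 * (t ^+ 2 - normv x ^+ 2) `^ (a / 2 + b - 1))%:E)%E.
Proof.
move=> t0 xt; have P0 := power_difference_gt0 xt.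
set P := t ^+ 2 - normv x ^+ 2 in P0 *.
set B := (\int[lambda]_u _)%E; have B0 : (0 <= B)%E by exact: beta_integral_ge0.
rewrite (ae_uniform_sphere (g2 := fun v =>
    (B * (P `^ (a + b - 1) * 2 `^ (- a))%:E * ((`|t - dotv x v| ^+ n.+1)^-1)%:E)%E)); last 5 first.
- by apply: (measurableT_comp (measurable_step_kernel a 0 (b - 1) t) (g := fun v => (x, v))); mfun.
- by move=> v; exact: step_kernel_ge0.
- by mfun.
- by pos.
- move=> v v1; have L0 := dotv_lt_sphere v1 xt.
  rewrite step_kernel_unit// -/P.
  transitivity ((P `^ (a + b - 1) * (2 * (t - dotv x v)) `^ (- a))%:E * B)%E.
    rewrite -(linear_beta_integral a b (t := t)) ?mulr_gt0//.
      apply: eq_integral => s _; congr (_ * _)%:E.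
      by rewrite powRr0 mulr1.
    (* P/(2 L) <= t amounts to |x - t v|^2 >= 0. *)
    rewrite ler_pdivrMr ?mulr_gt0//.
    have := normv_sub_sqr x t v1; have := sqr_ge0 (normv (addv x (scalev (- t) v))).
    by rewrite /P; lra.
  rewrite -muleA -EFinM muleC; apply: mule_eqr; congr EFin.
  rewrite gtr0_norm// -powR_mulrn ?(ltW L0)// -/a powRM ?(ltW L0)//.
  by rewrite -powRN mulrA.
rewrite -mule_integral; sides.
rewrite average_lorentz_scaled// -/P -muleA -EFinM muleC [in RHS]muleAC -EFinM.
congr ((_ : R)%:E * _)%E.
rewrite powRr0 mul1r -powR12_sqrt ?(ltW P0)// -powR_mulrn ?powR_ge0// -powRrM -/a -powRN.
rewrite mulrAC mulrC -powRD; last by rewrite (gt_eqF P0) implybT.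
by congr (_ * _ `^ _); field.
Qed.

(** With a = d/2 - 1 the two Beta terms carry |x - t v|^(-n) and |x - t v|^(-(n+2)), where d = n +
    2: a Newton and a Poisson kernel. The Newton average is the reason for 0 < n. *)
Lemma average_step_kernel2 (a := n%:R / 2) (t : R) (x : vec) :
  (0 < n)%N -> 0 < t -> normv x < t ->
  (\int[sigma]_v step_kernel a (- (a + b) - 1) (b - 1) t x v =
   (\int[lambda]_u (beta_weight a b u)%:E + \int[lambda]_u (u * beta_weight a b u)%:E) *
   (t `^ (- (a + (a + b)) - 1) * (t ^+ 2 - normv x ^+ 2) `^ (a + b - 1))%:E)%E.
Proof.
move=> n0 t0 xt; have P0 := power_difference_gt0 xt.
set P := t ^+ 2 - normv x ^+ 2 in P0 *.
have := beta_integral_ge0 a; have := beta_integral1_ge0 a.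
set B := (\int[lambda]_u (beta_weight a b u)%:E)%E; set B1 := (\int[lambda]_u _)%E => B10 B0.
pose Q v := normv (addv x (scalev (- t) v)).
have mQ : measurable_fun setT Q by rewrite /Q; mfun.
have Q_ge0 v : 0 <= Q v by exact: normv_ge0.
rewrite (ae_uniform_sphere (g2 := fun v =>
    (B * (t `^ (- b - 1) * P `^ (a + b - 1))%:E * ((Q v ^+ n)^-1)%:E +
     B1 * (t `^ (- b - 1) * P `^ (a + b))%:E * ((Q v ^+ n.+2)^-1)%:E)%E)); last 5 first.
- by apply: (measurableT_comp (measurable_step_kernel a (- (a + b) - 1) (b - 1) t) (g := fun v => (x, v))); mfun.
- by move=> v; exact: step_kernel_ge0.
- by mfun.
- by pos.
- move=> v v1; have L0 := dotv_lt_sphere v1 xt; have Q0 := sphere_dist_gt0 t0 v1 xt.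
  rewrite step_kernel_unit// -/P.
  have LPQ : 2 * (t - dotv x v) = (P + Q v ^+ 2) / t.
    by rewrite /P /Q normv_sub_sqr//; field; rewrite gt_eqF.
  rewrite LPQ mobius_beta_integral ?exprn_gt0// muleDr; last 2 first.
  - by [].
  - by apply: ge0_adde_def; rewrite inE mule_ge0// lee_fin mulr_ge0// powR_ge0.
  rewrite !muleA -!EFinM -/B -/B1.
  have EQ k : (Q v ^+ 2) `^ (- (k%:R / 2)) = (Q v ^+ k)^-1.
    rewrite -powR_mulrn// -powRrM -powR_mulrn// -powRN; congr (_ `^ _).
    by field.
  rewrite {1}/a EQ (_ : - a - 1 = - (n.+2%:R / 2)) ?EQ; last first.
    by rewrite /a -addn2 natrD; field.
  by rewrite ![(_ * B)%E]muleC ![(_ * B1)%E]muleC -!muleA -!EFinM !mulrA.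
rewrite ge0_integralD//; last 4 first.
- by pos.
- by mfun.
- by pos.
- by mfun.
rewrite -!mule_integral; sides.
rewrite average_newton_scaled// average_poisson_scaled// -/P.
rewrite -!muleA -!EFinM; clearbody B B1; rewrite ge0_muleDl//.
have E1 : t `^ (- b - 1) * P `^ (a + b - 1) * (t ^+ n)^-1 =
    t `^ (- (a + (a + b)) - 1) * P `^ (a + b - 1).
  rewrite -powR_mulrn ?(ltW t0)// -powRN mulrAC -powRD ?(gt_eqF t0) ?implybT//.
  by congr (_ `^ _ * _); rewrite /a; field.
(* The Poisson mean supplies 1/P, so P^(a+b) drops to P^(a+b-1) and both terms become the same
   function of t and x. *)
rewrite E1 (_ : t `^ (- b - 1) * P `^ (a + b) * (t ^+ n * P)^-1 =
  t `^ (- (a + (a + b)) - 1) * P `^ (a + b - 1))//.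
rewrite -E1 (powR_predr (a + b) P0); field.
by rewrite !gt_eqF// exprn_gt0.
Qed.

End step_kernels.

(** By Cauchy-Schwarz this set is the ray spanned by v, where the shear along v degenerates. With v
    on the first axis, each slice at fixed first coordinate is contained in the origin, a null set
    since at least one coordinate remains. *)
Lemma lebesgue_vec_ray {R : realType} {n : nat} (v : n.+2.-tuple R) : normv v = 1 ->
  lebesgue_vec n.+2 [set y | normv y <= dotv v y] = 0%E.
Proof.
move=> v1.
pose b (y : n.+2.-tuple R) : R := (normv y <= dotv v y)%R%:R.
have mb : measurable_fun setT b by rewrite /b; mfun.
have -> : lebesgue_vec n.+2 [set y | normv y <= dotv v y] =
    (\int[lebesgue_vec n.+2]_y (b y)%:E)%E.
  rewrite -[X in lebesgue_vec _ X]setIT -integral_indic//; last by apply: (@measurable_bool _ _ R).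
  by apply: eq_integral => y _; rewrite /b indicE mem_setE.
have [H [mH Hv dotH _ [HK intH]]] := rotate_to_axis v.
rewrite -intH; last 2 first.
- by mfun.
- by move=> y; rewrite lee_fin.
rewrite integral_lebesgue_vecS; last 2 first.
- by mfun.
- by move=> y; rewrite lee_fin.
rewrite integral0_eq// => a _.
rewrite (@ge0_negligible_integral _ _ _ _ setT [set zerov])//; last 4 first.
- exact: measurable_zerov.
- by mfun.
- by move=> y _; rewrite lee_fin.
- exact: lebesgue_vec_zerov.
rewrite setTD integral0_eq// => s /= s0; rewrite /b.
rewrite normvE dotH -normvE -{1}(HK v) dotH Hv v1 /axisv normvE !dotv_consv dot0v addr0 mul1r.
rewrite leNgt (_ : a < _)//; apply: le_lt_trans (ler_norm _) _.
rewrite -sqrtr_sqr -expr2 ltr_sqrt; last first.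
  rewrite ltr_wpDl ?sqr_ge0// lt_neqAle dotv_ge0 andbT eq_sym dotv_eq0.
  exact/eqP.
rewrite ltrDl lt_neqAle dotv_ge0 andbT eq_sym dotv_eq0.
exact/eqP.
Qed.

(** * Flight with a single change of direction *)

Section flight_with_one_change.
Context {R : realType} {n : nat}.
Notation lambda := (@lebesgue_measure R).
Notation leb := (@lebesgue_vec R).
Notation vec := (n.+2.-tuple R).
Notation sigma := (@uniform_sphere R n.+1).
Notation dvol := (n.+2%:R * @ball_volume R n.+1).
Variables (a t : R).
Hypothesis t0 : 0 < t.

(** Up to a constant, the density at x given that the last direction is v. With Q = |x - t v| and L
    = t - <x,v>, the two legs have lengths Q^2/(2 L) and P/(2 L); the exponents come from
    substituting these. *)
Definition base_kernel (x v : vec) : R :=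
  (normv (addv x (scalev (- t) v)) ^+ 2) `^ (a - n.+1%:R) *
  (t ^+ 2 - normv x ^+ 2) `^ (a - 1) *
  (2 * `|t - dotv x v|) `^ (n.+1%:R - 2 * a).

Variable g : vec -> \bar R.
Hypotheses (mg : measurable_fun setT g) (g0 : forall x, (0 <= g x)%E).

Let two_legs (s : R) (v v' : vec) : \bar R :=
  ((((0 < s) && (s < t))%R%:R * (s `^ (a - 1) * (t - s) `^ (a - 1)))%:E *
   g (addv (scalev s v) (scalev (t - s) v')))%E.

Let mtwo_legs d (U : measurableType d) (fs : U -> R) (fv fw : U -> vec) :
  measurable_fun setT fs -> measurable_fun setT fv -> measurable_fun setT fw ->
  measurable_fun setT (fun u => two_legs (fs u) (fv u) (fw u)).
Proof. by move=> mfs mfv mfw; rewrite /two_legs; mfun. Qed.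

Let two_legs_ge0 s v v' : (0 <= two_legs s v v')%E.
Proof. rewrite /two_legs; pos. Qed.

Let flight_two_legs : flight_functional a 1 t g =
  (\int[sigma]_v' \int[lambda]_s \int[sigma]_v two_legs s v v')%E.
Proof.
rewrite [RHS](fubini_swap (m1 := sigma) (m2 := lambda)
  (fun v' s => \int[sigma]_v two_legs s v v')%E); last 2 first.
- apply: (measurable_integral_r sigma (fun (z : vec * measurableTypeR R) v => two_legs z.2 v z.1)) => //.
  by apply: mtwo_legs; mfun.
- by move=> v' s; exact: integral_ge0.
apply: eq_integral => s _.
rewrite [RHS](fubini_swap (m1 := sigma) (m2 := sigma) (fun v' v => two_legs s v v')%E); last 2 first.
- by apply: mtwo_legs; mfun.
- by [].
rewrite mule_integral; sides; last first.
  apply: emeasurable_funM; first by mfun.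
  apply: (measurable_integral_r sigma (fun v v' => g (addv (scalev s v) (scalev (t - s) v')))) => //.
  by mfun.
apply: eq_integral => v _.
rewrite !mule_integral; sides.
apply: eq_integral => v' _.
by rewrite /two_legs muleA -EFinM mulrA.
Qed.

(** The first leg s v is read as a point y in polar coordinates, with s^(a-1) = s^(d-1) s^(a-d) and
    d = n + 2. *)
Let polar (v' : vec) : normv v' = 1 ->
  (dvol%:E * \int[lambda]_s \int[sigma]_v two_legs s v v' =
   \int[leb n.+2]_y ((((normv y < t)%R%:R * (normv y `^ (a - n.+2%:R) *
     (t - normv y) `^ (a - 1))))%:E * g (addv y (scalev (t - normv y) v'))))%E.
Proof.
move=> v1; rewrite polar_coordinates; last 2 first.
- by mfun.
- by pos.
apply: mule_eqr; apply: eq_integral => s _.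
rewrite mule_integral; sides; last first.
- rewrite lee_fin; case: ltP => [s0|_]; last by rewrite mul0r.
  by rewrite mul1r exprn_ge0// ltW.
apply: ae_uniform_sphere.
- by apply: mtwo_legs; mfun.
- by [].
- by mfun.
- move=> v; rewrite mule_ge0//.
    rewrite lee_fin; case: ltP => [s0|_]; last by rewrite mul0r.
    by rewrite mul1r exprn_ge0// ltW.
  by pos.
move=> v v1'; rewrite /two_legs.
have [s0|_] := ltP 0 s; last by rewrite !mul0r !mul0e.
rewrite normv_scale v1' mulr1 gtr0_norm//= muleA -EFinM; congr (_%:E * _)%E.
have -> : s `^ (a - 1) = s ^+ n.+1 * s `^ (a - n.+2%:R).
  rewrite -powR_mulrn ?(ltW s0)// -powRD ?(gt_eqF s0) ?implybT//.
  by congr (_ `^ _); rewrite -[n.+2]addn1 natrD; ring.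
by ring.
Qed.

(** Norm of the preimage of z under y |-> y - |y| v for a unit v: the equation |z + rho v| = rho is
    now linear in rho, and its solution is positive when <v,z> < 0. *)
Let rho (v z : vec) : R := normv z ^+ 2 / (2 * - dotv v z).

(** The last factor is the inverse of the Jacobian 1 - <v,y>/|y|, expressed in terms of z. *)
Let W (v z : vec) : R :=
  ((0 < rho v z) && (rho v z < t))%R%:R *
  (rho v z `^ (a - n.+2%:R) * (t - rho v z) `^ (a - 1) *
   (normv z ^+ 2 / (2 * dotv v z ^+ 2))).

Let W_ge0 v z : 0 <= W v z.
Proof. by rewrite /W; pos; rewrite ?ler0n//; pos. Qed.

Let mW d (U : measurableType d) (fv fz : U -> vec) :
  measurable_fun setT fv -> measurable_fun setT fz ->
  measurable_fun setT (fun u => W (fv u) (fz u)).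
Proof. by move=> mfv mfz; rewrite /W /rho; mfun. Qed.

(** For z = y - |y| v the endpoint y + (t - |y|) v is z + t v, so the argument of [g] becomes a
    translate of z. The ray on which the Jacobian vanishes is discarded first. *)
Let sheared (v : vec) : normv v = 1 ->
  (\int[leb n.+2]_y ((((normv y < t)%R%:R * (normv y `^ (a - n.+2%:R) *
     (t - normv y) `^ (a - 1))))%:E * g (addv y (scalev (t - normv y) v))) =
   \int[leb n.+2]_z (((dotv v z < 0)%R%:R * W v z)%:E * g (addv z (scalev t v))))%E.
Proof.
move=> v1.
have H := @shear_change_of_variable _ _ v (fun z => (W v z)%:E * g (addv z (scalev t v)))%E.
transitivity (\int[leb n.+2]_z ((((normv v < 1) || (dotv v z < 0))%R%:R)%:E *
   ((W v z)%:E * g (addv z (scalev t v)))))%E; last first.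
  by apply: eq_integral => z _; rewrite v1 ltxx /= muleA -EFinM.
have mWv : measurable_fun setT (W v) by apply: mW; mfun.
rewrite -H ?v1//; last 2 first.
- by mfun.
- by move=> z; rewrite mule_ge0// lee_fin.
rewrite [LHS](@ge0_negligible_integral _ _ _ _ setT [set y | normv y <= dotv v y])//; last 4 first.
- by apply: (@measurable_bool _ _ R); mfun.
- by mfun.
- by pos.
- exact: lebesgue_vec_ray.
rewrite [RHS](@ge0_negligible_integral _ _ _ _ setT [set y | normv y <= dotv v y])//; last 4 first.
- by apply: (@measurable_bool _ _ R); mfun.
- by mfun.
- move=> y _; rewrite mule_ge0 ?mule_ge0 ?lee_fin//.
  rewrite subr_ge0; have [->|y0] := eqVneq (normv y) 0; first by rewrite invr0 mulr0.
  rewrite ler_pdivrMr ?lt_neqAle ?normv_ge0 1?eq_sym ?y0// mul1r.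
  by apply: le_trans (cauchy_schwarz _ _) _; rewrite v1 mul1r.
- exact: lebesgue_vec_ray.
rewrite setTD; apply: eq_integral => y; rewrite inE /= => /negP.
rewrite -ltNge => vy.
have y0 : 0 < normv y.
  rewrite lt_neqAle normv_ge0 andbT eq_sym; apply/negP => /eqP y0.
  move: vy; rewrite y0; move/eqP: y0; rewrite normv_eq0 => /eqP ->.
  by rewrite dotvC dot0v ltxx.
set z := addv y (scalev (- normv y) v).
have E1 : - dotv v z = normv y - dotv v y.
  by rewrite /z dotvDr dotvZr -sqr_normv v1; ring.
have E2 : normv z ^+ 2 = 2 * normv y * (normv y - dotv v y).
  by rewrite /z normv_sub_sqr// (dotvC y); ring.
have E3 : rho v z = normv y.
  by rewrite /rho E1 E2; field; rewrite gt_eqF// subr_gt0.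
have -> : addv z (scalev t v) = addv y (scalev (t - normv y) v).
  by apply: eq_from_tnth => i; rewrite !tnth_mktuple; ring.
rewrite muleA -EFinM; congr (_%:E * _)%E.
rewrite /W E3 y0 /= -[dotv v z]opprK sqrrN E1 E2.
by field; rewrite !gt_eqF// subr_gt0.
Qed.

(** Translation x = z + t v, after which rho = Q^2/(2 L) and t - rho = P/(2 L); the condition rho <
    t becomes |x| < t. *)
Let recentered (v : vec) : normv v = 1 ->
  (\int[leb n.+2]_z (((dotv v z < 0)%R%:R * W v z)%:E * g (addv z (scalev t v))) =
   \int[leb n.+2]_x ((2 * ((normv x < t)%R%:R * base_kernel x v))%:E * g x))%E.
Proof.
move=> v1.
have mWv : measurable_fun setT (W v) by apply: mW; mfun.
transitivity (\int[leb n.+2]_x (((dotv v (addv x (scalev (- t) v)) < 0)%R%:R *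
   W v (addv x (scalev (- t) v)))%:E * g x))%E.
  have <- := lebesgue_vec_shift (scalev t v) (g := fun x =>
     (((dotv v (addv x (scalev (- t) v)) < 0)%R%:R *
       W v (addv x (scalev (- t) v)))%:E * g x)%E); last 2 first.
  - by mfun.
  - by move=> x; rewrite mule_ge0// lee_fin mulr_ge0.
  apply: eq_integral => z _; rewrite (addvC z).
  have -> : addv (addv (scalev t v) z) (scalev (- t) v) = z.
    by apply: eq_from_tnth => i; rewrite !tnth_mktuple; ring.
  by [].
apply: eq_integral => x _; congr (_%:E * _)%E.
set z := addv x (scalev (- t) v).
have E1 : - dotv v z = t - dotv x v.
  by rewrite /z dotvDr dotvZr -sqr_normv v1 (dotvC v); ring.
have E2 : normv z ^+ 2 = normv x ^+ 2 - 2 * t * dotv x v + t ^+ 2.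
  by rewrite /z normv_sub_sqr.
have [xt|xt] := ltP (normv x) t.
  have L0 := dotv_lt_sphere v1 xt; have Q0 := sphere_dist_gt0 t0 v1 xt.
  have P0 := power_difference_gt0 xt.
  rewrite -oppr_gt0 E1 L0 !mul1r /W /rho /base_kernel -/z -(sqrrN (dotv v z)) E1.
  set L := t - dotv x v in E1 L0 *; set Q := normv z in E2 Q0 *.
  set P := t ^+ 2 - normv x ^+ 2 in P0 *.
  have -> : t - Q ^+ 2 / (2 * L) = P / (2 * L).
    by rewrite E2 /P /L; field; rewrite gt_eqF.
  have r0 : 0 < Q ^+ 2 / (2 * L) by rewrite divr_gt0 ?mulr_gt0 ?exprn_gt0.
  rewrite r0 -subr_gt0 (_ : t - _ = P / (2 * L)); last first.
    by rewrite E2 /P /L; field; rewrite gt_eqF.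
  rewrite divr_gt0 ?mulr_gt0//= mul1r (gtr0_norm L0).
  have -> : Q ^+ 2 / (2 * L ^+ 2) = 2 * (Q ^+ 2) `^ 1 * (2 * L) `^ (- 2).
    rewrite powRr1 ?sqr_ge0// powRN powR_mulrn ?mulr_ge0 ?(ltW L0)//.
    by field; rewrite gt_eqF.
  rewrite !powR_exp_ln ?divr_gt0 ?mulr_gt0 ?exprn_gt0//.
  rewrite !lnM ?lnV ?posrE ?invr_gt0 ?mulr_gt0 ?exprn_gt0// !lnM ?posrE ?exprn_gt0//.
  have pull (x1 x2 x3 x4 : R) : x1 * x2 * (2 * x3 * x4) = 2 * (x1 * x2 * x3 * x4) by ring.
  rewrite pull -!expRD; congr (_ * expR _).
  by rewrite -[n.+2]addn1 natrD; ring.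
rewrite mul0r mulr0; have [L0|_] := ltP (dotv v z) 0; last by rewrite mul0r.
rewrite mul1r /W; rewrite (_ : (rho v z < t) = false) ?andbF ?mul0r//.
apply/negbTE; rewrite -leNgt /rho E1 E2.
move: L0; rewrite -oppr_gt0 E1 => L0.
rewrite ler_pdivlMr ?mulr_gt0//.
have : t ^+ 2 <= normv x ^+ 2 by rewrite ler_sqr ?nnegrE ?normv_ge0// ltW.
by lra.
Qed.

Lemma flight_functional_one :
  (flight_functional a 1 t g = (2 / dvol)%:E *
   \int[leb n.+2]_x (((normv x < t)%R%:R)%:E *
     \int[sigma]_v (base_kernel x v)%:E * g x))%E.
Proof.
have d0 : 0 < dvol by rewrite mulr_gt0// ball_volume_gt0.
have mk : measurable_fun setT (fun z : vec * vec => base_kernel z.1 z.2).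
  by rewrite /base_kernel; mfun.
have k0 x v : 0 <= base_kernel x v by rewrite /base_kernel; pos.
have mk' x : measurable_fun setT (base_kernel x).
  by apply: (measurableT_comp mk (g := fun v => (x, v))); mfun.
rewrite flight_two_legs.
transitivity (\int[sigma]_v' ((2 / dvol)%:E * \int[leb n.+2]_x
    (((normv x < t)%R%:R * base_kernel x v')%:E * g x)))%E.
  apply: ae_uniform_sphere.
  - apply: (measurable_integral_r lambda (fun v' s => \int[sigma]_v two_legs s v v')%E).
      apply: (measurable_integral_r sigma (fun (z : vec * measurableTypeR R) v => two_legs z.2 v z.1)) => //.
      by apply: mtwo_legs; mfun.
    by move=> v' s; exact: integral_ge0.
  - by move=> v'; apply: integral_ge0 => s _; exact: integral_ge0.
  - apply: emeasurable_funM; first by mfun.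
    apply: (measurable_integral_r (leb n.+2) (fun v' x => (((normv x < t)%R%:R * base_kernel x v')%:E * g x))%E).
      by mfun.
    by pos.
  - move=> v; rewrite mule_ge0//; last by apply: integral_ge0; pos.
    by rewrite lee_fin divr_ge0// ltW.
  move=> v v1.
  have := polar v1; rewrite sheared// recentered//.
  move/(congr1 (fun z => (dvol^-1)%:E * z)%E).
  rewrite muleA -EFinM mulVf ?gt_eqF// mul1e => ->.
  rewrite [(2 / _)%R]mulrC EFinM -muleA [in RHS]mule_integral; sides.
  apply: mule_eqr; apply: eq_integral => x _.
  by rewrite muleA -EFinM.
rewrite -mule_integral; last 3 first.
- apply: (measurable_integral_r (leb n.+2) (fun v' x => (((normv x < t)%R%:R * base_kernel x v')%:E * g x))%E).
    by mfun.
  by pos.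
- by pos.
- by rewrite lee_fin divr_ge0// ltW.
apply: mule_eqr.
rewrite (fubini_swap (m1 := sigma) (m2 := leb n.+2) (fun v x => (((normv x < t)%R%:R * base_kernel x v)%:E * g x)%E)); last 2 first.
- by mfun.
- by pos.
apply: eq_integral => x _.
rewrite muleC mule_integral; sides.
rewrite mule_integral; sides.
- by apply: eq_integral => v _; rewrite muleC EFinM.
- by apply: emeasurable_funM; [exact: measurable_cst|apply/measurable_EFinP; exact: mk'].
- by apply/measurable_EFinP; exact: mk'.
Qed.

End flight_with_one_change.

(** * Endpoint densities for h = 1 and h = 2 *)

Section radial_laws.
Context {R : realType} {n : nat}.
Notation lambda := (@lebesgue_measure R).
Notation leb := (@lebesgue_vec R).
Notation vec := (n.+2.-tuple R).
Notation sigma := (@uniform_sphere R n.+1).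

Lemma radial_law_base (a e q c : R) : 0 <= c ->
  (forall t x, 0 < t -> normv x < t ->
    (\int[sigma]_v (base_kernel a t x v)%:E =
     (c * (t `^ e * (t ^+ 2 - normv x ^+ 2) `^ q))%:E)%E) ->
  @radial_law R n a 1 e q.
Proof.
move=> c0 cE; have vol0 := @ball_volume_gt0 R n.+1.
pose C : R := 2 / (n.+2%:R * @ball_volume R n.+1).
have C0 : 0 <= C by rewrite divr_ge0// mulr_ge0// ltW.
exists (C * c)%:E; first by rewrite lee_fin mulr_ge0.
move=> t g t0 mg g0; rewrite flight_functional_one// -/C; clearbody C.
rewrite (EFinM C) -!muleA; apply: mule_eqr.
rewrite mule_integral; sides.
rewrite mule_integral; sides.
apply: eq_integral => x _; have [xt|_] := ltP (normv x) t; last by rewrite mul0r !mul0e !mule0.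
by rewrite cE// !mul1r mul1e !muleA -!EFinM mulrA.
Qed.

(** For a = d - 1 the first factor of the kernel has exponent 0, so only L^(1-d) is averaged. *)
Lemma average_base_kernel1 (a := n.+1%:R) (t : R) (x : vec) :
  0 < t -> normv x < t ->
  (\int[sigma]_v (base_kernel a t x v)%:E =
   (2 `^ (- a) * (t `^ 0 * (t ^+ 2 - normv x ^+ 2) `^ (a / 2 - 1)))%:E)%E.
Proof.
move=> t0 xt; have P0 := power_difference_gt0 xt.
rewrite /base_kernel; set P := t ^+ 2 - normv x ^+ 2 in P0 *.
transitivity (\int[sigma]_v ((2 `^ (- a) * P `^ (a - 1))%:E * ((`|t - dotv x v| ^+ n.+1)^-1)%:E))%E.
  apply: eq_integral => v _; rewrite -EFinM; congr EFin.
  rewrite subrr powRr0 mul1r (_ : n.+1%:R - 2 * a = - a); last by rewrite -/a; ring.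
  rewrite powRM// [X in _ * (_ * X)]powRN powR_mulrn// /a.
  by ring.
rewrite -mule_integral; sides.
rewrite average_lorentz_scaled// -/P -EFinM -mulrA powRr0 mul1r; congr (_ * _)%:E.
rewrite -powR12_sqrt ?(ltW P0)// -powR_mulrn ?powR_ge0// -powRrM -/a -powRN.
rewrite -powRD ?(gt_eqF P0) ?implybT//.
by congr (_ `^ _); field.
Qed.

(** For a = d/2 - 1 the last factor has exponent 1 and splits, leaving one Poisson and one Newton
    term. *)
Lemma average_base_kernel2 (a := n%:R / 2) (t : R) (x : vec) :
  (0 < n)%N -> 0 < t -> normv x < t ->
  (\int[sigma]_v (base_kernel a t x v)%:E =
   (2 * (t `^ (- (a + a) - 1) * (t ^+ 2 - normv x ^+ 2) `^ (a - 1)))%:E)%E.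
Proof.
move=> n0 t0 xt; have P0 := power_difference_gt0 xt.
set P := t ^+ 2 - normv x ^+ 2 in P0 *.
pose Q v := normv (addv x (scalev (- t) v)).
have mQ : measurable_fun setT Q by rewrite /Q; mfun.
have Q_ge0 v : 0 <= Q v by exact: normv_ge0.
rewrite (ae_uniform_sphere (g2 := fun v =>
    ((t^-1 * P `^ a)%:E * ((Q v ^+ n.+2)^-1)%:E +
     (t^-1 * P `^ (a - 1))%:E * ((Q v ^+ n)^-1)%:E)%E)); last 5 first.
- by rewrite /base_kernel; mfun.
- by rewrite /base_kernel; pos.
- by mfun.
- by pos.
- move=> v v1; have L0 := dotv_lt_sphere v1 xt; have Q0 := sphere_dist_gt0 t0 v1 xt.
  rewrite /base_kernel -/P -/(Q v) gtr0_norm//.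
  have LPQ : 2 * (t - dotv x v) = (P + Q v ^+ 2) / t.
    by rewrite /P /Q normv_sub_sqr//; field; rewrite gt_eqF.
  rewrite (_ : n.+1%:R - 2 * a = 1); last by rewrite /a -addn1 natrD; field.
  rewrite powRr1; last by rewrite mulr_ge0// ltW.
  rewrite LPQ (_ : a - n.+1%:R = - (n.+2%:R / 2)); last first.
    by rewrite /a -addn2 -[n.+1]addn1 !natrD; field.
  have -> : (Q v ^+ 2) `^ (- (n.+2%:R / 2)) = (Q v ^+ n.+2)^-1.
    rewrite -powR_mulrn// -powRrM -powR_mulrn// -powRN; congr (_ `^ _).
    by field.
  rewrite -!EFinM -EFinD; congr EFin; rewrite (powR_predr a P0).
  rewrite -[n.+2]addn2 exprD; field.
  by rewrite !expf_neq0 ?gt_eqF.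
rewrite ge0_integralD//; last 4 first.
- by pos.
- by mfun.
- by pos.
- by mfun.
rewrite -!mule_integral; sides.
rewrite average_newton_scaled// average_poisson_scaled// -/P -!EFinM -EFinD.
congr EFin; rewrite (powR_predr a P0).
have -> : t `^ (- (a + a) - 1) = t^-1 * (t ^+ n)^-1.
  rewrite -powR_mulrn ?(ltW t0)// -powRN -[t^-1]powR_inv1 ?(ltW t0)// -powRD ?(gt_eqF t0) ?implybT//.
  by congr (_ `^ _); rewrite /a; field.
by field; rewrite !gt_eqF// exprn_gt0.
Qed.

Lemma radial_law1 (N : nat) (a : R := n.+1%:R) : (0 < N)%N ->
  @radial_law R n a N 0 (N%:R * (a / 2) - 1).
Proof.
case: N => // N _; elim: N => [|N IH].
  rewrite mul1r; apply: (radial_law_base (c := 2 `^ (- a))); first exact: powR_ge0.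
  by move=> t x t0 xt; exact: average_base_kernel1.
apply: (radial_law_step (c := ((2 `^ (- a))%:E *
   \int[lambda]_u (beta_weight a (N.+1%:R * (a / 2)) u)%:E)%E) _ _ IH).
  by rewrite mule_ge0 ?lee_fin ?powR_ge0// beta_integral_ge0.
move=> t x t0 xt; rewrite average_step_kernel1//; congr (_ * (_ * _ `^ _)%:E)%E.
by rewrite -[in RHS]addn1 natrD; ring.
Qed.

(** The power of t after N changes, -(N+1) a - 1, is -(a+b) - 1 for b = N a, precisely the exponent
    that [mobius_beta_integral] requires; this is why the recursion closes. *)
Lemma radial_law2 (N : nat) (a : R := n%:R / 2) : (0 < n)%N -> (0 < N)%N ->
  @radial_law R n a N (- (N.+1%:R * a) - 1) (N%:R * a - 1).
Proof.
move=> n0; case: N => // N _; elim: N => [|N IH].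
  rewrite mul1r mulrDl mul1r; apply: (radial_law_base (c := 2)) => //.
  by move=> t x t0 xt; exact: average_base_kernel2.
have EN (k : nat) : k.+1%:R * a = a + k%:R * a by rewrite -addn1 natrD; ring.
rewrite EN in IH.
rewrite (EN N.+2) (EN N.+1).
apply: (radial_law_step (c := (\int[lambda]_u (beta_weight a (N.+1%:R * a) u)%:E +
   \int[lambda]_u (u * beta_weight a (N.+1%:R * a) u)%:E)%E) _ _ IH).
  by rewrite adde_ge0 ?beta_integral_ge0 ?beta_integral1_ge0.
by move=> t x t0 xt; rewrite average_step_kernel2.
Qed.

End radial_laws.

(** * Normalization *)

Section gamma_integral.
Context {R : realType}.
Notation lambda := (@lebesgue_measure R).
Notation leb := (@lebesgue_vec R).

(** Euler's integral kept in the extended reals. [Gamma] is its [fine] part, equal to 0 for an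
    infinite integral, so finiteness has to be proved before [Gamma] can be used. *)
Definition gamma_integral (p : R) : \bar R :=
  (\int[lambda]_s ((0 < s)%R%:R * (s `^ (p - 1) * expR (- s)))%:E)%E.

Lemma gamma_integral_ge0 p : (0 <= gamma_integral p)%E.
Proof. rewrite /gamma_integral; pos. Qed.

Lemma GammaE (p : R) : Gamma p = fine (gamma_integral p).
Proof.
rewrite /Gamma /Rintegral [in LHS]integral_indicl /gamma_integral.
congr fine; apply: eq_integral => s _; rewrite -EFinM; congr (_ * _)%:E.
by rewrite indicE mem_setE in_itv/= andbT.
Qed.

Lemma gamma_integral1 : gamma_integral 1 = 1%E.
Proof.
rewrite -(@integral_exponential_pdf R 1 ltr01) /gamma_integral.
transitivity (\int[lambda]_(s in `]0%R, +oo[) (expR (- s))%:E)%E.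
  rewrite [RHS]integral_indicl; apply: eq_integral => s _; rewrite -EFinM; congr EFin.
  rewrite subrr powRr0 mul1r; congr (_ * _).
  by rewrite indicE mem_setE in_itv/= andbT.
rewrite integral_itv_obnd_cbnd; last by apply: measurable_funTS; mfun.
rewrite integral_mkcond; apply: eq_integral => s _.
rewrite /exponential_pdf !patchE; case: ifP => // _.
by rewrite mul1r mulN1r.
Qed.

Lemma integral_gauss_vec m :
  (\int[leb m]_x (expR (- normv x ^+ 2))%:E = (Num.sqrt pi ^+ m)%:E)%E.
Proof.
elim: m => [|m IH].
  rewrite /= integral_dirac//; last by mfun.
  by rewrite diracT mul1e sqr_normv /dotv big_ord0 oppr0 expR0.
rewrite integral_lebesgue_vecS; last 2 first.
- by mfun.
- by pos.
transitivity (\int[lambda]_a ((gauss_fun a)%:E * (Num.sqrt pi ^+ m)%:E))%E.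
  apply: eq_integral => a _; rewrite -IH mule_integral; sides.
  apply: eq_integral => s _; rewrite /gauss_fun -EFinM -expRD !sqr_normv dotv_consv expr2.
  by congr (expR _)%:E; ring.
rewrite ge0_integralZr//; last 2 first.
- by apply/measurable_EFinP; exact: measurable_gauss_fun.
- by move=> a _; rewrite lee_fin gauss_fun_ge0.
by rewrite integralT_gauss -EFinM exprS.
Qed.

Definition ball_power m (T q : R) : \bar R :=
  (\int[leb m]_x ((normv x < T)%R%:R * (T ^+ 2 - normv x ^+ 2) `^ q)%:E)%E.

Lemma ball_power_ge0 m T q : (0 <= ball_power m T q)%E.
Proof. rewrite /ball_power; pos. Qed.

Lemma ball_power_scale m (T q : R) : 0 < T ->
  (ball_power m T q = (T `^ (2 * q + m%:R))%:E * ball_power m 1 q)%E.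
Proof.
move=> T0; pose g (x : m.-tuple R) : \bar R := ((normv x < T)%R%:R * (T ^+ 2 - normv x ^+ 2) `^ q)%:E.
have mg : measurable_fun setT g by rewrite /g; mfun.
have g0 (x : m.-tuple R) : (0 <= g x)%E by rewrite /g; pos.
have E : (ball_power m T q = (T ^+ m)%:E * \int[leb m]_x g (scalev T x))%E.
  by rewrite lebesgue_vec_scale// muleA -EFinM mulfV ?mul1e// expf_neq0 ?gt_eqF.
rewrite {}E /ball_power mule_integral; sides.
rewrite [in RHS]mule_integral; sides.
apply: eq_integral => x _; rewrite /g -!EFinM; congr EFin.
rewrite normv_scale gtr0_norm// gtr_pMr//.
have [x1|_] := ltP (normv x) 1; last by rewrite !mul0r !mulr0.
have -> : T ^+ 2 - (T * normv x) ^+ 2 = T ^+ 2 * (1 ^+ 2 - normv x ^+ 2) by ring.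
rewrite !mul1r powRM ?sqr_ge0//; last by rewrite ltW// power_difference_gt0.
rewrite mulrA -powR_mulrn ?(ltW T0)// -(powR_mulrn 2) ?(ltW T0)// -powRrM.
by rewrite -powRD ?(gt_eqF T0) ?implybT// addrC.
Qed.

(** Integrate (u - |x|^2)^(p-1) e^(-u) over |x|^2 < u in both orders. For fixed x a shift of u gives
    the Gamma integral at p times a Gaussian; for fixed u the ball of radius sqrt u gives a power of
    u by scaling. *)
Lemma ball_power_gamma m (p : R) :
  (ball_power m 1 (p - 1) * gamma_integral (p + m%:R / 2) =
   gamma_integral p * (Num.sqrt pi ^+ m)%:E)%E.
Proof.
have gp0 := gamma_integral_ge0 p; have bp0 := ball_power_ge0 m 1 (p - 1).
rewrite -integral_gauss_vec [in RHS]mule_integral; sides.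
pose w (x : m.-tuple R) (u : R) : R :=
  (normv x ^+ 2 < u)%R%:R * ((u - normv x ^+ 2) `^ (p - 1) * expR (- u)).
have w0 x u : 0 <= w x u by rewrite /w; pos.
have mw : measurable_fun setT (fun z : m.-tuple R * measurableTypeR R => w z.1 z.2).
  by rewrite /w; mfun.
transitivity (\int[leb m]_x \int[lambda]_u (w x u)%:E)%E; last first.
  apply: eq_integral => x _; rewrite muleC /gamma_integral mule_integral; sides.
  rewrite -[RHS](lebesgue_shift (- normv x ^+ 2)); sides.
  apply: eq_integral => u _; rewrite -EFinM /w; congr EFin.
  rewrite (addrC (- _)) subr_gt0 [RHS]mulrCA; congr (_ * _).
  by rewrite [RHS]mulrCA -expRD; congr (_ * expR _); ring.
rewrite (fubini_swap (m1 := leb m) (m2 := lambda) (fun x u => (w x u)%:E)); last 2 first.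
- by mfun.
- by move=> x u; rewrite lee_fin.
rewrite /gamma_integral mule_integral; sides.
apply: eq_integral => u _.
have [u0|u0] := ltP 0 u; last first.
  rewrite mul0r mule0 integral0_eq// => x _; rewrite /w.
  by rewrite (ltNge (_ ^+ 2)) (le_trans u0 (sqr_ge0 _)) mul0r.
have su : 0 < Num.sqrt u by rewrite sqrtr_gt0.
transitivity ((expR (- u))%:E * ball_power m (Num.sqrt u) (p - 1))%E.
  have -> : true%:R * (u `^ (p + m%:R / 2 - 1) * expR (- u)) =
      expR (- u) * Num.sqrt u `^ (2 * (p - 1) + m%:R).
    rewrite mul1r mulrC -powR12_sqrt ?(ltW u0)// -powRrM; congr (_ * _ `^ _).
    by field.
  by rewrite muleC EFinM -muleA -ball_power_scale.
rewrite /ball_power mule_integral; sides.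
apply: eq_integral => x _; rewrite /w -EFinM; congr EFin.
rewrite sqr_sqrtr ?(ltW u0)//.
rewrite (_ : (normv x < Num.sqrt u) = (normv x ^+ 2 < u)); first by ring.
by rewrite -[u in RHS]sqr_sqrtr ?(ltW u0)// ltr_sqr// nnegrE ?normv_ge0 ?ltW.
Qed.

Lemma ball_power0 m : ball_power m.+1 1 0 = (@ball_volume R m)%:E.
Proof.
rewrite -ball_volumeE -[X in leb _ X]setIT -integral_indic//; last exact: measurable_ball.
apply: eq_integral => x _; rewrite powRr0 mulr1 indicE mem_setE.
by [].
Qed.

(** Case p = 1 of [ball_power_gamma]: the Gamma integral at 1 is 1 and the ball integral is the
    volume of the unit ball, finite and positive. *)
Lemma gamma_integral_half m : exists2 r : R, 0 < r &
  gamma_integral (1 + m.+1%:R / 2) = r%:E.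
Proof.
have := ball_power_gamma m.+1 1; rewrite subrr ball_power0 gamma_integral1 mul1e.
have v0 := @ball_volume_gt0 R m.
move/(congr1 (fun z => ((@ball_volume R m)^-1)%:E * z)%E).
rewrite muleA -!EFinM mulVf ?gt_eqF// mul1e => ->.
by eexists; last reflexivity; rewrite mulr_gt0 ?invr_gt0// exprn_gt0// sqrtr_gt0 pi_gt0.
Qed.

(* Gamma p is only known to be finite and positive through that of [ball_power],
   which the total mass of the flight density provides. *)
Lemma ball_power_Gamma m (p T r : R) (k : nat) : 0 < T -> 0 < r ->
  p + m%:R / 2 = 1 + k.+1%:R / 2 -> ball_power m T (p - 1) = r%:E ->
  [/\ 0 < Gamma p, 0 < Gamma (p + m%:R / 2) &
   r = Gamma p / Gamma (p + m%:R / 2) * (pi `^ (m%:R / 2) * T `^ (2 * (p - 1) + m%:R))].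
Proof.
move=> T0 r0 pk; rewrite ball_power_scale//.
set Tq := T `^ _ => H.
have Tq0 : 0 < Tq by exact: powR_gt0.
have I1 : ball_power m 1 (p - 1) = (r / Tq)%:E.
  move/(congr1 (fun z => (Tq^-1)%:E * z)%E): H.
  by rewrite muleA -!EFinM mulVf ?gt_eqF// mul1e mulrC.
have := ball_power_gamma m p; rewrite I1.
have [g g0 gE] := gamma_integral_half k.
have s0 : 0 < Num.sqrt pi ^+ m :> R by rewrite exprn_gt0// sqrtr_gt0 pi_gt0.
rewrite !GammaE pk gE -EFinM /= => /esym.
move/(congr1 (fun z => z * ((Num.sqrt pi ^+ m)^-1)%:E)%E).
rewrite -muleA -!EFinM mulfV ?gt_eqF// mule1 => ->/=.
split => //; first by rewrite divr_gt0// mulr_gt0// divr_gt0.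
have -> : pi `^ (m%:R / 2) = Num.sqrt pi ^+ m :> R.
  rewrite -powR12_sqrt ?pi_ge0// -powR_mulrn ?powR_ge0// -powRrM.
  by congr (_ `^ _); field.
by field; rewrite !gt_eqF.
Qed.

End gamma_integral.

(** * The joint law of directions and times *)

Section power_probability.
Context d (T : measurableType d) (R : realType).
Variable p : probability T R.

Definition cons_tuple m (z : T * m.-tuple T) : m.+1.-tuple T := [tuple of z.1 :: z.2].

Lemma measurable_cons_tuple m : measurable_fun setT (@cons_tuple m).
Proof. by apply: measurable_cons; mfun. Qed.

Definition power_step m (mu : probability (m.-tuple T) R) : set (m.+1.-tuple T) -> \bar R :=
  image_measure (product_measure1 p mu) (@measurable_cons_tuple m).

HB.instance Definition _ m mu := Measure.on (@power_step m mu).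

Let power_step_setT m (mu : probability (m.-tuple T) R) : power_step mu setT = 1%E.
Proof.
transitivity (product_measure1 p mu (setT `*` setT)).
  by rewrite setXTT /power_step image_measureE preimage_setT.
rewrite product_measure1E//.
exact: (etrans (f_equal2 mule (probability_setT p) (probability_setT mu)) (mule1 _)).
Qed.

HB.instance Definition _ m mu := Measure_isProbability.Build _ _ _ (@power_step m mu)
  (power_step_setT mu).

Fixpoint power_probability m : probability (m.-tuple T) R :=
  match m with
  | 0 => @dirac _ (0.-tuple T) [tuple] R
  | m'.+1 => power_step (power_probability m')
  end.

Lemma integral_power_probabilityS m (g : m.+1.-tuple T -> \bar R) :
  measurable_fun setT g -> (forall x, (0 <= g x)%E) ->
  (\int[power_probability m.+1]_x g x =
   \int[p]_v \int[power_probability m]_w g (cons_tuple (v, w)))%E.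
Proof.
move=> mg g0.
transitivity (\int[image_measure (product_measure1 p (power_probability m))
    (@measurable_cons_tuple m)]_x g x)%E.
  by apply: eq_measure_integral.
rewrite ge0_integral_image// (fubini_tonelli1 (fun z => g (cons_tuple z)))//.
by apply: measurableT_comp => //; exact: measurable_cons_tuple.
Qed.

Definition box m (B : 'I_m -> set T) : set (m.-tuple T) :=
  [set x | forall i, B i (tnth x i)].

Lemma measurable_box m (B : 'I_m -> set T) :
  (forall i, measurable (B i)) -> measurable (box B).
Proof.
move=> mB; rewrite (_ : box B = \bigcap_(i in [set: 'I_m])
    ((fun s : m.-tuple T => tnth s i) @^-1` B i)).
  apply: fin_bigcap_measurable => // i _; rewrite -[X in measurable X]setTI.
  exact: (measurable_tnth i).
by apply/seteqP; split => x /= Ax i; [move=> _|]; exact: Ax.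
Qed.

Lemma power_probability_box m (B : 'I_m -> set T) : (forall i, measurable (B i)) ->
  power_probability m (box B) = (\prod_(i < m) p (B i))%E.
Proof.
elim: m B => [|m IH] B mB.
  by rewrite big_ord0 /= diracE mem_set// => -[].
rewrite big_ord_recl -IH//.
have -> : power_probability m.+1 (box B) = product_measure1 p (power_probability m)
    (B ord0 `*` box (fun i => B (lift ord0 i))).
  rewrite /= /power_step image_measureE; congr (product_measure1 _ _ _).
  apply/seteqP; split => -[x s] /=.
    move=> H; split; first exact: (H ord0).
    by move=> i; have := H (lift ord0 i); rewrite /cons_tuple tnthS.
  move=> [Ax As] i; have [j ->|->//] := unliftP ord0 i.
  by rewrite tnthS; exact: As.
by apply: product_measure1E => //; exact: measurable_box.
Qed.

(** Boxes are stable under intersection and generate the sigma-algebra, so two measures, the first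
    of them finite, agree as soon as they agree on boxes. *)
Lemma box_measure_unique m (m1 m2 : {measure set (m.-tuple T) -> \bar R}) :
  (m1 setT < +oo)%E ->
  (forall B, (forall i, measurable (B i)) -> m1 (box B) = m2 (box B)) ->
  forall A, measurable A -> m1 A = m2 A.
Proof.
move=> m1oo m12.
pose G : set (set (m.-tuple T)) :=
  [set A | exists2 B : 'I_m -> set T, (forall i, measurable (B i)) & A = box B].
have GT : G setT.
  exists (fun=> setT) => //; apply/seteqP; split => x //=.
have mG : measurable = <<s G >>.
  apply/seteqP; split; last first.
    apply: smallest_sub; first exact: sigma_algebra_measurable.
    by move=> _ [B mB ->]; exact: measurable_box.
  apply: smallest_sub; first exact: smallest_sigma_algebra.
  elim/big_ind: _ => [||i _]; first by [].
    by move=> X Y XG YG; rewrite subUset.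
  move=> _ [B mB <-]; apply: sub_sigma_algebra.
  (* A cylinder over one coordinate is a box whose other sides are the whole space. *)
  exists (fun j => if j == i then B else setT).
    by move=> j; case: (j == i).
  rewrite setTI; apply/seteqP; split => x /=.
    by move=> Bx j; case: eqP => // ->.
  by move=> /(_ i); rewrite eqxx.
apply: (@measure_unique _ R _ G (fun=> setT)) => //.
- move=> _ _ [B mB ->] [C mC ->]; exists (fun i => B i `&` C i).
    by move=> i; exact: measurableI.
  apply/seteqP; split => x /=; first by move=> [xB xC] i; split.
  by move=> H; split => i; have [] := H i.
- by rewrite bigcup_const//; exists 0%N.
- by move=> _ [B mB ->]; exact: m12.
Qed.

End power_probability.

Section density_integral.
Context d (T : measurableType d) (R : realType).
Variables (mu : {sigma_finite_measure set T -> \bar R}) (f : T -> R).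
Hypotheses (mf : measurable_fun setT f) (f0 : forall x, 0 <= f x).
Notation lambda := (@lebesgue_measure R).

(** The subgraph again realizes the measure with density [f] as a first marginal. *)
Let under : set (T * measurableTypeR R) := [set z | (0 <= z.2) && (z.2 < f z.1)].

Let munder : measurable under.
Proof. by apply: (@measurable_bool _ _ R); mfun. Qed.

Let nu' : {measure set T -> \bar R} :=
  image_measure (mrestr (product_measure1 mu lambda) munder) measurable_fst.

Let int_nu' (g : T -> \bar R) : measurable_fun setT g -> (forall x, (0 <= g x)%E) ->
  (\int[nu']_x g x = \int[mu]_x ((f x)%:E * g x))%E.
Proof.
move=> mg g0; rewrite ge0_integral_image//.
rewrite (ge0_integral_mrestr _ munder)//; last exact: measurableT_comp.
rewrite integral_indicl.
rewrite (fubini_tonelli1 (m1 := mu) (m2 := lambda) (fun z => (\1_under z)%:E * (g \o fst) z)%E); last 2 first.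
- apply: emeasurable_funM; first exact/measurable_EFinP/measurable_indic.
  exact: measurableT_comp.
- by move=> z; apply: mule_ge0; [rewrite lee_fin|exact: g0].
apply: eq_integral => y _; rewrite /fubini_F /=.
have munderi : measurable_fun setT (\1_under : _ -> R) by exact: measurable_indic.
rewrite ge0_integralZr//; last by apply/measurable_EFinP; exact: measurableT_comp.
congr (_ * _)%E.
rewrite (_ : (fun z => _) = (fun z => (\1_(xsection under y) z)%:E)); last first.
  by apply/funext => z; rewrite !indicE mem_xsection.
rewrite integral_indic ?setIT//; last exact: measurable_xsection.
rewrite (_ : xsection under y = `[0, f y[%classic); last first.
  by apply/seteqP; split => z; rewrite xsectionE/= /under/= in_itv.
transitivity (lambda `[0%R, f y[%classic); first by [].
rewrite lebesgue_measure_itv/= lte_fin; case: ltP => [_|fy0].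
  by rewrite sube0.
by congr EFin; apply/eqP; rewrite eq_le fy0 f0.
Qed.

Lemma density_integral (nu : {measure set T -> \bar R}) (g : T -> \bar R) :
  (forall A, measurable A -> nu A = \int[mu]_(x in A) (f x)%:E)%E ->
  measurable_fun setT g -> (forall x, (0 <= g x)%E) ->
  (\int[nu]_x g x = \int[mu]_x ((f x)%:E * g x))%E.
Proof.
move=> nuE mg g0; rewrite -int_nu'//; apply: eq_measure_integral => A mA _.
rewrite nuE// -[X in nu' X]setIT -integral_indic// int_nu'; last 2 first.
- by apply/measurable_EFinP; exact: measurable_indic.
- by move=> x; rewrite lee_fin.
by rewrite integral_indicl; apply: eq_integral => x _; rewrite muleC.
Qed.

End density_integral.

(** * Dirichlet times and removal of the first leg *)

Section flight_law.
Context {R : realType} {n : nat}.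
Notation lambda := (@lebesgue_measure R).
Notation leb := (@lebesgue_vec R).
Notation vec := (n.+2.-tuple R).
Notation sigma := (@uniform_sphere R n.+1).
Variable a : R.

Lemma interval_length0 N (t s0 : R) (s : N.-tuple R) :
  interval_length t (consv (s0, s)) 0 = s0.
Proof. by []. Qed.

Lemma interval_lengthS N (t s0 : R) (s : N.-tuple R) k :
  interval_length t (consv (s0, s)) k.+1 = interval_length (t - s0) s k.
Proof.
rewrite /interval_length /=; congr nth; rewrite big_ord_recl /consv tnth0 opprD addrA.
by congr (_ - _); apply: eq_bigr => i _; rewrite tnthS.
Qed.

Lemma measurable_interval_length N (t : R) k :
  measurable_fun setT (fun s : N.-tuple R => interval_length t s k).
Proof.
rewrite /interval_length; have [kN|Nk] := ltnP k N.
  rewrite (_ : (fun s => _) = (fun s : N.-tuple R => tnth s (Ordinal kN))).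
    exact: measurable_tnth.
  by apply/funext => s; rewrite (tnth_nth (t - \sum_(j < N) tnth s j)).
rewrite (_ : (fun s => _) = (fun s : N.-tuple R => t - \sum_(j < N) tnth s j)).
  by mfun.
by apply/funext => s; rewrite nth_default// size_tuple.
Qed.

(** Dirichlet density without its constant, which makes it factor exactly when the first interval is
    removed. *)
Definition simplex_weight N (t : R) (s : N.-tuple R) : R :=
  \prod_(k < N.+1) interval_length t s k `^ (a - 1) * \1_(@simplex R N t) s.

Lemma simplex_cons N (t s0 : R) (s : N.-tuple R) :
  simplex t (consv (s0, s)) <-> (0 < s0) && (s0 < t) /\ simplex (t - s0) s.
Proof.
have E : \sum_(k < N.+1) tnth (consv (s0, s)) k = s0 + \sum_(k < N) tnth s k.
  by rewrite big_ord_recl /consv tnth0; congr (_ + _); apply: eq_bigr => i _; rewrite tnthS.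
rewrite /simplex /= E; split.
  move=> [s_gt0 st]; have s00 := s_gt0 ord0.
  have sp k : 0 < tnth s k by have := s_gt0 (lift ord0 k); rewrite /consv tnthS.
  have S0 : 0 <= \sum_(k < N) tnth s k by apply: sumr_ge0 => k _; exact: ltW.
  split; last by split => //; rewrite ltrBrDl.
  by rewrite /consv tnth0 in s00; rewrite s00/=; apply: le_lt_trans st; rewrite lerDl.
move=> [/andP[s00 _] [sp st]]; split; last by rewrite -ltrBrDl.
by move=> k; have [j ->|->] := unliftP ord0 k; rewrite /consv ?tnthS// tnth0.
Qed.

Lemma simplex_weight_cons N (t s0 : R) (s : N.-tuple R) :
  simplex_weight t (consv (s0, s)) =
  ((0 < s0) && (s0 < t))%R%:R * s0 `^ (a - 1) * simplex_weight (t - s0) s.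
Proof.
rewrite /simplex_weight big_ord_recl interval_length0.
have -> : \1_(simplex t) (consv (s0, s)) =
    ((0 < s0) && (s0 < t))%R%:R * \1_(simplex (t - s0)) s :> R.
  rewrite !indicE -natrM mulnb; congr (nat_of_bool _)%:R.
  apply/idP/idP; rewrite ?inE => H.
    by have /simplex_cons[-> H'] := H; rewrite mem_set.
  by move/andP: H => [H1]; rewrite inE => H2; apply/simplex_cons.
under eq_bigr do rewrite interval_lengthS.
by ring.
Qed.

Lemma simplex_weight_ge0 N t (s : N.-tuple R) : 0 <= simplex_weight t s.
Proof. by rewrite /simplex_weight mulr_ge0// prodr_ge0// => k _; exact: powR_ge0. Qed.

Lemma measurable_simplex N (t : R) : measurable (@simplex R N t).
Proof.
have -> : @simplex R N t = \bigcap_(i in [set: 'I_N]) [set s | 0 < tnth s i] `&`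
    [set s | \sum_(k < N) tnth s k < t].
  by apply/seteqP; split => s /= [H1 H2]; split => // i; [move=> _|]; exact: H1.
apply: measurableI; last by apply: (@measurable_bool _ _ R); mfun.
apply: fin_bigcap_measurable => // i _.
by apply: (@measurable_bool _ _ R); mfun.
Qed.

Lemma measurable_simplex_weight N t : measurable_fun setT (@simplex_weight N t).
Proof.
apply: measurable_funM; last by apply: measurable_indic; exact: (@measurable_simplex N t).
apply: (measurable_prod (s := index_enum 'I_N.+1)
  (h := fun k s => interval_length t s k `^ (a - 1))) => k _.
apply: measurable_fun_powRl.
exact: (@measurable_interval_length N t k).
Qed.

(** Position at unit speed as a deterministic function of times and directions, to be integrated
    against their joint law. *)
Definition endpoint N (t : R) (s : N.-tuple R) (v : N.+1.-tuple vec) : vec :=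
  sumv N.+1 (fun k => scalev (interval_length t s k) (nth zerov v k)).

Lemma endpoint_cons N t s0 (s : N.-tuple R) (v0 : vec) v :
  endpoint t (consv (s0, s)) (cons_tuple (v0, v)) =
  addv (scalev s0 v0) (endpoint (t - s0) s v).
Proof.
apply: eq_from_tnth => i; rewrite !tnth_mktuple big_ord_recl interval_length0 /=.
rewrite !tnth_mktuple; congr (_ + _); apply: eq_bigr => k _.
by rewrite interval_lengthS.
Qed.

Lemma measurable_endpoint N t d (U : measurableType d) (fs : U -> N.-tuple R)
    (fv : U -> N.+1.-tuple vec) :
  measurable_fun setT fs -> measurable_fun setT fv ->
  measurable_fun setT (fun u => endpoint t (fs u) (fv u)).
Proof.
move=> mfs mfv; apply: measurable_tuple => i.
under eq_fun do rewrite tnth_mktuple.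
apply: measurable_sum => k; under eq_fun do rewrite tnth_mktuple.
apply: measurable_funM.
  by apply: (measurableT_comp (measurable_interval_length t k)).
apply: measurable_fun_tnth.
under eq_fun do rewrite -tnth_nth.
exact: (measurableT_comp (measurable_tnth k) mfv).
Qed.

(** Induction on N: splitting off the first time and the first direction with Tonelli reproduces the
    defining recursion of [flight_functional]. *)
Lemma flight_functional_integral N t (g : vec -> \bar R) : 0 < t ->
  measurable_fun setT g -> (forall x, (0 <= g x)%E) ->
  (\int[leb N]_s ((simplex_weight t s)%:E *
     \int[power_probability sigma N.+1]_v g (endpoint t s v)) =
   flight_functional a N t g)%E.
Proof.
have msw M t' := @measurable_simplex_weight M t'.
have sw0 M t' := @simplex_weight_ge0 M t'.
have mS M t' (h : vec -> \bar R) : measurable_fun setT h -> (forall x, (0 <= h x)%E) ->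
    measurable_fun setT (fun s : M.-tuple R =>
      \int[power_probability sigma M.+1]_v h (endpoint t' s v))%E.
  move=> mh h0.
  apply: (measurable_integral_r (power_probability sigma M.+1)
    (fun s v => h (endpoint t' s v))) => //.
  by apply: (measurableT_comp mh); apply: measurable_endpoint; mfun.
elim: N t g => [|N IH] t g t0 mg g0.
  (* With no change of direction the measure on times is a point mass at the empty tuple, and the
     default value of [interval_length] is t. *)
  pose F (s : 0.-tuple R) : \bar R := ((simplex_weight t s)%:E *
     \int[power_probability sigma 1]_v g (endpoint t s v))%E.
  have mF : measurable_fun setT F.
    by apply: emeasurable_funM; [apply/measurable_EFinP; exact: msw|exact: mS].
  transitivity (F [tuple]); first by rewrite /= integral_dirac// diracT mul1e.
  rewrite /F integral_power_probabilityS//; last first.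
    by apply: (measurableT_comp mg); apply: measurable_endpoint; mfun.
  congr (_%:E * _)%E.
    rewrite /simplex_weight big_ord_recl big_ord0 mulr1 indicE mem_set ?mulr1.
      by rewrite /interval_length /= big_ord0 subr0.
    by split; [case|rewrite big_ord0].
  apply: eq_integral => v _; rewrite /= integral_dirac//; last first.
    apply: (measurableT_comp mg); apply: measurable_endpoint; first by mfun.
    by apply: (measurableT_comp (@measurable_cons_tuple _ _ _)); mfun.
  rewrite diracT mul1e; congr g; apply: eq_from_tnth => i.
  rewrite !tnth_mktuple big_ord_recl big_ord0 addr0 tnth_mktuple /=.
  by rewrite /interval_length /= big_ord0 subr0.
rewrite integral_lebesgue_vecS; last 2 first.
- by apply: emeasurable_funM; [apply/measurable_EFinP; exact: msw|exact: mS].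
- by move=> s; rewrite mule_ge0 ?lee_fin//; exact: integral_ge0.
rewrite -[RHS]/(\int[lambda]_s ((((0 < s) && (s < t))%R%:R * s `^ (a - 1))%:E *
  \int[sigma]_v flight_functional a N (t - s)%R (fun y => g (addv (scalev s v) y))))%E.
apply: eq_integral => s0 _.
set c := ((0 < s0) && (s0 < t))%R%:R * s0 `^ (a - 1).
have c0 : 0 <= c by rewrite mulr_ge0// powR_ge0.
pose h v0 y := g (addv (scalev s0 v0) y).
have mh v0 : measurable_fun setT (h v0) by rewrite /h; mfun.
have h0 v0 y : (0 <= h v0 y)%E by exact: g0.
pose B v0 (s : N.-tuple R) : \bar R := ((simplex_weight (t - s0) s)%:E *
   \int[power_probability sigma N.+1]_v h v0 (endpoint (t - s0) s v))%E.
have mI : measurable_fun setT (fun z : vec * N.-tuple R =>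
   \int[power_probability sigma N.+1]_v h z.1 (endpoint (t - s0) z.2 v))%E.
  apply: (measurable_integral_r (power_probability sigma N.+1)
    (fun (z : vec * N.-tuple R) v => h z.1 (endpoint (t - s0) z.2 v))) => //.
  apply: (measurableT_comp mg); apply: measurable_fun_addv; first by mfun.
  by apply: measurable_endpoint; mfun.
have mB : measurable_fun setT (fun z => B z.1 z.2).
  apply: emeasurable_funM => //; apply/measurable_EFinP.
  by apply: (measurableT_comp (msw N (t - s0))); mfun.
have B0 v0 s : (0 <= B v0 s)%E.
  by rewrite /B mule_ge0 ?lee_fin//; exact: integral_ge0.
transitivity (\int[leb N]_s (c%:E * \int[sigma]_v0 B v0 s))%E.
  apply: eq_integral => s _; rewrite simplex_weight_cons -/c EFinM -muleA.
  apply: mule_eqr; rewrite integral_power_probabilityS//; last first.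
    by apply: (measurableT_comp mg); apply: measurable_endpoint; mfun.
  transitivity ((simplex_weight (t - s0) s)%:E *
      \int[sigma]_v0 \int[power_probability sigma N.+1]_v h v0 (endpoint (t - s0) s v))%E.
    apply: mule_eqr; apply: eq_integral => v0 _; apply: eq_integral => v _.
    by rewrite endpoint_cons.
  rewrite mule_integral//.
  - by apply: (measurableT_comp mI (g := fun v0 => (v0, s))); mfun.
  - by move=> v0; exact: integral_ge0.
  - by rewrite lee_fin.
have mB' : measurable_fun setT (fun z : N.-tuple R * vec => B z.2 z.1).
  by apply: (measurableT_comp mB (g := fun z => (z.2, z.1))); mfun.
rewrite -mule_integral; last 3 first.
- exact: (measurable_integral_r sigma (fun s v0 => B v0 s)).
- by move=> s; exact: integral_ge0.
- by rewrite lee_fin.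
rewrite -/c; have [s00|] := boolP (0 < s0 < t); last first.
  by move=> /negbTE s00; rewrite /c s00 mul0r !mul0e.
apply: mule_eqr; rewrite (fubini_swap (m1 := leb N) (m2 := sigma) (fun s v0 => B v0 s))//.
apply: eq_integral => v0 _; rewrite -IH//.
- by rewrite subr_gt0; case/andP: s00.
- exact: mh.
Qed.

End flight_law.

Section joint_law.
Context {disp : measure_display} {Omega : measurableType disp} {R : realType}.
Variable Q : probability Omega R.

(** Independence gives the product formula on rectangles, hence the product measure; Tonelli and the
    density of [Y] then yield the iterated integral. *)
Lemma independent_joint_law d1 d2 (T1 : measurableType d1) (T2 : measurableType d2)
    (X : Omega -> T1) (Y : Omega -> T2) (lawX : probability T1 R)
    (mu : {sigma_finite_measure set T2 -> \bar R}) (f : T2 -> R) :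
  measurable_fun setT X -> measurable_fun setT Y ->
  (forall A, measurable A -> Q (X @^-1` A) = lawX A) ->
  measurable_fun setT f -> (forall y, 0 <= f y) ->
  (forall A, measurable A -> Q (Y @^-1` A) = \int[mu]_(y in A) (f y)%:E)%E ->
  independent Q X Y ->
  forall E, measurable E ->
  Q ((fun w => (X w, Y w)) @^-1` E) =
  (\int[mu]_y ((f y)%:E * \int[lawX]_x (\1_E (x, y))%:E))%E.
Proof.
move=> mX mY lawXE mf f0 lawYE XY E mE.
have mXY : measurable_fun setT (fun w => (X w, Y w)) by exact: measurable_fun_pair.
pose Ym : {mfun Omega >-> T2} := HB.pack Y (isMeasurableFun.Build _ _ _ _ Y mY).
pose lawY : probability T2 R := distribution Q Ym.
have lawYmu A : measurable A -> lawY A = (\int[mu]_(y in A) (f y)%:E)%E by exact: lawYE.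
transitivity (product_measure1 lawX lawY E).
  apply/esym; apply: (@product_measure_unique _ _ _ _ _ _ _ (image_measure Q mXY)) => //.
  move=> A B mA mB; transitivity (Q (X @^-1` A `&` Y @^-1` B)); first by [].
  by rewrite XY// lawXE.
have m1 : measurable_fun setT (\1_E : T1 * T2 -> R) by exact: measurable_indic.
transitivity (\int[product_measure1 lawX lawY]_z (\1_E z)%:E)%E.
  by rewrite integral_indic// setIT.
rewrite (fubini_tonelli2 (m1 := lawX) (m2 := lawY) (fun z => (\1_E z)%:E)); last 2 first.
- exact/measurable_EFinP.
- by move=> z; rewrite lee_fin.
rewrite (density_integral (mu := mu) (f := f))//.
- apply: (measurable_fun_fubini_tonelli_G (m1 := lawX) (fun z => (\1_E z)%:E)).
    exact/measurable_EFinP.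
  by move=> z; rewrite lee_fin.
- by move=> y; apply: integral_ge0 => x _; rewrite lee_fin.
Qed.

Lemma directions_law n N (V : nat -> Omega -> n.+2.-tuple R) :
  (forall k, measurable_fun setT (V k)) ->
  (forall k : 'I_N, uniform_on_sphere Q (V k)) ->
  mutually_independent Q (fun k : 'I_N => V k) ->
  forall A, measurable A ->
  Q ((fun w => [tuple V k w | k < N]) @^-1` A) =
  power_probability (@uniform_sphere R n.+1) N A.
Proof.
move=> mV VU VI.
have mD : measurable_fun setT (fun w => [tuple V k w | k < N]).
  apply/measurable_fun_tnthP => i.
  rewrite (_ : _ \o _ = V i); first exact: mV.
  by apply/funext => w /=; rewrite tnth_mktuple.
apply: (box_measure_unique (m1 := image_measure Q mD)).
  rewrite (_ : image_measure Q mD setT = 1%:E) ?ltry//.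
  exact: (@probability_setT _ _ _ Q).
move=> B mB.
transitivity (\prod_(i < N) @uniform_sphere R n.+1 (B i))%E; last first.
  by apply/esym; exact: power_probability_box.
transitivity (Q [set w | forall i : 'I_N, B i (V i w)]).
  by congr (Q _); apply/seteqP; split => w /= H i; have := H i; rewrite tnth_mktuple.
rewrite VI//; apply: eq_bigr => i _.
by rewrite VU// sphere_lawE.
Qed.

End joint_law.

Lemma Gamma_ge0 {R : realType} (p : R) : 0 <= Gamma p.
Proof. by rewrite GammaE fine_ge0// gamma_integral_ge0. Qed.

Definition profile {R : realType} {m : nat} (T q : R) (x : m.-tuple R) : R :=
  (normv x < T)%R%:R * (T ^+ 2 - normv x ^+ 2) `^ q.

(** * Law of the position up to a constant *)

Section position_law.
Context {disp : measure_display} {Omega : measurableType disp} {R : realType} {n : nat}.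
Notation leb := (@lebesgue_vec R).
Notation vec := (n.+2.-tuple R).
Variables (P Q : probability Omega R) (h N : nat) (c t : R).
Variables (tau : nat -> {RV P >-> R}) (V : nat -> {RV P >-> vec}).
Hypotheses (c0 : 0 < c) (t0 : 0 < t).
Let a : R := n.+2%:R / h%:R - 1.
Hypothesis times_density : has_density Q (times tau N) (@dirichlet_density R n.+2 h N t).
Hypothesis directions_uniform : forall k : 'I_N.+1, uniform_on_sphere Q (V k).
Hypothesis directions_independent :
  mutually_independent Q (fun k : 'I_N.+1 => (V k : Omega -> vec)).
Hypothesis times_independent : independent Q (directions V N.+1) (times tau N).
Variables (e q : R).
Hypothesis radial : @radial_law R n a N e q.

(** The random number of changes is replaced by the fixed [N]; the two positions agree on the
    conditioning event. *)
Definition position_after (w : Omega) : vec :=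
  scalev c (sumv N.+1 (fun k => scalev (interval_length t (times tau N w) k) (V k w))).

Lemma position_afterE w :
  position_after w = scalev c (endpoint t (times tau N w) (directions V N.+1 w)).
Proof.
congr (scalev _ _); apply: eq_from_tnth => i; rewrite !tnth_mktuple.
apply: eq_bigr => k _; rewrite !tnth_mktuple; congr (_ * tnth _ _).
by rewrite -tnth_nth tnth_mktuple.
Qed.

Lemma position_law_up_to_constant : exists2 K : \bar R, (0 <= K)%E &
  forall A, measurable A -> (Q (position_after @^-1` A) =
    K * \int[leb n.+2]_x ((profile (c * t) q x)%:E * (\1_A x)%:E))%E.
Proof.
have [mT mf f0 TE] := times_density.
have mD : measurable_fun setT (directions V N.+1).
  apply/measurable_fun_tnthP => i.
  rewrite (_ : _ \o _ = V i); first exact: measurable_funP.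
  by apply/funext => w /=; rewrite tnth_mktuple.
have DE := directions_law (fun k => measurable_funP (V k)) directions_uniform directions_independent.
have [K K0 KE] := radial.
set m : R := n.+1%:R + 1.
pose C : R := Gamma (N.+1%:R * a) / Gamma a ^+ N.+1 * (t `^ (N.+1%:R * a - 1))^-1.
have C0 : 0 <= C.
  by rewrite mulr_ge0 ?invr_ge0 ?powR_ge0// mulr_ge0 ?invr_ge0 ?exprn_ge0 ?Gamma_ge0.
have fE (s : N.-tuple R) : dirichlet_density n.+2 h t s = C * simplex_weight a t s :> R.
  rewrite /dirichlet_density /simplex_weight -/a mulrA; congr (_ * _ * _).
  by apply: eq_bigr => k _; congr (_ `^ _); rewrite /a; ring.
pose c2 : R := (c ^+ 2) `^ q.
have c20 : 0 < c2 by rewrite powR_gt0// exprn_gt0.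
(* [C] is the Dirichlet constant and K t^e the factor of the radial law; c^(-2q) and c^(-d) come
   from the dilation by the speed c. *)
exists (C%:E * (K * (t `^ e)%:E * (c2^-1 * (c ^+ n.+2)^-1)%:E))%E.
  by rewrite mule_ge0 ?lee_fin// !mule_ge0 ?lee_fin ?powR_ge0// mulr_ge0// invr_ge0 ?exprn_ge0// ltW.
move=> A mA.
have mA' : measurable_fun setT (\1_A : vec -> R) by exact: measurable_indic.
pose g x : \bar R := (\1_A (scalev c x))%:E.
have mg : measurable_fun setT g.
  by apply/measurable_EFinP; apply: (measurableT_comp mA'); mfun.
have g0 x : (0 <= g x)%E by rewrite lee_fin.
pose E : set (N.+1.-tuple vec * N.-tuple R) := [set z | A (scalev c (endpoint t z.2 z.1))].
have mE : measurable E.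
  rewrite (_ : E = (fun z => scalev c (endpoint t z.2 z.1)) @^-1` A)//.
  rewrite -[X in measurable X]setTI; apply: measurable_fun_scalev => //.
  by apply: measurable_endpoint; mfun.
have -> : position_after @^-1` A = (fun w => (directions V N.+1 w, times tau N w)) @^-1` E.
  by apply/seteqP; split => w; rewrite /E /= position_afterE.
rewrite (independent_joint_law mD mT DE mf f0 TE times_independent mE).
transitivity (C%:E * \int[leb N]_s ((simplex_weight a t s)%:E *
     \int[power_probability uniform_sphere N.+1]_v g (endpoint t s v)))%E.
  rewrite mule_integral//; last 2 first.
  - apply: emeasurable_funM; first by apply/measurable_EFinP; exact: (@measurable_simplex_weight R a N t).
    apply: (measurable_integral_r (power_probability uniform_sphere N.+1) (fun s v => g (endpoint t s v))) => //.
    by apply: (measurableT_comp mg); apply: measurable_endpoint; mfun.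
  - by move=> s; rewrite mule_ge0 ?lee_fin ?simplex_weight_ge0//; exact: integral_ge0.
  apply: eq_integral => s _; rewrite fE EFinM -muleA.
  by [].
rewrite flight_functional_integral// KE// -!muleA; apply: mule_eqr; apply: mule_eqr; apply: mule_eqr.
pose H x : \bar R := ((profile (c * t) q x)%:E * (\1_A x)%:E)%E.
have mH : measurable_fun setT H by rewrite /H /profile; mfun; exact/measurable_EFinP.
have H0 x : (0 <= H x)%E by rewrite /H /profile mule_ge0// lee_fin mulr_ge0// powR_ge0.
rewrite EFinM -muleA -(lebesgue_vec_scale c0 mH H0) mule_integral//; last 2 first.
- by apply: (measurableT_comp mH); mfun.
- by rewrite lee_fin invr_ge0 ltW.
apply: eq_integral => x _; rewrite /H /g muleA -(EFinM c2^-1); congr (_%:E * _)%E.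
rewrite /profile normv_scale gtr0_norm// ltr_pM2l//.
have [xt|_] := ltP (normv x) t; last by rewrite !mul0r mulr0.
rewrite !mul1r (_ : (c * t) ^+ 2 - _ = c ^+ 2 * (t ^+ 2 - normv x ^+ 2)); last by ring.
rewrite powRM ?sqr_ge0//; last by rewrite ltW// power_difference_gt0.
by rewrite mulKf// gt_eqF.
Qed.

End position_law.

(** * Inversion and the reflected flight *)

Section inversion_change_of_variable.
Context {R : realType} {n : nat}.
Notation lambda := (@lebesgue_measure R).
Notation leb := (@lebesgue_vec R).
Notation vec := (n.+1.-tuple R).
Notation sigma := (@uniform_sphere R n).

Lemma lebesgue_vec_sphere (r : R) : leb n.+1 [set x | normv x = r] = 0%E.
Proof.
pose b (y : vec) : R := ((normv y <= r) && (r <= normv y))%R%:R.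
have mb : measurable_fun setT b by rewrite /b; mfun.
have bE : [set x : vec | normv x = r] = [set x | (normv x <= r) && (r <= normv x)].
  by apply/seteqP; split => x /=; [move=> ->; rewrite lexx|rewrite -eq_le => /eqP].
have mS : measurable [set x : vec | normv x = r].
  by rewrite bE; apply: (@measurable_bool _ _ R).
have -> : leb n.+1 [set x | normv x = r] = (\int[leb n.+1]_y (b y)%:E)%E.
  rewrite -[X in lebesgue_vec _ X]setIT -integral_indic//.
  by apply: eq_integral => y _; rewrite /b bE indicE mem_setE.
rewrite polar_coordinates; last 2 first.
- by mfun.
- by move=> y; rewrite lee_fin.
rewrite (@ge0_negligible_integral _ (measurableTypeR R) R lambda setT [set r])//; last 3 first.
- apply: emeasurable_funM; first by mfun.
  apply: (measurable_integral_r sigma (fun s v => (b (scalev s v))%:E)); first by mfun.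
  by move=> s v; rewrite lee_fin.
- move=> s _; apply: mule_ge0; last by apply: integral_ge0 => v _; rewrite lee_fin.
  by rewrite lee_fin; case: ltP => [s0|_]; rewrite ?mul0r// mul1r exprn_ge0// ltW.
- exact: lebesgue_measure_set1.
rewrite setTD integral0_eq ?mule0// => s /= sr.
have [s0|_] := ltP 0 s; last by rewrite mul0r mul0e.
rewrite (ae_uniform_sphere (g2 := fun=> 0%E)) ?integral0 ?mule0//.
- by mfun.
- by move=> v; rewrite lee_fin.
- move=> v v1; rewrite /b normv_scale v1 mulr1 gtr0_norm// -eq_le.
  by case: eqP.
Qed.

(** Spheres are null, which absorbs all discrepancies between strict and large inequalities at the
    boundaries of balls and shells. *)
Lemma eq_integral_off_spheres (r1 r2 : R) (f g : vec -> \bar R) :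
  measurable_fun setT f -> (forall x, (0 <= f x)%E) ->
  measurable_fun setT g -> (forall x, (0 <= g x)%E) ->
  (forall x, normv x != r1 -> normv x != r2 -> f x = g x) ->
  (\int[leb n.+1]_x f x = \int[leb n.+1]_x g x)%E.
Proof.
move=> mf f0 mg g0 fg.
pose S := [set x : vec | normv x = r1] `|` [set x | normv x = r2].
have mS r : measurable [set x : vec | normv x = r].
  rewrite (_ : [set x | _] = [set x | (normv x <= r) && (r <= normv x)]).
    by apply: (@measurable_bool _ _ R); mfun.
  by apply/seteqP; split => x /=; [move=> ->; rewrite lexx|rewrite -eq_le => /eqP].
have S0 : leb n.+1 S = 0%E.
  rewrite measureU0//; exact: lebesgue_vec_sphere.
rewrite [LHS](@ge0_negligible_integral _ _ _ _ setT S)//; last exact: measurableU.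
rewrite [RHS](@ge0_negligible_integral _ _ _ _ setT S)//; last exact: measurableU.
rewrite setTD; apply: eq_integral => x; rewrite inE /S /= => /not_orP[x1 x2].
by apply: fg; apply/eqP.
Qed.

Lemma integral_inversion_1d (r T : R) (phi : R -> \bar R) : 0 < r -> r < T ->
  measurable_fun setT phi -> (forall u, (0 <= phi u)%E) ->
  (\int[lambda]_s ((((r < s) && (s <= T))%R%:R * s ^+ n)%:E * phi (r ^+ 2 / s)%R) =
   \int[lambda]_u ((((r ^+ 2 / T <= u) && (u < r))%R%:R *
     (r ^+ (2 * n.+1) * (u ^+ n.+2)^-1))%:E * phi u))%E.
Proof.
move=> r0 rT mphi phi0; have T0 : 0 < T by exact: lt_trans rT.
(* The map s |-> r^2/s is decreasing, so its opposite is used with the increasing change of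
   variable, and the sign is undone by [lebesgue_opp]. *)
pose F (s : R) : R := - r ^+ 2 * s^-1.
pose f (s : R) := r ^+ 2 / s ^+ 2.
pose G (w : R) : \bar R := ((((- r < w) && (w <= - (r ^+ 2 / T)))%R%:R * (r ^+ (2 * n.+1) * (`|w| ^+ n.+2)^-1))%:E * phi (- w)%R)%E.
have mG : measurable_fun setT G.
  apply: emeasurable_funM; first by mfun.
  by apply: (measurableT_comp mphi); mfun.
have G0 w : (0 <= G w)%E by rewrite /G; pos.
have Fr : F r = - r by rewrite /F; field; rewrite gt_eqF.
have FT : F T = - (r ^+ 2 / T) by rewrite /F mulNr.
transitivity (\int[lambda]_(s in `]r, T]) ((f s)%:E * G (F s)))%E.
  rewrite [RHS]integral_indicl; apply: eq_integral => s _.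
  rewrite indicE mem_setE in_itv/=.
  have [/andP[rs sT]|_] := boolP (r < s <= T); last by rewrite mul0r !mul0e.
  have s0 : 0 < s by exact: lt_trans rs.
  rewrite mul1r mul1e /G.
  have -> : - r < F s.
    by rewrite /F mulNr ltrN2 ltr_pdivrMr// expr2 ltr_pM2l.
  have -> : F s <= - (r ^+ 2 / T).
    by rewrite /F mulNr lerN2 ler_wpM2l ?sqr_ge0// lef_pV2// posrE.
  rewrite mul1r muleA -EFinM /F mulNr opprK normrN gtr0_norm ?divr_gt0 ?exprn_gt0//.
  congr (_%:E * _)%E; rewrite /f.
  have -> : r ^+ (2 * n.+1) = (r ^+ n) ^+ 2 * r ^+ 2 by rewrite -exprM -exprD mulnC mulSn addnC.
  have -> : (r ^+ 2 / s) ^+ n.+2 = (r ^+ n) ^+ 2 * (r ^+ 2) ^+ 2 / (s ^+ n * s ^+ 2).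
    by rewrite exprMn exprVn -[n.+2]addn2 !exprD (exprAC _ n).
  by field; rewrite !gt_eqF ?exprn_gt0.
have mF : measurable_fun setT F.
  apply: measurable_funM; first exact: measurable_cst.
  exact: (measurable_fun_inv (f := fun s => s)).
have mf : measurable_fun setT f by rewrite /f; mfun.
have dF (s : R) : r <= s <= T -> is_derive s 1 F (f s).
  move=> /andP[rs _]; have s0 : s != 0 by rewrite gt_eqF// (lt_le_trans r0).
  have dV := is_deriveV (f := @id R) s0 (is_derive_id s 1).
  have -> : F = (- r ^+ 2) \*: (GRing.inv : R -> R).
    by apply/funext => y; rewrite /F.
  apply: is_derive_eq; rewrite /f /GRing.scale/=.
  by field.
have cf (s : R) : r <= s <= T -> {for s, continuous f}.
  move=> /andP[rs _]; have s0 : s != 0 by rewrite gt_eqF// (lt_le_trans r0).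
  apply: cvgM; first exact: cvg_cst.
  by apply: cvgV; [rewrite expf_neq0|exact: exprn_continuous].
have f0 (s : R) : r <= s <= T -> 0 < f s.
  move=> /andP[rs _]; have s0 : 0 < s by exact: lt_le_trans rs.
  by rewrite /f divr_gt0 ?exprn_gt0.
rewrite (change_of_variable_C1 (ltW rT) mF mf dF cf f0 mG G0).
rewrite Fr FT [LHS]integral_indicl -[LHS]lebesgue_opp; last 2 first.
- by apply: emeasurable_funM => //; apply/measurable_EFinP; exact: measurable_indic.
- by move=> w; rewrite mule_ge0// lee_fin.
apply: eq_integral => u _; rewrite indicE mem_setE in_itv/= ltrN2 lerN2 andbC.
rewrite /G ltrN2 lerN2 andbC normrN opprK.
have [/andP[ru ur]|_] := boolP (_ && _); last by rewrite !mul0r !mul0e.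
rewrite !mul1e gtr0_norm//; apply: lt_le_trans ur.
by rewrite divr_gt0 ?exprn_gt0.
Qed.

Lemma inversion_scale (r s : R) (v : vec) : 0 < s -> normv v = 1 ->
  inversion r (scalev s v) = scalev (r ^+ 2 / s) v.
Proof.
move=> s0 v1; rewrite /inversion normv_scale v1 mulr1 gtr0_norm// scalevA.
by congr (scalev _ _); field; rewrite gt_eqF.
Qed.

Lemma normv_inversion (r : R) (x : vec) : 0 < normv x ->
  normv (inversion r x) = r ^+ 2 / normv x.
Proof.
move=> x0; rewrite /inversion normv_scale ger0_norm ?divr_ge0 ?sqr_ge0//.
by field; rewrite gt_eqF.
Qed.

Lemma inversionK (r : R) (x : vec) : r != 0 -> 0 < normv x ->
  inversion r (inversion r x) = x.
Proof.
move=> r0 x0; rewrite {1}/inversion normv_inversion// /inversion scalevA.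
rewrite -[RHS]scale1v; congr (scalev _ _); field.
by rewrite r0 gt_eqF.
Qed.

Lemma measurable_inversion (r : R) : measurable_fun setT (@inversion R n.+1 r).
Proof. by rewrite /inversion; mfun. Qed.

(** Inversion acts on the radius alone, so polar coordinates reduce it to u = r^2/s; the weight
    (r/|y|)^(2d), with d = n + 1, is its Jacobian. *)
Lemma integral_inversion (r T : R) (g : vec -> \bar R) : 0 < r -> r < T ->
  measurable_fun setT g -> (forall x, (0 <= g x)%E) ->
  (\int[leb n.+1]_x ((((r < normv x) && (normv x <= T))%R%:R)%:E * g (inversion r x)) =
   \int[leb n.+1]_y ((((r ^+ 2 / T <= normv y) && (normv y < r))%R%:R *
      (r ^+ (2 * n.+1) / normv y ^+ (2 * n.+1)))%:E * g y))%E.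
Proof.
move=> r0 rT mg g0; have T0 : 0 < T by exact: lt_trans rT.
have minv := measurable_inversion r.
have mphi : measurable_fun setT (fun s => \int[sigma]_v g (scalev s v))%E.
  by apply: (measurable_integral_r sigma (fun s v => g (scalev s v))) => //; mfun.
rewrite polar_coordinates; last 2 first.
- by apply: emeasurable_funM; [mfun|exact: measurableT_comp].
- by pos.
rewrite [RHS]polar_coordinates; last 2 first.
- by mfun.
- by pos.
apply: mule_eqr.
transitivity (\int[lambda]_s ((((r < s) && (s <= T))%R%:R * s ^+ n)%:E *
    \int[sigma]_v g (scalev (r ^+ 2 / s) v)))%E.
  apply: eq_integral => s _; have [s0|s0] := ltP 0 s; last first.
    by rewrite mul0r mul0e (ltNge r) (le_trans s0 (ltW r0)) /= mul0r mul0e.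
  rewrite mul1r mulrC EFinM -muleA; apply: mule_eqr.
  rewrite mule_integral; sides.
  apply: ae_uniform_sphere.
  - by apply: emeasurable_funM; [mfun|apply: (measurableT_comp mg); apply: (measurableT_comp minv); mfun].
  - by pos.
  - by mfun.
  - by pos.
  by move=> v v1; rewrite normv_scale v1 mulr1 gtr0_norm// inversion_scale.
rewrite (integral_inversion_1d r0 rT mphi); last first.
  by move=> s; exact: integral_ge0.
apply: eq_integral => s _; have [s0|s0] := ltP 0 s; last first.
  rewrite mul0r mul0e (leNgt (_ / T)) (le_lt_trans s0) ?mul0r ?mul0e//.
  by rewrite divr_gt0 ?exprn_gt0.
rewrite mul1r mule_integral; sides.
rewrite mule_integral; sides.
apply: ae_uniform_sphere.
- by mfun.
- by pos.
- by mfun.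
- by pos.
move=> v v1; rewrite normv_scale v1 mulr1 gtr0_norm// muleA -EFinM; congr (_%:E * _)%E.
have -> : s ^+ (2 * n.+1) = s ^+ n * s ^+ n.+2.
  by rewrite -exprD; congr (_ ^+ _); rewrite addnS addnS addnn -mul2n mulnS.
by field; rewrite !expf_neq0 ?gt_eqF.
Qed.

End inversion_change_of_variable.

Section reflection_law.
Context {R : realType} {n : nat}.
Notation leb := (@lebesgue_vec R).
Notation vec := (n.+2.-tuple R).
Variables (r T q : R).
Hypotheses (r0 : 0 < r) (rT : r < T).

(** On the sphere of radius [r] and beyond radius [T] both indicators vanish and the value is the
    origin; the former set is null and [profile T q] is 0 on the latter. *)
Definition reflect_outside (x : vec) : vec :=
  addv (scalev (\1_(centered_ball r) x) x)
       (scalev (\1_(shell r T) x) (inversion r x)).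

Lemma measurable_shell (r1 r2 : R) : measurable (shell r1 r2 : set vec).
Proof. by apply: (@measurable_bool _ _ R); mfun. Qed.

Lemma measurable_reflect_outside : measurable_fun setT reflect_outside.
Proof.
have minv := @measurable_inversion R n.+1 r.
have m1 : measurable_fun setT (\1_(centered_ball r) : vec -> R).
  by apply: measurable_indic; exact: measurable_ball.
have m2 : measurable_fun setT (\1_(shell r T) : vec -> R).
  by apply: measurable_indic; exact: measurable_shell.
by rewrite /reflect_outside; mfun.
Qed.

Lemma reflect_outside_ball (x : vec) : normv x < r -> reflect_outside x = x.
Proof.
move=> xr; rewrite /reflect_outside !indicE mem_set// memNset ?scale1v ?scale0v.
  by rewrite addvC add0v.
by rewrite /shell /= ltNge (ltW xr).
Qed.

Lemma reflect_outside_shell (x : vec) : r < normv x -> normv x <= T ->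
  reflect_outside x = inversion r x.
Proof.
move=> rx xT; rewrite /reflect_outside !indicE memNset ?scale0v ?add0v; last first.
  by rewrite /centered_ball /= ltNge (ltW rx).
by rewrite mem_set ?scale1v// /shell /= rx xT.
Qed.

Definition reflected_profile (x : vec) : R :=
  (T ^+ 2 - normv x ^+ 2) `^ q * \1_(centered_ball r) x +
  r ^+ (2 * n.+2) / normv x ^+ (2 * n.+2) *
    (T ^+ 2 - r ^+ 4 / normv x ^+ 2) `^ q * \1_(shell (r ^+ 2 / T) r) x.

Lemma measurable_reflected_profile : measurable_fun setT reflected_profile.
Proof.
have m1 : measurable_fun setT (\1_(centered_ball r) : vec -> R).
  by apply: measurable_indic; exact: measurable_ball.
have m2 : measurable_fun setT (\1_(shell (r ^+ 2 / T) r) : vec -> R).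
  by apply: measurable_indic; exact: measurable_shell.
by rewrite /reflected_profile; mfun.
Qed.

Lemma reflected_profile_ge0 x : 0 <= reflected_profile x.
Proof. rewrite /reflected_profile; pos; exact: ltW. Qed.

(** The integral splits at radius r. As inversion is an involution, the outer part is a function of
    the inverted point and [integral_inversion] transports it inside. *)
Lemma integral_reflected (g : vec -> \bar R) :
  measurable_fun setT g -> (forall x, (0 <= g x)%E) ->
  (\int[leb n.+2]_x ((profile T q x)%:E * g (reflect_outside x)) =
   \int[leb n.+2]_x ((reflected_profile x)%:E * g x))%E.
Proof.
move=> mg g0; have T0 : 0 < T by exact: lt_trans rT.
have mrefl := measurable_reflect_outside; have minv := @measurable_inversion R n.+1 r.
have mp : measurable_fun setT (profile T q : vec -> R) by rewrite /profile; mfun.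
have p0 (x : vec) : 0 <= profile T q x by rewrite /profile; pos.
pose inside (x : vec) : \bar R := (((normv x < r)%R%:R * (T ^+ 2 - normv x ^+ 2) `^ q)%:E * g x)%E.
pose out (y : vec) : \bar R := ((profile T q (inversion r y))%:E * g y)%E.
have minside : measurable_fun setT inside by rewrite /inside; mfun.
have inside0 (x : vec) : (0 <= inside x)%E by rewrite /inside mule_ge0// lee_fin mulr_ge0// powR_ge0.
have mout : measurable_fun setT out.
  apply: emeasurable_funM => //; apply/measurable_EFinP.
  exact: (measurableT_comp mp minv).
have out0 (x : vec) : (0 <= out x)%E by rewrite /out mule_ge0// lee_fin.
have insideE (x : vec) : inside x =
  (((normv x < r)%R%:R * (T ^+ 2 - normv x ^+ 2) `^ q)%:E * g x)%E by [].
have outE (y : vec) : out y = ((profile T q (inversion r y))%:E * g y)%E.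
  by reflexivity.
clearbody inside out.
transitivity (\int[leb n.+2]_x (inside x +
   (((r < normv x) && (normv x <= T))%R%:R)%:E * out (inversion r x)))%E.
  apply: (@eq_integral_off_spheres _ _ r r).
  - by mfun.
  - by move=> x; rewrite mule_ge0// lee_fin.
  - by mfun.
  - by move=> x; rewrite adde_ge0// mule_ge0// lee_fin.
  move=> x xr _; have [x_lt|x_gt|/eqP] := ltgtP (normv x) r; last by rewrite (negbTE xr).
    rewrite reflect_outside_ball// mul0e adde0 insideE /profile.
    by rewrite x_lt (lt_trans x_lt rT).
  rewrite insideE ltNge (ltW x_gt) mul0r mul0e add0e outE.
  have x0 : 0 < normv x by exact: lt_trans x_gt.
  rewrite inversionK ?gt_eqF//.
  have [xT|Tx] := leP (normv x) T.
    by rewrite reflect_outside_shell// mul1e.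
  by rewrite /profile ltNge (ltW Tx) !mul0r !mul0e.
have ratio0 (x : vec) : 0 <= r ^+ (2 * n.+2) / normv x ^+ (2 * n.+2).
  by rewrite divr_ge0 ?exprn_ge0 ?normv_ge0 ?ltW.
rewrite ge0_integralD//; last 2 first.
- by move=> x _; rewrite mule_ge0// lee_fin.
- by mfun.
rewrite integral_inversion// -ge0_integralD//; last 2 first.
- by move=> x _; rewrite mule_ge0// lee_fin mulr_ge0.
- by mfun.
(* The shell coming from the inversion contains radius r^2/T and not r, the one in
   [reflected_profile] the opposite; both spheres are discarded. *)
apply: (@eq_integral_off_spheres _ _ r (r ^+ 2 / T)).
- by mfun.
- by move=> x; rewrite adde_ge0// mule_ge0// lee_fin mulr_ge0.
- apply: emeasurable_funM => //; apply/measurable_EFinP.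
  exact: measurable_reflected_profile.
- by move=> x; rewrite mule_ge0// lee_fin reflected_profile_ge0.
move=> x xr xr'; rewrite insideE outE muleA -(EFinM ((_ && _)%:R * _)).
apply/esym; rewrite (_ : reflected_profile x =
   (normv x < r)%R%:R * (T ^+ 2 - normv x ^+ 2) `^ q +
   ((r ^+ 2 / T <= normv x) && (normv x < r))%R%:R *
    (r ^+ (2 * n.+2) / normv x ^+ (2 * n.+2)) * profile T q (inversion r x)).
  rewrite EFinD ge0_muleDl// lee_fin; first by rewrite mulr_ge0// powR_ge0.
  by rewrite mulr_ge0// mulr_ge0.
rewrite /reflected_profile !indicE.
have -> : (x \in centered_ball r) = (normv x < r) by rewrite mem_setE.
have -> : (x \in shell (r ^+ 2 / T) r) = (r ^+ 2 / T < normv x) && (normv x <= r).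
  by rewrite mem_setE.
have -> : (r ^+ 2 / T <= normv x) = (r ^+ 2 / T < normv x).
  by rewrite le_eqVlt eq_sym (negbTE xr').
have -> : (normv x <= r) = (normv x < r) by rewrite le_eqVlt (negbTE xr).
rewrite [(_ `^ q * _)%R]mulrC; congr (_ + _).
have [rx|_] /= := ltP (r ^+ 2 / T) (normv x); last by rewrite mulr0 !mul0r.
have x0 : 0 < normv x by apply: lt_trans rx; rewrite divr_gt0 ?exprn_gt0.
rewrite /profile normv_inversion// ltr_pdivrMr// [T * _]mulrC -ltr_pdivrMr// rx.
have -> : (r ^+ 2 / normv x) ^+ 2 = r ^+ 4 / normv x ^+ 2 by rewrite expr_div_n -exprM.
by rewrite [(true%:R * _)%R]mul1r [LHS]mulrC; exact: mulrA.
Qed.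

End reflection_law.

(** Settles the unknown constant: as 0 times infinity is 0, a product equal to 1 forces both
    nonnegative factors to be finite and positive. *)
Lemma mule_eq1 {R : realType} (x y : \bar R) : (0 <= x)%E -> (0 <= y)%E ->
  (x * y = 1)%E -> exists2 r : R, 0 < r & y = r%:E /\ x = (r^-1)%:E.
Proof.
case: x => [x||] //; case: y => [y||] // => x0 y0.
- rewrite -EFinM => -[xy]; exists y.
    rewrite lt_neqAle -lee_fin y0 andbT; apply/eqP => y00.
    by move: xy; rewrite -y00 mulr0 => /eqP; rewrite eq_sym oner_eq0.
  split => //; congr EFin; have y_neq0 : y != 0.
    by apply/eqP => y00; move: xy; rewrite y00 mulr0 => /eqP; rewrite eq_sym oner_eq0.
  by rewrite -[x]mulr1 -(mulfV y_neq0) mulrA xy mul1r.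
- rewrite mulry; move: x0; rewrite lee_fin le_eqVlt => /predU1P[<-|x0].
    by rewrite sgr0 mul0e => -[/eqP]; rewrite eq_sym oner_eq0.
  by rewrite gtr0_sg// mul1e.
- rewrite mulyr; move: y0; rewrite lee_fin le_eqVlt => /predU1P[<-|y0].
    by rewrite sgr0 mul0e => -[/eqP]; rewrite eq_sym oner_eq0.
  by rewrite gtr0_sg// mul1e.
Qed.

(** * Measurability of the position and the conditioning event *)

Section measurable_position.
Context {disp : measure_display} {Omega : measurableType disp} {R : realType}.

(** Preimages split along the countably many values of [N]. *)
Lemma measurable_fun_nat_index d (T : measurableType d) (N : Omega -> nat)
    (f : nat -> Omega -> T) :
  measurable_fun setT N -> (forall k, measurable_fun setT (f k)) ->
  measurable_fun setT (fun w => f (N w) w).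
Proof.
move=> mN mf _ A mA; rewrite setTI.
rewrite (_ : _ @^-1` A = \bigcup_k (N @^-1` [set k] `&` f k @^-1` A)).
  apply: bigcup_measurable => k _; apply: measurableI.
    by rewrite -[X in measurable X]setTI; exact: mN.
  by rewrite -[X in measurable X]setTI; exact: mf.
apply/seteqP; split => w /=; first by move=> Aw; exists (N w).
by move=> [k _ [/= ->]].
Qed.

Lemma cond_prob_eq (P : probability Omega R) (N : {RV P >-> nat}) n A B :
  P (N @^-1` [set n]) != 0%E ->
  A `&` N @^-1` [set n] = B `&` N @^-1` [set n] ->
  cond_prob P N n A = cond_prob P N n B.
Proof. by move=> PN0 AB; rewrite !cond_probE// AB. Qed.

Lemma measurable_position_after n (P : probability Omega R) (c t : R)
    (tau : nat -> {RV P >-> R}) (V : nat -> {RV P >-> n.+2.-tuple R}) N :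
  measurable_fun setT (position_after N c t tau V).
Proof.
rewrite (_ : position_after _ _ _ _ _ = fun w =>
  scalev c (endpoint t (times tau N w) (directions V N.+1 w))).
  apply: measurable_fun_scalev => //; apply: measurable_endpoint.
    apply: measurable_tuple => i; under eq_fun do rewrite tnth_mktuple.
    exact: measurable_funP.
  apply/measurable_fun_tnthP => i.
  rewrite (_ : _ \o _ = V i); first exact: measurable_funP.
  by apply/funext => w /=; rewrite tnth_mktuple.
by apply/funext => w; rewrite position_afterE.
Qed.

End measurable_position.

Theorem mainTheorem4 (R : realType) (disp : measure_display)
    (Omega : measurableType disp) (P : probability Omega R)
    (h d n : nat) (c rad t : R)
    (N : {RV P >-> nat}) (tau : nat -> {RV P >-> R})
    (V : nat -> {RV P >-> d.-tuple R}) :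
  (h = 1%N /\ (2 <= d)%N) \/ (h = 2%N /\ (3 <= d)%N) ->
  (1 <= n)%N -> 0 < c -> 0 < rad -> rad / c < t ->
  random_flight h t N tau V ->
  P (N @^-1` [set n]) != 0%E ->
  has_density (cond_prob P N n) (reflected_position c rad t N tau V)
    (fun x : d.-tuple R =>
      Gamma (n.+1%:R / 2 * (d%:R - h%:R) + h%:R / 2)
        / Gamma (n%:R / 2 * (d%:R - h%:R))
      * (pi `^ (d%:R / 2)
         * (c * t) `^ (n.+1%:R * (d%:R - h%:R) + h%:R - 2))^-1
      * ((c ^+ 2 * t ^+ 2 - normv x ^+ 2) `^ (n%:R / 2 * (d%:R - h%:R) - 1)
           * \1_(centered_ball rad) x
         + rad ^+ (2 * d) / normv x ^+ (2 * d)
           * (c ^+ 2 * t ^+ 2 - rad ^+ 4 / normv x ^+ 2)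
               `^ (n%:R / 2 * (d%:R - h%:R) - 1)
           * \1_(shell (rad ^+ 2 / (c * t)) rad) x)).
Proof.
move=> hd n1 c0 r0 rct flight PN0.
have [m dm] : exists m, d = m.+2.
  by case: hd => -[_]; case: d V flight => [|[|m]] // *; exists m.
subst d.
have t0 : 0 < t by apply: lt_trans rct; rewrite divr_gt0.
have rT : rad < c * t by rewrite mulrC -ltr_pdivrMr.
have T0 : 0 < c * t by rewrite mulr_gt0.
set p : R := n%:R / 2 * (m.+2%:R - h%:R).
(* The power of t depends on h, but at fixed t it only enters the constant, so its exponent can stay
   existential. *)
have [e radial] : exists e, @radial_law R m (m.+2%:R / h%:R - 1) n e (p - 1).
  case: hd => -[hE dE]; rewrite /p hE.
    exists 0; rewrite divr1 (_ : m.+2%:R - 1 = m.+1%:R); last first.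
      by rewrite -[m.+2]addn1 natrD addrK.
    rewrite (_ : n%:R / 2 * m.+1%:R = n%:R * (m.+1%:R / 2)); last by field.
    exact: radial_law1.
  exists (- (n.+1%:R * (m%:R / 2)) - 1).
  have E : m.+2%:R - 2 = m%:R :> R by rewrite -[m.+2]addn2 natrD addrK.
  rewrite (_ : m.+2%:R / 2 - 1 = m%:R / 2 :> R); last by rewrite -E; field.
  rewrite E (_ : n%:R / 2 * m%:R = n%:R * (m%:R / 2)); last by field.
  by apply: radial_law2.
(* k + 1 = n (d - h) + d - 2 is positive, so p + d/2 is a point where [gamma_integral_half] gives a
   finite positive value. *)
have [k kE] : exists k : nat, p + m.+2%:R / 2 = 1 + k.+1%:R / 2.
  exists (n * (m.+2 - h) + m).-1; rewrite prednK; last first.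
    by case: hd => -[-> dE]; rewrite addn_gt0 muln_gt0 n1 subn_gt0 dE.
  rewrite natrD natrM natrB; last by case: hd => -[-> dE] //; exact: ltnW.
  by rewrite /p -[m.+2]addn2 natrD; field.
have [dens unif mutind indep] := flight n n1 PN0.
have [K K0 KE] := position_law_up_to_constant c0 t0 dens unif mutind indep radial.
(* The whole space has conditional probability 1, which determines [K] as the inverse of the ball
   integral [I]. *)
have mass : (K * ball_power m.+2 (c * t) (p - 1) = 1)%E.
  rewrite -(@probability_setT _ _ _ (cond_prob P N n)) -[setT](preimage_setT (position_after n c t tau V)).
  rewrite KE//; apply: mule_eqr; apply: eq_integral => x _.
  by rewrite indicE mem_set// mule1.
have [I I0 [ballE KI]] := mule_eq1 K0 (ball_power_ge0 _ _ _) mass.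
have [G0 G1 IE] := ball_power_Gamma T0 I0 kE ballE.
rewrite (_ : n.+1%:R / 2 * (m.+2%:R - h%:R) + h%:R / 2 = p + m.+2%:R / 2); last first.
  by rewrite /p -[n.+1]addn1 natrD; field.
rewrite (_ : n.+1%:R * (m.+2%:R - h%:R) + h%:R - 2 = 2 * (p - 1) + m.+2%:R); last first.
  by rewrite /p -[n.+1]addn1 natrD; field.
set const := _ / _ * _^-1.
have constE : const = I^-1.
  by rewrite IE /const [RHS]invfM invf_div.
pose f (x : m.+2.-tuple R) := I^-1 * reflected_profile rad (c * t) (p - 1) x.
match goal with |- has_density _ _ ?g => have -> : g = f end.
  by apply/funext => x; rewrite constE /f /reflected_profile exprMn.
have mrp := @measurable_reflected_profile R m rad (c * t) (p - 1).
have rp0 := @reflected_profile_ge0 R m rad (c * t) (p - 1) r0.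
have mrefl := @measurable_reflect_outside R m rad (c * t).
split.
- apply: (measurableT_comp mrefl (g := position c t N tau V)).
  apply: (measurable_fun_nat_index (f := fun k => position_after k c t tau V)).
    exact: measurable_funP.
  by move=> j; exact: measurable_position_after.
- by rewrite /f; mfun.
- by move=> x; rewrite /f mulr_ge0// invr_ge0 ltW.
move=> A mA.
have mrA : measurable (reflect_outside rad (c * t) @^-1` A : set (m.+2.-tuple R)).
  by rewrite -[X in measurable X]setTI; exact: mrefl.
(* On the event N = n the reflected position is [reflect_outside] applied to [position_after n], and
   the conditional law sees nothing else. *)
transitivity (cond_prob P N n (position_after n c t tau V @^-1` (reflect_outside rad (c * t) @^-1` A))).
  apply: cond_prob_eq => //; apply/seteqP; split => w /= [].
    by rewrite /reflected_position /position => + Nw; rewrite Nw.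
  by rewrite /reflected_position /position => + Nw; rewrite Nw.
rewrite KE// KI.
have mA' : measurable_fun setT (\1_A : m.+2.-tuple R -> R) by exact: measurable_indic.
transitivity ((I^-1)%:E * \int[lebesgue_vec m.+2]_x
    ((profile (c * t) (p - 1) x)%:E * (\1_A (reflect_outside rad (c * t) x))%:E))%E.
  by apply: mule_eqr.
rewrite (integral_reflected _ _ _ (g := fun x => (\1_A x)%:E))//; last first.
  exact/measurable_EFinP.
rewrite mule_integral//; last 3 first.
- by apply: emeasurable_funM; exact/measurable_EFinP.
- by move=> x; rewrite mule_ge0// lee_fin.
- by rewrite lee_fin invr_ge0 ltW.
rewrite [RHS]integral_indicl; apply: eq_integral => x _.
by rewrite /f -!EFinM; congr EFin; ring.
Qed.
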